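(* Let $X\subseteq \mathbb{P}^1\times\mathbb{P}^1\times\mathbb{P}^1$ be a variety of lines. Then $X$ is arithmetically Cohen–Macaulay if and only if $X$ has the $Hyp_n(\star)$-property for $n=4,5,6$.
   Context: $K$ is an algebraically closed field of characteristic zero, $R=K[x_{1,0},x_{1,1},x_{2,0},x_{2,1},x_{3,0},x_{3,1}]$ is trigraded by $\deg x_{i,j}=\mathbf e_i$ and is the coordinate ring of $\mathbb{P}^1\times\mathbb{P}^1\times\mathbb{P}^1$. A hyperplane is the zero locus $\mathcal L(H)$ of a linear form $H$ of degree $\mathbf e_i$ for some $i$ (its type). For hyperplanes $\mathcal L(H),\mathcal L(H')$ of different types, $\mathcal L(H,H')$ denotes the line defined by the ideal $(H,H')$; lines are exactly such loci. A variety of lines is a finite union of distinct lines, with defining ideal $I_X$ the intersection of the ideals of its lines; $X$ is arithmetically Cohen–Macaulay if $R/I_X$ is Cohen–Macaulay. For $n\ge 4$, $X$ has the $Hyp_n(\star)$-property if for any $n$ hyperplanes $H_1,\ldots,H_n$ such that $\mathcal{L}(H_i,H_j)$ is a line of $X$ for all $i,j$ with $j\neq i-1,i,i+1$ (indices modulo $n$, i.e. $H_0=H_n$, $H_{n+1}=H_1$), there exists $u\in\{1,\ldots,n\}$ such that $\mathcal{L}(H_u,H_{u+1})$ is a line of $X$. *)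

(* Defs.v *)
From HB Require Import structures.
From mathcomp Require Import all_boot all_order all_algebra.
From mathcomp Require Import mpoly.
Set Implicit Arguments. Unset Strict Implicit. Unset Printing Implicit Defensive.
Import Order.TTheory GRing.Theory.
Local Open Scope ring_scope.

Section P1P1P1.
Variable K : fieldType.

(* R = K[x_{1,0},x_{1,1},x_{2,0},x_{2,1},x_{3,0},x_{3,1}];
   the variable x_{i+1,j} (i : 'I_3, j : 'I_2) is 'X_(xv i j), index 2i+j. *)
Definition Rpoly := {mpoly K[6]}.

Definition xv (i : 'I_3) (j : 'I_2) : 'I_6 := inord (2 * i + j).

Definition is_lform (i : 'I_3) (H : Rpoly) : Prop :=
  exists a b : K, ((a != 0) || (b != 0)) /\
    H = a *: 'X_(xv i ord0) + b *: 'X_(xv i ord_max).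

Definition is_hyperplane (H : Rpoly) : Prop := exists i, is_lform i H.

(* Points of P^1 x P^1 x P^1, via representatives v : 'I_6 -> K with
   (v(x_{i,0}), v(x_{i,1})) <> (0,0) for every i.  All forms considered are
   multihomogeneous, so vanishing does not depend on the representative. *)
Definition is_point (v : 'I_6 -> K) : Prop :=
  forall i : 'I_3, (v (xv i ord0) != 0) || (v (xv i ord_max) != 0).

Definition in_locus2 (H H' : Rpoly) (v : 'I_6 -> K) : Prop :=
  H.@[v] = 0 /\ H'.@[v] = 0.

Definition same_locus2 (H H' G G' : Rpoly) : Prop :=
  forall v, is_point v -> (in_locus2 H H' v <-> in_locus2 G G' v).

Definition variety_of_lines (X : seq (Rpoly * Rpoly)) : Prop :=
  (forall L, L \in X -> exists i j : 'I_3, i != j /\ is_lform i L.1 /\ is_lform j L.2)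
  /\ (forall k l : nat, (k < size X)%N -> (l < size X)%N -> k <> l ->
        ~ same_locus2 (nth (0, 0) X k).1 (nth (0, 0) X k).2
                      (nth (0, 0) X l).1 (nth (0, 0) X l).2).

Definition line_of (X : seq (Rpoly * Rpoly)) (H H' : Rpoly) : Prop :=
  exists L, L \in X /\ same_locus2 H H' L.1 L.2.

Definition ideal_of (X : seq (Rpoly * Rpoly)) (f : Rpoly) : Prop :=
  forall L, L \in X -> exists a b : Rpoly, f = a * L.1 + b * L.2.

Definition in_ideal_plus (I : Rpoly -> Prop) (fs : seq Rpoly) (g : Rpoly) : Prop :=
  exists h : Rpoly, I h /\ exists c : nat -> Rpoly,
    g = h + \sum_(k < size fs) c k * nth 0 fs k.

Definition in_irrelevant (f : Rpoly) : Prop := f@_0%MM = 0.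

Definition regular_seq (I : Rpoly -> Prop) (fs : seq Rpoly) : Prop :=
  (forall f, f \in fs -> in_irrelevant f) /\
  (forall k : nat, (k < size fs)%N -> forall g : Rpoly,
      in_ideal_plus I (take k fs) (nth 0 fs k * g) -> in_ideal_plus I (take k fs) g) /\
  ~ in_ideal_plus I fs 1.

Definition is_prime_ideal (P : Rpoly -> Prop) : Prop :=
  P 0 /\ (forall a b, P a -> P b -> P (a + b)) /\ (forall a b, P b -> P (a * b)) /\
  ~ P 1 /\ (forall a b, P (a * b) -> P a \/ P b).

Definition prime_chain (I : Rpoly -> Prop) (d : nat) : Prop :=
  exists P : nat -> Rpoly -> Prop,
    (forall k, (k <= d)%N -> is_prime_ideal (P k)) /\
    (forall f, I f -> P 0%N f) /\
    (forall k, (k < d)%N -> (forall f, P k f -> P k.+1 f) /\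
                            exists f, P k.+1 f /\ ~ P k f).

Definition krull_dim_eq (I : Rpoly -> Prop) (d : nat) : Prop :=
  prime_chain I d /\ ~ prime_chain I d.+1.

(* R/I (I a homogeneous ideal) is Cohen-Macaulay: either R/I = 0, or
   depth_m(R/I) = dim(R/I), i.e. there is an R/I-regular sequence in m of
   length dim R/I (depth <= dim always holds). *)
Definition cohen_macaulay (I : Rpoly -> Prop) : Prop :=
  I 1 \/ exists d, krull_dim_eq I d /\ exists fs, size fs = d /\ regular_seq I fs.

Definition ACM (X : seq (Rpoly * Rpoly)) : Prop := cohen_macaulay (ideal_of X).

Definition Hyp_star (n : nat) (X : seq (Rpoly * Rpoly)) : Prop :=
  forall H : 'I_n -> Rpoly,
    (forall i, is_hyperplane (H i)) ->
    (forall i j : 'I_n, j != i -> val j <> (i.+1 %% n)%N -> val i <> (j.+1 %% n)%N ->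
        line_of X (H i) (H j)) ->
    exists u : 'I_n, exists u' : 'I_n, val u' = (u.+1 %% n)%N /\ line_of X (H u) (H u').

End P1P1P1.

(* Main.v *)
(** Encode X by the tripartite graph whose vertices are hyperplanes and whose edges are lines.
    The properties Hyp_4, Hyp_5, Hyp_6 say that the complement of this graph is chordal: the
    three types are cliques of the complement, so longer induced cycles are impossible.

    If the complement is chordal, peeling off simplicial vertices (Dirac) shows that the ideal
    of X plus general linear forms is still an intersection of linear ideals, so that four
    general linear forms are a regular sequence; four is the dimension, as a linear prime of
    height two is minimal over the ideal.

    Conversely, a regular sequence of length four makes the Koszul cohomology of powers of
    generators of the irrelevant ideal vanish in low degrees.  Elements supported in small
    dimension therefore vanish, and general forms of the three types are a regular sequence.
    The quotient by them is monomial and torsion free; this produces a trihomogeneous form in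
    the ideal for any numbers that bound vertex covers between each pair of types.  Divisibility
    by hyperplanes turns these forms into vertex covers of the whole graph, and this covering
    property passes to induced subgraphs, where an antihole contradicts it. *)

From Stdlib Require Import Classical_Prop FunctionalExtensionality PropExtensionality.
Require Import Defs.
From HB Require Import structures.
From mathcomp Require Import all_boot all_order all_algebra.
From mathcomp Require Import mpoly ring.
Set Implicit Arguments. Unset Strict Implicit. Unset Printing Implicit Defensive.
Import GRing.Theory.
Local Open Scope ring_scope.

(** The regular sequence that Cohen-Macaulayness provides consists of arbitrary elements of the
    irrelevant ideal, while the combinatorics needs three very special forms, [a r] for each type
    [r]. Koszul cohomology bridges the gap: its vanishing only asks for powers of the sequence to
    lie in the ideal of the chosen generators, so powers of [x r] and [a r] with any exponents will
    do. As [a r] involves a single type, its regularity is not automatic: an element that it kills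
    is shown to be killed by powers of the variables of two or three types as well, and the depth
    still available excludes this. Each form costs one unit of depth; of the four, one is left for
    torsion freeness of the quotient by all three. Modulo [a r] every hyperplane of type [r] is a
    multiple of one variable, so that products of hyperplanes are compared by their counts per type;
    this is how covers of single pairs of types get combined. Cohen-Macaulayness is not visibly
    inherited by the lines among a subset of the hyperplanes. The combinatorial property [tight] is
    extracted from it because that one does survive the deletion of vertices. *)

Section Ideals.
Variable A : comNzRingType.
Implicit Types (N : A -> Prop) (a b f g w : A).

Definition ideal N : Prop :=
  [/\ N 0, forall a b, N a -> N b -> N (a + b) & forall a b, N b -> N (a * b)].

Definition adjoin N a : A -> Prop := fun f => exists n g, N n /\ f = n + g * a.

Definition regular N a : Prop := forall w, N (a * w) -> N w.

Section Theory.
Variables (N : A -> Prop) (idN : ideal N).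

Lemma ideal0 : N 0. Proof. by case: idN. Qed.
Lemma idealD a b : N a -> N b -> N (a + b). Proof. by case: idN => _ + _; apply. Qed.
Lemma idealMl a b : N b -> N (a * b). Proof. by case: idN => _ _; apply. Qed.
Lemma idealMr a b : N a -> N (a * b). Proof. by rewrite mulrC; apply: idealMl. Qed.
Lemma idealN a : N a -> N (- a). Proof. by rewrite -mulN1r; apply: idealMl. Qed.
Lemma idealB a b : N a -> N b -> N (a - b).
Proof. by move=> Na Nb; apply: idealD => //; apply: idealN. Qed.
Lemma idealDr a b : N a -> N (a + b) -> N b.
Proof. by move=> Na Nab; rewrite -(addKr a b) addrC; apply: idealB. Qed.

Lemma ideal_sum I r (P : pred I) (F : I -> A) :
  (forall i, P i -> N (F i)) -> N (\sum_(i <- r | P i) F i).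
Proof. by move=> NF; apply: (big_ind N) => //; [apply: ideal0 | apply: idealD]. Qed.

Lemma ideal_adjoin a : ideal (adjoin N a).
Proof.
split=> [|f g [n [h [Nn ->]]] [n' [h' [Nn' ->]]]|f g [n [h [Nn ->]]]].
- by exists 0, 0; rewrite mul0r addr0; split=> //; apply: ideal0.
- exists (n + n'), (h + h'); split; first exact: idealD.
  by rewrite mulrDl addrACA.
- by exists (f * n), (f * h); split; [apply: idealMl | rewrite mulrDr mulrA].
Qed.

Lemma adjoin_sub a f : N f -> adjoin N a f.
Proof. by move=> Nf; exists f, 0; rewrite mul0r addr0. Qed.

Lemma adjoin_mul a g : adjoin N a (g * a).
Proof. by exists 0, g; rewrite add0r; split=> //; apply: ideal0. Qed.

Lemma adjoin_mem a : adjoin N a a.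
Proof. by rewrite -[X in adjoin _ _ X]mul1r; apply: adjoin_mul. Qed.

Lemma adjoin_comm a b f : adjoin (adjoin N a) b f -> adjoin (adjoin N b) a f.
Proof.
move=> [_ [g [[n [h [Nn ->]]] ->]]].
by exists (n + g * b), h; rewrite addrAC; split=> //; exists n, g.
Qed.

Lemma regularM a b : regular N a -> regular N b -> regular N (a * b).
Proof. by move=> ra rb w; rewrite -mulrA => /ra/rb. Qed.

Lemma regular_prod I r (P : pred I) (F : I -> A) :
  (forall i, P i -> regular N (F i)) -> regular N (\prod_(i <- r | P i) F i).
Proof.
move=> rF; apply: (big_ind (regular N)) => //; last exact: regularM.
by move=> w; rewrite mul1r.
Qed.

(** A relation [b * w = n + g * a] is a relation for [g] modulo [b]; solving it by regularity of [a]
    and substituting back leaves a multiple of [b] inside [N]. Regularity of [a] modulo [N] itself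
    is not asked for. *)
Lemma regular_swap a b : regular N b -> regular (adjoin N b) a -> regular (adjoin N a) b.
Proof.
move=> rb ra w [n [g [Nn def_bw]]].
have /ra[n' [g' [Nn' def_g]]] : adjoin N b (a * g).
  by exists (- n), w; split; [apply: idealN | rewrite [w * b]mulrC def_bw addKr mulrC].
suff /rb Nw : N (b * (w - g' * a)).
  by exists (w - g' * a), g'; rewrite subrK.
have -> : b * (w - g' * a) = n + n' * a by rewrite mulrBr def_bw def_g; ring.
by apply: idealD => //; apply: idealMr.
Qed.

End Theory.

Lemma adjoin_mono N N' a f : (forall f, N f -> N' f) -> adjoin N a f -> adjoin N' a f.
Proof. by move=> sNN' [n [g [Nn ->]]]; exists n, g; split=> //; apply: sNN'. Qed.

End Ideals.

Section Morphisms.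
Variables (F : fieldType) (n : nat) (S : comNzRingType).
Variables (phi psi : {rmorphism {mpoly F[n]} -> S}).
Hypothesis eqC : forall c, phi c%:MP = psi c%:MP.

(** Congruence modulo [J] passes through sums and products, so constants and variables decide. With
    [idfun] for one morphism it says that a substitution moves polynomials only within the ideal of
    the displacements of the variables. *)
Lemma rmorph_congr (J : S -> Prop) : ideal J ->
  (forall i, J (phi 'X_i - psi 'X_i)) -> forall f, J (phi f - psi f).
Proof.
move=> idJ JX f; have J0 := ideal0 idJ.
have JM a b a' b' : J (a - a') -> J (b - b') -> J (a * b - a' * b').
  move=> Ja Jb; have -> : a * b - a' * b' = a * (b - b') + b' * (a - a').
    by rewrite !mulrBr addrA [b' * a]mulrC subrK [b' * a']mulrC.
  by apply: idealD => //; apply: idealMl.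
rewrite [f]mpolyE !rmorph_sum -sumrB; apply: ideal_sum => // m _.
rewrite -mul_mpolyC !rmorphM; apply: (JM); first by rewrite eqC subrr.
rewrite mpolyXE_id !rmorph_prod; apply: (big_ind2 (fun x y => J (x - y))).
- by rewrite subrr.
- by move=> x x2 y y2 Jx Jy; apply: (JM).
move=> i _; rewrite !rmorphXn; elim: (m i) => [|k IH]; first by rewrite subrr.
by rewrite !exprS; apply: (JM).
Qed.

Lemma rmorph_ext : (forall i, phi 'X_i = psi 'X_i) -> phi =1 psi.
Proof.
move=> eqX f; apply/eqP; rewrite -subr_eq0; apply/eqP.
apply: (rmorph_congr (J := fun x => x = 0)) => [|i].
  by split=> // [a b -> ->|a b ->]; rewrite ?addr0 ?mulr0.
by rewrite eqX subrr.
Qed.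

End Morphisms.

(** * Prime ideals generated by linear forms *)

Section LinearIdeals.
Variables (F : fieldType) (n : nat).
Implicit Types (u : 'rV[F]_n) (f g : {mpoly F[n]}).

Definition linform u : {mpoly F[n]} := \sum_i u 0 i *: 'X_i.

Lemma linform_is_linear : linear linform.
Proof.
move=> a u v; rewrite /linform scaler_sumr -big_split; apply: eq_bigr => i _.
by rewrite !mxE scalerDl scalerA.
Qed.
HB.instance Definition _ :=
  GRing.isLinear.Build F 'rV[F]_n {mpoly F[n]} _ linform linform_is_linear.

Lemma linform_delta i : linform (delta_mx 0 i) = 'X_i.
Proof.
rewrite /linform (bigD1 i) //= big1 ?addr0 => [|j ji]; rewrite mxE eqxx /=.
  by rewrite eqxx scale1r.
by rewrite (negPf ji) scale0r.
Qed.

Lemma linform_coef u i : (linform u)@_U_(i) = u 0 i.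
Proof.
rewrite /linform raddf_sum (bigD1 i) //= mcoeffZ mcoeffXU eqxx mulr1.
by rewrite big1 ?addr0 // => j ji; rewrite mcoeffZ mcoeffXU (negPf ji) mulr0.
Qed.

Lemma linform_inj : injective linform.
Proof. by move=> u v e; apply/rowP => i; rewrite -!linform_coef e. Qed.

Definition linsub (P : 'M[F]_n) : {mpoly F[n]} -> {mpoly F[n]} :=
  mmap (@mpolyC n F) (fun i => linform (row i P)).
HB.instance Definition _ P := GRing.RMorphism.copy (linsub P)
  (mmap (@mpolyC n F) (fun i => linform (row i P))).

Lemma linsubC P c : linsub P c%:MP = c%:MP.
Proof. by rewrite /linsub mmapC. Qed.

Lemma linsubX P i : linsub P 'X_i = linform (row i P).
Proof. by rewrite /linsub mmapX mmap1U. Qed.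

Lemma linsub_lin P u : linsub P (linform u) = linform (u *m P).
Proof.
rewrite {1}/linform rmorph_sum mulmx_sum_row linear_sum; apply: eq_bigr => i _ /=.
by rewrite -mul_mpolyC rmorphM /= linsubC linsubX mul_mpolyC linearZ.
Qed.

(* The linear substitution that kills exactly the row space of M. *)
Definition killmx m (M : 'M[F]_(m, n)) : 'M[F]_n := 1%:M - pinvmx M *m M.

Lemma mul_killmx m (M : 'M[F]_(m, n)) u : (u *m killmx M == 0) = (u <= M)%MS.
Proof.
rewrite mulmxBr mulmx1 mulmxA; apply/eqP/idP => [/eqP|uM]; last by rewrite mulmxKpV ?subrr.
by rewrite subr_eq0 => /eqP ->; rewrite submxMl.
Qed.

(** Defined as a kernel rather than by generators, so that primality comes at once from the target
    being a domain; [linidealP] recovers the generators. *)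
Definition linideal m (M : 'M[F]_(m, n)) f : Prop := linsub (killmx M) f = 0.

Section Theory.
Variables (m : nat) (M : 'M[F]_(m, n)).

Lemma linideal_ideal : ideal (linideal M).
Proof.
rewrite /linideal; split=> [|f g ef eg|f g eg]; first by rewrite rmorph0.
  by rewrite rmorphD /= ef eg addr0.
by rewrite rmorphM /= eg mulr0.
Qed.

Lemma linideal_prime f g : linideal M (f * g) -> linideal M f \/ linideal M g.
Proof.
by rewrite /linideal rmorphM /= => /eqP; rewrite mulf_eq0 => /orP[]/eqP; [left|right].
Qed.

Lemma linideal1 : ~ linideal M 1.
Proof. by rewrite /linideal rmorph1 => /eqP; rewrite oner_eq0. Qed.

Lemma linideal_lin u : linideal M (linform u) <-> (u <= M)%MS.
Proof.
rewrite /linideal linsub_lin -mul_killmx; split=> [e|/eqP->]; last by rewrite linear0.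
by apply/eqP/linform_inj; rewrite linear0.
Qed.

Lemma linidealP f :
  linideal M f <-> exists c : 'I_m -> {mpoly F[n]}, f = \sum_i c i * linform (row i M).
Proof.
split=> [Mf|[c ->]]; last first.
  apply: (ideal_sum linideal_ideal) => i _; apply: (idealMl linideal_ideal).
  by apply/linideal_lin; apply: row_sub.
pose J g := exists c : 'I_m -> {mpoly F[n]}, g = \sum_i c i * linform (row i M).
have idJ : ideal J.
  split=> [|_ _ [c ->] [d ->]|a _ [c ->]].
  - by exists (fun=> 0); rewrite big1 // => i _; rewrite mul0r.
  - exists (fun i => c i + d i); rewrite -big_split; apply: eq_bigr => i _.
    by rewrite mulrDl.
  - exists (fun i => a * c i); rewrite mulr_sumr; apply: eq_bigr => i _.
    by rewrite mulrA.
(* Each variable is moved by a combination of rows of [M], hence so is each polynomial, modulo the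
   ideal [J] of these rows; an element of the kernel is moved to 0. *)
suff: J (idfun f - linsub (killmx M) f) by rewrite Mf subr0.
apply: (rmorph_congr (phi := idfun)) => // [c|i]; first by rewrite /= linsubC.
rewrite /= linsubX -linform_delta -linearB /=.
have -> : delta_mx 0 i - row i (killmx M) = row i (pinvmx M) *m M.
  by rewrite -row_mul /killmx !rowE mulmxBr mulmx1 opprB addrC subrK.
exists (fun j => (row i (pinvmx M) 0 j)%:MP).
rewrite mulmx_sum_row linear_sum; apply: eq_bigr => j _.
by rewrite linearZ /= mul_mpolyC.
Qed.

Lemma linideal_regular u : ~~ (u <= M)%MS -> regular (linideal M) (linform u).
Proof. by move=> uM w /linideal_prime[/linideal_lin|//]; rewrite (negPf uM). Qed.

End Theory.

Lemma linideal_sub m1 m2 (M1 : 'M[F]_(m1, n)) (M2 : 'M[F]_(m2, n)) f :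
  (M1 <= M2)%MS -> linideal M1 f -> linideal M2 f.
Proof.
move=> sM /linidealP[c ->]; apply: (ideal_sum (linideal_ideal M2)) => i _.
apply: (idealMl (linideal_ideal M2)); apply/linideal_lin.
exact: submx_trans (row_sub _ _) sM.
Qed.

Lemma linideal_col m (M : 'M[F]_(m, n)) u f :
  linideal (col_mx M u) f <-> adjoin (linideal M) (linform u) f.
Proof.
split=> [/linidealP[c ->]|[p [g [Mp ->]]]].
  rewrite big_split_ord big_ord1 /=; exists (\sum_i c (lshift 1 i) * linform (row i M)).
  exists (c (rshift m 0)); split.
    by apply/linidealP; exists (fun i => c (lshift 1 i)).
  congr (_ + _); first by apply: eq_bigr => i _; rewrite rowKu.
  by rewrite rowKd; congr (_ * linform _); apply/rowP => j; rewrite mxE.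
have idM := linideal_ideal (col_mx M u).
apply: (idealD idM); first by apply: linideal_sub Mp; rewrite -addsmxE addsmxSl.
by apply: (idealMl idM); apply/linideal_lin; rewrite -addsmxE addsmxSr.
Qed.

End LinearIdeals.

(** * Koszul complexes *)

Section Koszul.
Variable A : comNzRingType.
Implicit Types (N : A -> Prop) (a f u : A) (us cs : seq A).

(* The Koszul cochain complex: a cochain on [u :: us] is [x.1 + x.2 e_u]. *)
Fixpoint koszul us : lmodType A :=
  if us is _ :: us' then (koszul us' * koszul us')%type else A^o.

Fixpoint kdiff us : koszul us -> koszul us :=
  match us with
  | [::] => fun=> 0
  | u :: us' => fun x => (kdiff x.1, u *: x.1 - kdiff x.2)
  end.

Fixpoint kin N us : koszul us -> Prop :=
  match us with
  | [::] => fun x => N x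
  | u :: us' => fun x => kin N x.1 /\ kin N x.2
  end.

Fixpoint khom us k : koszul us -> Prop :=
  match us with
  | [::] => fun x => k = 0%N \/ x = 0
  | u :: us' => fun x => khom k x.1 /\ (if k is k'.+1 then khom k' x.2 else x.2 = 0)
  end.

(** Degree [k - 1], with only 0 in degree -1: where a primitive of a degree [k] cochain has to
    lie. *)
Definition khomp us k (x : koszul us) : Prop := if k is k'.+1 then khom k' x else x = 0.

(** Interior product with [cs], which makes multiplication by [kpairing us cs] null homotopic. A
    list [cs] that is too short is continued by zeros. *)
Fixpoint kcontract us cs : koszul us -> koszul us :=
  match us with
  | [::] => fun=> 0
  | u :: us' => fun x =>
      (kcontract (behead cs) x.1 + head 0 cs *: x.2, - kcontract (behead cs) x.2)
  end.

Fixpoint kpairing us cs : A :=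
  if us is u :: us' then u * head 0 cs + kpairing us' (behead cs) else 0.

Lemma kdiff_is_linear us : linear (@kdiff us).
Proof.
elim: us => [|u us IH] a x y /=; first by rewrite scaler0 addr0.
congr (_, _); rewrite /= !IH //.
by rewrite scalerDr scalerBr !scalerA [u * a]mulrC opprD addrACA.
Qed.
HB.instance Definition _ us :=
  GRing.isLinear.Build A (koszul us) (koszul us) _ (@kdiff us) (@kdiff_is_linear us).

Lemma kcontract_is_linear us cs : linear (@kcontract us cs).
Proof.
elim: us cs => [|u us IH] cs a x y /=; first by rewrite scaler0 addr0.
congr (_, _); rewrite /= !IH; first by rewrite !scalerDr !scalerA [_ * a]mulrC addrACA.
by rewrite opprD scalerN.
Qed.
HB.instance Definition _ us cs := GRing.isLinear.Build A (koszul us) (koszul us) _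
  (@kcontract us cs) (@kcontract_is_linear us cs).

Lemma kdiff_kdiff us (x : koszul us) : kdiff (kdiff x) = 0.
Proof.
elim: us x => [|u us IH] x //=.
by rewrite IH linearB linearZ /= IH subr0 subrr.
Qed.

Lemma khom0 us k : khom k (0 : koszul us).
Proof. by elim: us k => [|u us IH] [|k] /=; auto. Qed.

Lemma khomD us k (x y : koszul us) : khom k x -> khom k y -> khom k (x + y).
Proof.
elim: us k x y => [|u us IH] k x y /=; first by move=> [->|->]; [left|rewrite add0r].
case: k => [|k] [x1 x2] [y1 y2]; split; try exact: IH.
by rewrite x2 y2 addr0.
Qed.

Lemma khomZ us k a (x : koszul us) : khom k x -> khom k (a *: x).
Proof.
elim: us k x => [|u us IH] k x /=; first by move=> [->|->]; [left|rewrite scaler0; right].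
by case: k => [|k] [x1 x2]; split; try exact: IH; rewrite x2 scaler0.
Qed.

Lemma khomN us k (x : koszul us) : khom k x -> khom k (- x).
Proof. by rewrite -scaleN1r; apply: khomZ. Qed.

Lemma khomB us k (x y : koszul us) : khom k x -> khom k y -> khom k (x - y).
Proof. by move=> hx hy; apply: khomD => //; apply: khomN. Qed.

Lemma khomp0 us k : khomp k (0 : koszul us).
Proof. by case: k => [|k] //; apply: khom0. Qed.

Lemma khom_kdiff us k (x : koszul us) : khom k x -> khom k.+1 (kdiff x).
Proof.
elim: us k x => [|u us IH] k x /=; first by right.
case: k => [|k] [x1 x2]; split; try exact: IH.
  by rewrite x2 linear0 subr0; apply: khomZ.
by apply: khomB; [apply: khomZ | apply: IH].
Qed.

Lemma khomp_kdiff us k (x : koszul us) : khomp k x -> khom k (kdiff x).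
Proof. by case: k => [/= ->|k]; [rewrite linear0; apply: khom0 | apply: khom_kdiff]. Qed.

Lemma khomp_kcontract us cs k (x : koszul us) : khom k x -> khomp k (kcontract cs x).
Proof.
elim: us cs k x => [|u us IH] cs k x /=; first by move=> _; apply: khomp0.
case: k => [|k] /= [x1 x2].
  rewrite (IH _ 0%N _ x1) x2 scaler0 addr0.
  by rewrite (IH (behead cs) 0%N _ (khom0 us 0)) oppr0.
split; first by apply: khomD; [apply: (IH _ k.+1) | apply: khomZ].
have := IH (behead cs) k _ x2.
by case: k {x1 x2} => [|k] /= => [->|]; [rewrite oppr0 | apply: khomN].
Qed.

Lemma kcontract_homotopy us cs (x : koszul us) :
  kdiff (kcontract cs x) + kcontract cs (kdiff x) = kpairing us cs *: x.
Proof.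
elim: us cs x => [|u us IH] cs x /=; first by rewrite add0r scale0r.
case: x => x y /=.
congr (_, _) => /=.
  rewrite linearD linearZ /= scalerBr addrACA IH [_ *: kdiff y + _]addrCA subrr addr0.
  by rewrite scalerA -scalerDl addrC mulrC.
rewrite linearN /= opprK linearB linearZ /= opprB scalerDr scalerA.
rewrite [kcontract _ _ - _]addrC addrACA IH [X in X + _]addrAC subrr add0r.
by rewrite -scalerDl.
Qed.

Section Mod.
Variables (N : A -> Prop) (idN : ideal N).

Lemma kin0 us : kin N (0 : koszul us).
Proof. by elim: us => [|u us IH] //=; apply: ideal0. Qed.

Lemma kinD us (x y : koszul us) : kin N x -> kin N y -> kin N (x + y).
Proof.
elim: us x y => [|u us IH] x y /=; first exact: idealD.
by move=> [x1 x2] [y1 y2]; split; apply: IH.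
Qed.

Lemma kinZ us a (x : koszul us) : kin N x -> kin N (a *: x).
Proof.
elim: us x => [|u us IH] x /=; first exact: idealMl.
by move=> [x1 x2]; split; apply: IH.
Qed.

Lemma kinN us (x : koszul us) : kin N x -> kin N (- x).
Proof. by rewrite -scaleN1r; apply: kinZ. Qed.

Lemma kinB us (x y : koszul us) : kin N x -> kin N y -> kin N (x - y).
Proof. by move=> Nx Ny; apply: kinD => //; apply: kinN. Qed.

Lemma kin_kdiff us (x : koszul us) : kin N x -> kin N (kdiff x).
Proof.
elim: us x => [|u us IH] x /=; first by move=> _; apply: ideal0.
by move=> [x1 x2]; split; [apply: IH | apply: kinB; [apply: kinZ | apply: IH]].
Qed.

Lemma kin_kcontract us cs (x : koszul us) : kin N x -> kin N (kcontract cs x).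
Proof.
elim: us cs x => [|u us IH] cs x /=; first by move=> _; apply: ideal0.
move=> [x1 x2]; split; last by apply: kinN; apply: IH.
by apply: kinD; [apply: IH | apply: kinZ].
Qed.

Lemma kin_regular us a (x : koszul us) : regular N a -> kin N (a *: x) -> kin N x.
Proof.
move=> ra; elim: us x => [|u us IH] x /=; first exact: ra.
by move=> [x1 x2]; split; apply: IH.
Qed.

Lemma kin_adjoin us a k (x : koszul us) : kin (adjoin N a) x -> khom k x ->
  exists y : koszul us, khom k y /\ kin N (x - a *: y).
Proof.
elim: us k x => [|u us IH] k x /=.
  move=> [n [g [Nn ->]]] [->|e]; last by exists 0; rewrite e scaler0 subrr; split; [right|apply: ideal0].
  by exists g; split; [left|rewrite /GRing.scale /= [a * g]mulrC addrK].
move=> [x1 x2] [/(IH _ _ x1)[y1 [h1 n1]]].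
case: k {h1 x1} (h1) => [|k] h1.
  move=> x20; exists (y1, 0); split=> //; split=> //.
  by rewrite /= x20 scaler0 subrr; apply: kin0.
by move=> /(IH _ _ x2)[y2 [h2 n2]]; exists (y1, y2).
Qed.

Lemma kin_adjoin_scale us a (x : koszul us) : kin (adjoin N a) (a *: x).
Proof.
elim: us x => [|u us IH] x /=; first by rewrite /GRing.scale /= mulrC; apply: adjoin_mul.
by split; apply: IH.
Qed.

End Mod.

Lemma kin_mono N N' us (x : koszul us) : (forall f, N f -> N' f) -> kin N x -> kin N' x.
Proof.
move=> sNN'; elim: us x => [|u us IH] x /=; first exact: sNN'.
by move=> [x1 x2]; split; apply: IH.
Qed.

Definition kbound N us k (x : koszul us) : Prop :=
  exists2 y : koszul us, khomp k y & kin N (x - kdiff y).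

(* Koszul cohomology of A/N vanishes in degrees < d. *)
Definition acyclic N d us : Prop :=
  forall k (x : koszul us), (k < d)%N -> khom k x -> kin N (kdiff x) -> kbound N k x.

Section Depth.
Variables (N : A -> Prop) (idN : ideal N).

Lemma acyclic0 us : acyclic N 0 us.
Proof. by []. Qed.

(** Multiplication by [f] on [A/N] has cokernel [A/(N + f)]; by the long exact sequence, the
    cohomology of the latter one degree lower is the obstruction to [f] being injective on the
    cohomology of [A/N]. In degree 0 there are no primitives and regularity of [f] is enough. *)
Lemma kbound_divide us d f k (x : koszul us) : regular N f ->
  acyclic (adjoin N f) d us -> (k < d.+1)%N -> khom k x -> kbound N k (f *: x) ->
  kbound N k x.
Proof.
move=> rf ac kd hx [y hy ny].
case: k kd hx hy => [|k] kd hx hy.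
  exists 0 => //; rewrite linear0 subr0; apply: kin_regular rf _.
  by move: ny; rewrite hy linear0 subr0.
have [z hz nz] : kbound (adjoin N f) k y.
  apply: ac => //.
  have -> : kdiff y = f *: x - (f *: x - kdiff y) by rewrite subKr.
  apply: kinB; [exact: ideal_adjoin | exact: kin_adjoin_scale |].
  by apply: kin_mono ny => g; apply: adjoin_sub.
have hyz : khom k (y - kdiff z) by apply: khomB => //; apply: khomp_kdiff.
have [w [hw nw]] := kin_adjoin idN nz hyz.
exists w => //; apply: kin_regular rf _.
have -> : f *: (x - kdiff w) = (f *: x - kdiff y) + kdiff (y - kdiff z - f *: w).
  have -> : kdiff (y - kdiff z - f *: w) = kdiff y - f *: kdiff w.
    by rewrite linearB linearB /= kdiff_kdiff subr0 linearZ.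
  by rewrite scalerBr addrA subrK.
by apply: kinD => //; apply: kin_kdiff.
Qed.

(** By the homotopy a power of [f] kills the cohomology, while [kbound_divide] makes [f] injective
    on it in degrees up to [d]; so it vanishes there. *)
Lemma acyclicS us cs t d f : regular N f -> f ^+ t = kpairing us cs ->
  acyclic (adjoin N f) d us -> acyclic N d.+1 us.
Proof.
move=> rf ft ac k x kd hx nx.
have: kbound N k (f ^+ t *: x).
  exists (kcontract cs x); first exact: khomp_kcontract.
  rewrite ft -kcontract_homotopy addrC addKr.
  exact: kin_kcontract.
elim: t {ft} => [|t IH]; first by rewrite scale1r.
rewrite exprS -scalerA => /(kbound_divide rf ac kd (khomZ _ hx))/IH; exact.
Qed.

(** The same exact sequence read elsewhere: the cohomology of [A/(N + a)] in degree [k] sits between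
    those of [A/N] in degrees [k] and [k + 1], so one degree is lost. *)
Lemma acyclic_adjoin us d a : regular N a -> acyclic N d.+1 us -> acyclic (adjoin N a) d us.
Proof.
move=> ra ac k x kd hx nx.
have [y [hy ny]] := kin_adjoin idN nx (khom_kdiff hx).
have ndy : kin N (kdiff y).
  apply: kin_regular ra _; rewrite -linearZ /=.
  have -> : kdiff (a *: y) = - kdiff (kdiff x - a *: y).
    by rewrite linearB /= kdiff_kdiff sub0r opprK.
  by apply: kinN => //; apply: kin_kdiff.
have [z hz nz] : kbound N k.+1 y by apply: ac.
have hxz : khom k (x - a *: z) by apply: khomB => //; apply: khomZ.
have [|w hw nw] := ac k (x - a *: z) (ltnW kd) hxz.
  have -> : kdiff (x - a *: z) = (kdiff x - a *: y) + a *: (y - kdiff z).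
    by rewrite linearB linearZ /= scalerBr addrA subrK.
  by apply: kinD => //; apply: kinZ.
exists w => //.
have -> : x - kdiff w = (x - a *: z - kdiff w) + a *: z by rewrite addrAC subrK.
apply: kinD; first exact: ideal_adjoin.
  by apply: kin_mono nw => g; apply: adjoin_sub.
exact: kin_adjoin_scale.
Qed.

End Depth.

Fixpoint kconst ss (w : A) : koszul ss :=
  if ss is _ :: ss' then (kconst ss' w, 0) else w.

(* The cochain [w e_1 ... e_n], where the [e_i] are dual to [rest]. *)
Fixpoint kvolume rest ss (w : A) : koszul (rest ++ ss) :=
  match rest with
  | [::] => kconst ss w
  | _ :: rest' => (0, kvolume rest' ss w)
  end.

Fixpoint kcoef0 ss : koszul ss -> A :=
  match ss with [::] => id | _ :: _ => fun x => kcoef0 x.1 end.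

Fixpoint kcoef rest ss : koszul (rest ++ ss) -> A :=
  match rest with
  | [::] => @kcoef0 ss
  | _ :: rest' => fun x => kcoef x.2
  end.

Definition adjoins N (us : seq A) : A -> Prop := foldl (@adjoin A) N us.

Lemma ideal_adjoins N us : ideal N -> ideal (adjoins N us).
Proof. by elim: us N => [|u us IH] N idN //=; apply: IH; apply: ideal_adjoin. Qed.

Lemma adjoins_sub N us f : ideal N -> N f -> adjoins N us f.
Proof.
elim: us N => [|u us IH] N idN Nf //=.
by apply: IH; [apply: ideal_adjoin | apply: adjoin_sub].
Qed.

Lemma adjoins_mem N us u : ideal N -> u \in us -> adjoins N us u.
Proof.
elim: us N => [|v us IH] N idN //=; rewrite inE => /predU1P[->|]; last first.
  by apply: IH; apply: ideal_adjoin.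
apply: adjoins_sub; [exact: ideal_adjoin | exact: adjoin_mem].
Qed.

Section Torsion.
Variables (N : A -> Prop) (idN : ideal N).

Lemma kcoefB rest ss (x y : koszul (rest ++ ss)) : kcoef (x - y) = kcoef x - kcoef y.
Proof.
elim: rest x y => [|r rest IH] x y /=; last exact: IH.
by elim: ss x y => [|s ss IH] x y //=.
Qed.

Lemma kcoefZ rest ss a (x : koszul (rest ++ ss)) : kcoef (a *: x) = a * kcoef x.
Proof.
elim: rest x => [|r rest IH] x /=; last exact: IH.
by elim: ss x => [|s ss IH] x //=.
Qed.

Lemma kcoef_kvolume rest ss w : kcoef (kvolume rest ss w) = w.
Proof. by elim: rest => [|r rest IH] //=; elim: ss => [|s ss IH]. Qed.

Lemma kcoef_kin rest ss (x : koszul (rest ++ ss)) : kin N x -> N (kcoef x).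
Proof.
elim: rest x => [|r rest IH] x /=; last by case=> _ /IH.
by elim: ss x => [|s ss IH] x //= [/IH].
Qed.

(** The monomial formed by the duals of [rest] arises in a differential only by adding one of these
    duals, which brings in the matching element of [rest] as a factor. *)
Lemma kcoef_kdiff rest ss (x : koszul (rest ++ ss)) : adjoins N rest (kcoef (kdiff x)).
Proof.
elim: rest N idN x => [|r rest IH] M idM x /=.
  suff -> : kcoef0 (kdiff x) = 0 by apply: ideal0.
  by elim: ss x => [|s ss IH] x //=.
have idM' := ideal_adjoins rest (ideal_adjoin idM r).
rewrite kcoefB; apply: idealB => //; last first.
  by apply: IH; apply: ideal_adjoin.
rewrite kcoefZ.
apply: idealMr => //; apply: adjoins_sub; first exact: ideal_adjoin.
exact: adjoin_mem.
Qed.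

Lemma khom_kvolume rest ss w : khom (size rest) (kvolume rest ss w).
Proof.
elim: rest => [|r rest IH] /=; last by split=> //; apply: khom0.
by elim: ss => [|s ss IH] /=; [left | split].
Qed.

Lemma kin_kconst ss a w : N (a * w) -> kin N (a *: kconst ss w).
Proof.
move=> Naw; elim: ss => [|s ss IH] //=; rewrite scaler0.
by split=> //; apply: kin0.
Qed.

Lemma kin_kdiff_kvolume rest ss w : (forall s, s \in ss -> N (s * w)) ->
  kin N (kdiff (kvolume rest ss w)).
Proof.
move=> kw; elim: rest => [|r rest IH] /=; last first.
  rewrite linear0 scaler0 sub0r; split; [exact: kin0 | exact: kinN].
elim: ss kw => [|s ss IH] kw /=; first exact: ideal0.
split; first by apply: IH => s' ss'; apply: kw; rewrite inE ss' orbT.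
rewrite linear0 subr0.
apply: kin_kconst; apply: kw; exact: mem_head.
Qed.

(* An element killed by [ss] yields a cocycle in degree [size rest]; if that is a
   coboundary, its coefficient lies in the ideal of [rest]. *)
Lemma acyclic_torsion rest ss w : acyclic N (size rest).+1 (rest ++ ss) ->
  (forall s, s \in ss -> N (s * w)) -> adjoins N rest w.
Proof.
move=> ac kw.
have [y _ ny] := ac _ _ (ltnSn _) (khom_kvolume rest ss w) (kin_kdiff_kvolume rest kw).
have idR := ideal_adjoins rest idN.
have := kcoef_kin ny; rewrite kcoefB kcoef_kvolume => nwy.
rewrite -[w](subrK (kcoef (kdiff y))); apply: idealD => //; last exact: kcoef_kdiff.
exact: adjoins_sub.
Qed.

End Torsion.
End Koszul.

(** * Krull dimension of a polynomial ring *)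

Definition prime_pred (A : comNzRingType) (P : A -> Prop) : Prop :=
  [/\ ideal P, ~ P 1 & forall a b, P (a * b) -> P a \/ P b].

Section PrimePred.
Variables (A : comNzRingType) (P : A -> Prop) (prP : prime_pred P).

Lemma prime_idealP : ideal P. Proof. by case: prP. Qed.
Lemma prime_not1 : ~ P 1. Proof. by case: prP. Qed.
Lemma primeM a b : P (a * b) -> P a \/ P b. Proof. by case: prP => _ _; apply. Qed.

Lemma primeX a k : P (a ^+ k) -> P a.
Proof.
elim: k => [|k IH]; first by move/prime_not1.
by rewrite exprS => /primeM[].
Qed.

Lemma prime_prod I r (Q : pred I) (F : I -> A) :
  P (\prod_(i <- r | Q i) F i) -> exists i, Q i /\ P (F i).
Proof.
elim: r => [|i r IH]; first by rewrite big_nil => /prime_not1.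
by rewrite big_cons; case: ifP => // Qi /primeM[|//]; exists i.
Qed.

End PrimePred.

(* Coquand-Lombardi: along a chain of primes [P k] with [x k] in [P k.+1] but not in [P k],
   a relation between the [x k] is stripped down to its lexicographically least monomial. *)
Lemma prime_chain_strip (A : comNzRingType) (E : finType) (P : nat -> A -> Prop) (d : nat)
    (x : nat -> A) (ex : E -> nat -> nat) (C : E -> A) (M0 : {set E}) :
  (forall k, (k <= d)%N -> prime_pred (P k)) ->
  (forall k, (k < d)%N -> forall f, P k f -> P k.+1 f) ->
  (forall k, (k < d)%N -> P k.+1 (x k) /\ ~ P k (x k)) ->
  M0 != set0 -> P 0%N (\sum_(e in M0) C e * \prod_(0 <= i < d) x i ^+ ex e i) ->
  exists M : {set E}, [/\ M \subset M0, M != set0,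
    {in M &, forall e e', forall i, (i < d)%N -> ex e i = ex e' i} &
    P d (\sum_(e in M) C e)].
Proof.
move=> prP incP xP M0n0 P0.
suff: forall k, (k <= d)%N -> exists M : {set E}, [/\ M \subset M0, M != set0,
    {in M &, forall e e', forall i, (i < k)%N -> ex e i = ex e' i} &
    P k (\sum_(e in M) C e * \prod_(k <= i < d) x i ^+ ex e i)].
  move=> /(_ d (leqnn d))[M [sM Mn0 eqM PM]]; exists M; split=> //.
  move: PM; congr (P d _); apply: eq_bigr => e _.
  by rewrite big_geq ?mulr1.
elim=> [|k IH] kd; first by exists M0; split.
have [M [sM Mn0 eqM PM]] := IH (ltnW kd).
have [e0 e0M] := set0Pn _ Mn0.
case: (arg_minnP (fun e => ex e k) e0M) => e1 e1M0 min_e1; have e1M : e1 \in M := e1M0.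
(* The factor [x k ^+ m] can be cancelled because [x k] is outside the prime [P k]. Terms with a
   larger exponent keep a factor [x k] and so lie in [P k.+1], which leaves [M']. *)
pose m := ex e1 k; pose M' := [set e in M | ex e k == m].
have [xk1 xk0] := xP k kd.
exists M'; split.
- by apply: subset_trans sM; apply/subsetP => e; rewrite inE => /andP[].
- by apply/set0Pn; exists e1; rewrite inE e1M eqxx.
- move=> e e'; rewrite !inE => /andP[eM /eqP ek] /andP[e'M /eqP e'k] i.
  rewrite ltnS leq_eqVlt => /predU1P[->|]; first by rewrite ek e'k.
  exact: eqM.
have {PM}: P k (x k ^+ m * \sum_(e in M) C e * (x k ^+ (ex e k - m) *
                  \prod_(k.+1 <= i < d) x i ^+ ex e i)).
  move: PM; congr (P k _); rewrite mulr_sumr; apply: eq_bigr => e eM.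
  rewrite big_ltn // [RHS]mulrCA; congr (_ * _); rewrite mulrA -exprD subnKC //.
  exact: min_e1.
move=> /(primeM (prP k (ltnW kd)))[/(primeX (prP k (ltnW kd)))//|].
move/(incP k kd); rewrite (bigID (mem M')) /=.
have idP := prime_idealP (prP _ kd).
rewrite addrC; set r := (X in P k.+1 (X + _) -> _) => Prt.
have Pr : P k.+1 r.
  apply: ideal_sum => // e /andP[eM]; rewrite inE eM /= => ek.
  apply: idealMl => //; apply: idealMr => //.
  have : (0 < ex e k - m)%N by rewrite subn_gt0 ltn_neqAle eq_sym ek; apply: min_e1.
  by case: (_ - _)%N => // j _; rewrite exprS; apply: idealMr.
have := idealDr idP Pr Prt; congr (P _ _); apply: eq_big => [e|e].
  by rewrite !inE; case: (e \in M).
by rewrite inE => /andP[_ /andP[_ /eqP->]]; rewrite subnn mul1r.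
Qed.

Section Dimension.
Variables (F : fieldType) (n : nat).

Lemma msizeM_leS (p q : {mpoly F[n]}) a b :
  (msize p <= a.+1)%N -> (msize q <= b.+1)%N -> (msize (p * q) <= (a + b).+1)%N.
Proof.
have [->|p0] := eqVneq p 0; first by rewrite mul0r msize0.
have [->|q0] := eqVneq q 0; first by rewrite mulr0 msize0.
rewrite msizeM // => pa qb; have := leq_add pa qb; rewrite addSn addnS.
by case: (_ + _)%N.
Qed.

Lemma algebraic_dependence m (x : 'I_m -> {mpoly F[n]}) : (n < m)%N ->
  exists N, exists c : {ffun 'I_m -> 'I_N} -> F,
    (exists e, c e != 0) /\ \sum_e c e *: \prod_i x i ^+ e i = 0.
Proof.
(* There are [N ^ m] products, and all exponents in their expansions are below [B]. Since
   [B <= N * C] and [C ^ n < N], one gets [B ^ n <= N ^ n * C ^ n < N ^ n.+1 <= N ^ m]. *)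
move=> nm; pose D := (\max_i msize (x i))%N.
pose C := (m * D).+1; pose N := (C ^ n).+1; pose B := (m * (N * D)).+1.
pose E := {ffun 'I_m -> 'I_N}; pose G := {ffun 'I_n -> 'I_B}.
pose mon (e : E) := \prod_i x i ^+ e i.
have szmon e : (msize (mon e) <= B)%N.
  have : (msize (mon e) <= (\sum_(i < m) e i * D).+1)%N.
    apply: (big_ind2 (fun (p : {mpoly F[n]}) a => (msize p <= a.+1)%N)).
    - by rewrite msize1.
    - by move=> p a q b; apply: msizeM_leS.
    move=> i _; elim: (nat_of_ord (e i)) => [|k IH]; first by rewrite msize1.
    rewrite exprS mulSn; apply: msizeM_leS IH.
    by apply: leqW; apply: (leq_bigmax (F := fun i => msize (x i))).
  move/leq_trans; apply; rewrite ltnS -[X in (_ <= X * _)%N](card_ord m) -sum_nat_const.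
  by apply: leq_sum => i _; rewrite leq_mul2r ltnW ?orbT.
pose W := \matrix_(i < #|{: E}|, j < #|{: G}|)
  (mon (enum_val i))@_[multinom (enum_val j k : nat) | k < n].
have ltGE : (#|{: G}| < #|{: E}|)%N.
  rewrite !card_ffun !card_ord; apply: (@leq_ltn_trans ((N * C) ^ n)%N).
    have BNC : (B <= N * C)%N by rewrite /B /C mulnS mulnCA -add1n leq_add2r.
    by case: (posnP n) => [->|n0]; rewrite ?expn0 // leq_exp2r.
  rewrite expnMn; apply: (@leq_trans (N ^ n.+1)); last by rewrite leq_exp2l // ltnS expn_gt0.
  by rewrite expnSr ltn_pmul2l ?expn_gt0 // ltnS.
have : kermx W != 0.
  rewrite -mxrank_eq0 mxrank_ker subn_eq0 -ltnNge.
  by apply: leq_ltn_trans ltGE; apply: rank_leq_col.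
case/rowV0Pn => v /sub_kermxP vW v0.
exists N, (fun e => v 0 (enum_rank e)); split.
  have [j vj] := rV0Pn _ v0.
  by exists (enum_val j); rewrite enum_valK.
apply/mpolyP => k; rewrite mcoeff0.
have [kB|kB] := ltnP (mdeg k) B; last first.
  rewrite raddf_sum big1 // => e _; rewrite /= mcoeffZ.
  suff -> : (mon e)@_k = 0 by rewrite mulr0.
  by apply/eqP; rewrite mcoeff_eq0; apply: msize_mdeg_ge; apply: leq_trans kB.
have kiB i : (k i < B)%N.
  by apply: leq_ltn_trans kB; rewrite mdegE (bigD1 i) //= leq_addr.
pose g : G := [ffun i => Ordinal (kiB i)].
have := congr1 (fun M : 'rV_ _ => M 0 (enum_rank g)) vW; rewrite /= !mxE => <-.
rewrite raddf_sum (reindex (@enum_val E predT)) /=; last first.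
  by apply: onW_bij; apply: enum_val_bij.
apply: eq_bigr => j _; rewrite mcoeffZ enum_valK mxE enum_rankK; congr (_ * _@__).
by apply/mnmP => i; rewrite mnmE ffunE.
Qed.

(** Elements chosen from the successive differences of the chain satisfy a relation with constant
    coefficients. Stripping leaves a single exponent vector, so a nonzero constant would lie in the
    last prime. *)
Theorem mpoly_dimension (P : nat -> {mpoly F[n]} -> Prop) :
  (forall k, (k <= n.+1)%N -> prime_pred (P k)) ->
  (forall k, (k < n.+1)%N -> (forall f, P k f -> P k.+1 f) /\
                             exists f, P k.+1 f /\ ~ P k f) -> False.
Proof.
move=> prP incP.
have [x xP] : exists x : nat -> {mpoly F[n]}, forall k, (k < n.+1)%N -> P k.+1 (x k) /\ ~ P k (x k).
  have: forall d, (d <= n.+1)%N -> exists x : nat -> {mpoly F[n]},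
      forall k, (k < d)%N -> P k.+1 (x k) /\ ~ P k (x k).
    elim=> [|d IH] dn; first by exists (fun=> 0).
    have [x xP] := IH (ltnW dn); have [_ [f fP]] := incP d dn.
    exists (fun k => if k == d then f else x k) => k; rewrite ltnS leq_eqVlt.
    case/predU1P => [->|kd]; first by rewrite eqxx.
    by rewrite ltn_eqF //; apply: xP.
  by move=> /(_ n.+1 (leqnn _)).
have [N [c [[e0 ce0] rel]]] := algebraic_dependence (fun i : 'I_n.+1 => x i) (ltnSn n).
pose E := {ffun 'I_n.+1 -> 'I_N}.
have P0 : P 0%N (\sum_(e in [set e : E | c e != 0])
    (c e)%:MP * \prod_(0 <= i < n.+1) x i ^+ e (inord i)).
  rewrite (_ : \sum_(e in _) _ = 0); first exact: ideal0 (prime_idealP (prP 0%N _)).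
  rewrite -[RHS]rel [RHS](bigID (fun e : E => c e != 0)) /= [X in _ = _ + X]big1; last first.
    by move=> e; rewrite negbK => /eqP->; rewrite scale0r.
  rewrite addr0; apply: eq_big => [e|e _]; first by rewrite inE.
  rewrite mul_mpolyC big_mkord; congr (_ *: _); apply: eq_bigr => i _.
  by rewrite inord_val.
have supp0 : [set e : E | c e != 0] != set0 by apply/set0Pn; exists e0; rewrite inE.
have [] := prime_chain_strip prP (fun k kn => proj1 (incP k kn)) xP supp0 P0.
move=> M [/subsetP sM Mn0 eqM PM].
have [e1 e1M] := set0Pn _ Mn0.
have /eqP defM : M == [set e1].
  rewrite eqEsubset sub1set e1M andbT; apply/subsetP => e eM; rewrite inE; apply/eqP.
  apply/ffunP => i; apply/val_inj.
  by have := eqM _ _ eM e1M i (ltn_ord i); rewrite inord_val.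
have ce1 := sM _ e1M; rewrite inE in ce1.
move: PM; rewrite defM big_set1 => PM.
apply: (prime_not1 (prP n.+1 (leqnn _))).
have idP := prime_idealP (prP n.+1 (leqnn _)).
have := idealMl idP (c e1)^-1%:MP PM.
by rewrite -mpolyCM mulVf.
Qed.

End Dimension.

(** * Tripartite graphs without antiholes *)

Section TripartiteGraph.
Variables (T : finType) (ty : T -> 'I_3) (E : rel T).
Hypotheses (symE : forall u v, E u v = E v u) (Ety : forall u v, E u v -> ty u != ty v).

(** In this and the next two definitions the vertices are listed in the cyclic order of a would-be
    induced cycle of the complement: the premises are its chords, the conclusion its sides. *)
Definition no_antihole4 : Prop := forall a b c d, E a c -> E b d ->
  [|| E a b, E b c, E c d | E d a].
Definition no_antihole5 : Prop := forall a b c d e, E a c -> E a d -> E b d -> E b e ->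
  E c e -> [|| E a b, E b c, E c d, E d e | E e a].
Definition no_antihole6 : Prop := forall a b c d e f, E a c -> E a d -> E a e -> E b d ->
  E b e -> E b f -> E c e -> E c f -> E d f -> [|| E a b, E b c, E c d, E d e, E e f | E f a].

(* [v] is a simplicial vertex of the complement graph on [U]. *)
Definition simplicial (U : {set T}) v : Prop :=
  v \in U /\ {in U &, forall a b, ~~ E v a -> ~~ E v b -> ~~ E a b}.

Lemma irrE u : E u u = false.
Proof. by apply/negP => /Ety; rewrite eqxx. Qed.

Section Dirac.
Hypotheses (hole4 : no_antihole4) (hole5 : no_antihole5) (hole6 : no_antihole6).

Let nE : rel T := fun x y => ~~ E x y.

Lemma ord3_pigeonhole (a b c d : 'I_3) :
  [|| a == b, a == c, a == d, b == c, b == d | c == d].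
Proof.
by move: a b c d; do 4![case=> [[|[|[|?]]] ?] //].
Qed.

Lemma ord3_third (a b c d : 'I_3) :
  a != b -> c != a -> c != b -> d != a -> d != b -> c = d.
Proof.
move=> ab ca cb da db; have := ord3_pigeonhole a b c d.
rewrite (negPf ab) (eq_sym a c) (negPf ca) (eq_sym a d) (negPf da).
by rewrite (eq_sym b c) (negPf cb) (eq_sym b d) (negPf db) => /eqP.
Qed.

(* A shortest path outside the non-neighbours of [v] joining two neighbours of [v]
   closes up to an antihole; the three types bound its length. *)
Lemma separator_clique (v s t : T) (p : seq T) : E s t -> ~~ E v s -> ~~ E v t ->
  all (E v) p -> path nE s (rcons p t) -> False.
Proof.
move=> st vs vt pv pst.
elim: {p}(size p).+1 {-2}p (ltnSn (size p)) pv pst => // m IH p pm pv pst.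
(* The path may be taken shortest, so [E] joins any two of its vertices that are not consecutive. Up
   to three interior vertices this closes up with [v] to one of the forbidden antiholes. *)
have short q : all (E v) q -> path nE s (rcons q t) -> (size p <= size q)%N.
  move=> qv qst; rewrite leqNgt; apply/negP => qp.
  by apply: (IH q _ qv qst); apply: leq_trans qp _.
have sv : ~~ E s v by rewrite symE.
have tv : ~~ E t v by rewrite symE.
have ts : E t s by rewrite symE.
clear IH.
case: p pm pv pst short => [|c1 p] pm; first by rewrite /= /nE st.
case: p pm => [|c2 p] pm; rewrite /= ?andbT.
  move=> vc1 /andP[sc1 c1t] _.
  by have /or4P[] := hole4 vc1 st; apply/negP; rewrite // symE.
case: p pm => [|c3 p] pm; rewrite /= ?andbT.
  move=> /andP[vc1 vc2] /and3P[sc1 c12 c2t] short.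
  have sc2 : E s c2.
    apply/negPn/negP; rewrite -/(nE _ _) => h; have := short [:: c2]; rewrite /= vc2 h c2t.
    by move/(_ isT isT).
  have c1t : E c1 t.
    apply/negPn/negP; rewrite -/(nE _ _) => h; have := short [:: c1]; rewrite /= vc1 sc1 h.
    by move/(_ isT isT).
  by have /or4P[||| /orP[]] := hole5 vc1 vc2 sc2 st c1t; apply/negP; rewrite // symE.
case: (lastP p) pm => [|q ck] pm; rewrite /= ?andbT.
  move=> /and3P[vc1 vc2 vc3] /and4P[sc1 c12 c23 c3t] short.
  have sc2 : E s c2.
    apply/negPn/negP; rewrite -/(nE _ _) => h; have := short [:: c2; c3]; rewrite /= vc2 vc3 c23 h c3t.
    by move/(_ isT isT).
  have sc3 : E s c3.
    apply/negPn/negP; rewrite -/(nE _ _) => h; have := short [:: c3]; rewrite /= vc3 h c3t.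
    by move/(_ isT isT).
  have c13 : E c1 c3.
    apply/negPn/negP; rewrite -/(nE _ _) => h; have := short [:: c1; c3]; rewrite /= vc1 vc3 sc1 h c3t.
    by move/(_ isT isT).
  have c1t : E c1 t.
    apply/negPn/negP; rewrite -/(nE _ _) => h; have := short [:: c1]; rewrite /= vc1 sc1 h.
    by move/(_ isT isT).
  have c2t : E c2 t.
    apply/negPn/negP; rewrite -/(nE _ _) => h; have := short [:: c1; c2]; rewrite /= vc1 vc2 sc1 c12 h.
    by move/(_ isT isT).
  have /or4P[||| /or3P[]] := hole6 vc1 vc2 vc3 sc2 sc3 st c13 c1t c2t;
  by apply/negP; rewrite // symE.
(* With four or more interior vertices the types are exhausted: [c2] and [c3] must share a type,
   [c1] has that of [s] and the last interior vertex that of [t]. Then [v], [s], [t] and [c2] would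
   have four different types. *)
rewrite all_rcons !rcons_path last_rcons.
move=> /and4P[vc1 vc2 vc3 /andP[vck vq]] /and5P[sc1 c12 c23 pq ckt] short.
have {}short r : (size r < size q + 4)%N -> all (E v) r -> path nE s (rcons r t) -> False.
  rewrite addn4 => h rv /(short _ rv); rewrite size_rcons => h'.
  by move: (leq_trans h h'); rewrite ltnn.
have sz k : (k < 4)%N -> (k < size q + 4)%N by move=> h; apply: leq_trans h (leq_addl _ _).
have szq k : (k < 4)%N -> (size q + k < size q + 4)%N by rewrite ltn_add2l.
have nty a b : (nE a b -> False) -> ty a != ty b.
  by move=> h; apply: Ety; apply/negPn/negP.
have tail : path nE c3 (rcons (rcons q ck) t) by rewrite !rcons_path last_rcons pq.
have allq : all (E v) (rcons q ck) by rewrite all_rcons vck.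
have sc2 : ty s != ty c2.
  apply: nty => h; apply: (short [:: c2, c3 & rcons q ck]) => /=.
  - by rewrite size_rcons -addn3; apply: szq.
  - by rewrite vc2 vc3.
  - by rewrite h c23.
have sc3 : ty s != ty c3.
  apply: nty => h; apply: (short [:: c3 & rcons q ck]) => /=.
  - by rewrite size_rcons -addn2; apply: szq.
  - by rewrite vc3.
  - by rewrite h.
have sck : ty s != ty ck.
  apply: nty => h; apply: (short [:: ck]) => /=; first exact: sz.
  - by rewrite vck.
  - by rewrite h ckt.
have c1t : ty c1 != ty t.
  apply: nty => h; apply: (short [:: c1]) => /=; first exact: sz.
  - by rewrite vc1.
  - by rewrite h sc1.
have c2t : ty c2 != ty t.
  apply: nty => h; apply: (short [:: c1; c2]) => /=; first exact: sz.
  - by rewrite vc1 vc2.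
  - by rewrite h sc1 c12.
have c3t : ty c3 != ty t.
  apply: nty => h; apply: (short [:: c1; c2; c3]) => /=; first exact: sz.
  - by rewrite vc1 vc2 vc3.
  - by rewrite h sc1 c12 c23.
have c13 : ty c1 != ty c3.
  apply: nty => h; apply: (short [:: c1, c3 & rcons q ck]) => /=.
  - by rewrite size_rcons -addn3; apply: szq.
  - by rewrite vc1 vc3.
  - by rewrite h sc1.
have c2k : ty c2 != ty ck.
  apply: nty => h; apply: (short [:: c1; c2; ck]) => /=; first exact: sz.
  - by rewrite vc1 vc2 vck.
  - by rewrite h sc1 c12 ckt.
have c23' : ty c3 = ty c2 by apply: (@ord3_third (ty s) (ty t)); rewrite // eq_sym // Ety.
have c1s : ty c1 = ty s.
  by apply: (@ord3_third (ty t) (ty c2)); rewrite // 1?eq_sym // -?c23' // 1?eq_sym // Ety.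
have ckt' : ty ck = ty t.
  by apply: (@ord3_third (ty s) (ty c2)); rewrite // 1?eq_sym // Ety.
have := ord3_pigeonhole (ty v) (ty s) (ty t) (ty c2).
have := Ety vc1; have := Ety vc3; have := Ety vck.
rewrite c1s c23' ckt' => /negPf-> /negPf-> /negPf->; rewrite (negPf (Ety st)) /=.
by rewrite (negPf sc2) eq_sym (negPf c2t).
Qed.

(** Dirac's theorem, with the second clause added to carry the induction. In the complement, let [C]
    be the component of [u] among the non-neighbours of [v] and [S] its boundary, a clique by
    [separator_clique]. A vertex of [C] has no neighbours in [U] outside [C :|: S], so it is enough
    to find one that is simplicial in this smaller set. *)
Lemma simplicial_exists_and_avoids (U : {set T}) :
  (U != set0 -> exists v, simplicial U v) /\
  (forall v u, v \in U -> u \in U -> E v u -> exists x, simplicial U x /\ E v x).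
Proof.
have [m] := ubnP #|U|; elim: m => // m IH in U *; rewrite ltnS => Um.
suff avoid v u : v \in U -> u \in U -> E v u -> exists x, simplicial U x /\ E v x.
  split=> // /set0Pn[v vU].
  have [/existsP[u /existsP[w /and3P[uU wU Euw]]]|] :=
    boolP [exists u, exists w, [&& u \in U, w \in U & E u w]].
    by have [x [sx _]] := avoid _ _ uU wU Euw; exists x.
  rewrite negb_exists => /forallP noE; exists v; split=> // a b aU bU _ _.
  by have := noE a; rewrite negb_exists => /forallP/(_ b); rewrite aU bU.
move=> vU uU Evu; pose W := [set x in U | E v x].
pose r := [rel x y | [&& nE x y, x \in W & y \in W]].
have symr : connect_sym r.
  by apply: sym_connect_sym => x y; rewrite /= /nE symE [(y \in W) && _]andbC.
pose C := [set x in W | connect r u x].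
have CW : {subset C <= W} by move=> x; rewrite inE => /andP[].
have WE x : x \in W -> E v x by rewrite inE => /andP[].
have WU x : x \in W -> x \in U by rewrite inE => /andP[].
pose S := [set s in U | (s \notin C) && [exists c in C, nE s c]].
have CC x y : x \in C -> y \in W -> nE x y -> y \in C.
  move=> xC yW xy; rewrite inE yW /=; have := xC; rewrite inE => /andP[xW ux].
  by apply: connect_trans ux _; apply: connect1; rewrite /= xy xW.
have SW s : s \in S -> ~~ E v s.
  rewrite inE => /and3P[sU sC /existsP[c /andP[cC sc]]]; apply/negP => Evs.
  by case/negP: sC; apply: (CC c) => //; rewrite ?inE ?sU // /nE symE.
have Sclique : {in S &, forall s t, ~~ E s t}.
  move=> s t sS tS; apply/negP => Est; have [vs vt] := (SW s sS, SW t tS).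
  move: sS tS; rewrite !inE => /and3P[_ _ /existsP[c /andP[cC sc]]].
  move=> /and3P[_ _ /existsP[d /andP[dC td]]].
  have /connectP[p pr dp] : connect r c d.
    apply: (@connect_trans _ _ u); last by move: dC; rewrite inE => /andP[].
    by rewrite symr; move: cC; rewrite inE => /andP[].
  apply: (@separator_clique v s t (c :: p)) => //=.
    rewrite WE ?CW //=; elim: p (c) pr {dp} => //= y p IHp z /andP[/and3P[_ _ yW] /IHp ->].
    by rewrite WE.
  have dt : nE d t by rewrite /nE symE.
  rewrite sc rcons_path -dp dt andbT.
  by apply: sub_path pr => x y /and3P[].
have uC : u \in C by rewrite !inE uU Evu connect0.
pose U' := C :|: S.
have subU : {subset U' <= U}.
  by move=> x; rewrite inE => /orP[/CW/WU//|]; rewrite inE => /andP[].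
have U'm : (#|U'| < m)%N.
  apply: leq_trans Um; apply: proper_card; apply/properP; split; first exact/subsetP.
  exists v => //; rewrite inE negb_or; apply/andP; split.
    by apply/negP => /CW/WE; rewrite irrE.
  rewrite inE !negb_and negb_exists; apply/or3P/Or33/forallP => c.
  by rewrite negb_and negbK orbC; case: (boolP (c \in C)) => [/CW/WE->|]; rewrite ?orbT.
suff [x [xC sx]] : exists x, x \in C /\ simplicial U' x.
  exists x; split; last by apply/WE/CW.
  have inU' a : a \in U -> nE x a -> a \in U'.
    move=> aU xa; rewrite inE; case: (boolP (a \in C)) => //= aC.
    rewrite inE aU aC; apply/existsP; exists x; rewrite xC /nE symE; exact: xa.
  split; first by apply/WU/CW.
  move=> a b aU bU xa xb; case: sx => _; apply => //; exact: inU'.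
(* If some [s] of the boundary is not joined in the complement to all of [U'], the second clause
   gives a simplicial vertex not joined to [s], hence outside the clique [S]. Otherwise [S] is
   joined to everything and a simplicial vertex of [C] stays simplicial in [U']. *)
have [/existsP[s /existsP[w /and3P[sS wU' Esw]]]|] :=
    boolP [exists s, exists w, [&& s \in S, w \in U' & E s w]].
  have sU' : s \in U' by rewrite inE sS orbT.
  have [_ /(_ s w sU' wU' Esw)[x [sx Esx]]] := IH U' U'm.
  exists x; split=> //; case: (sx) => xU' _; move: xU'; rewrite inE => /orP[//|xS].
  by have := Sclique _ _ sS xS; rewrite Esx.
rewrite negb_exists => /forallP univ.
have {}univ s w : s \in S -> w \in U' -> ~~ E s w.
  by move=> sS wU'; have := univ s; rewrite negb_exists => /forallP/(_ w); rewrite sS wU'.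
have Cm : (#|C| < m)%N by apply: leq_ltn_trans U'm; apply: subset_leq_card; apply: subsetUl.
have [|x [xC sx]] := (IH C Cm).1; first by apply/set0Pn; exists u.
exists x; split=> //; split; first by rewrite inE xC.
move=> a b aU' bU' xa xb.
have [aS|aS] := boolP (a \in S); first exact: univ.
have [bS|bS] := boolP (b \in S); first by rewrite symE; apply: univ.
by apply: sx => //; [move: aU' | move: bU']; rewrite in_setU ?(negPf aS) ?(negPf bS) orbF.
Qed.

Lemma simplicial_exists (U : {set T}) : U != set0 -> exists v, simplicial U v.
Proof. by case: (simplicial_exists_and_avoids U). Qed.

End Dirac.
End TripartiteGraph.

(** * Vertex covers with prescribed counts in each type *)

Section Covers.
Variables (T : finType) (ty : T -> 'I_3).
Implicit Types (E : rel T) (C W : {set T}) (c : 'I_3 -> nat).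

Definition tyset r : {set T} := [set v | ty v == r].

Definition covers E C : Prop := forall u v, E u v -> (u \in C) || (v \in C).

Definition covers_off E r C : Prop :=
  forall u v, E u v -> ty u != r -> ty v != r -> (u \in C) || (v \in C).

Definition nbr E r v : {set T} := [set u | E v u & ty u == r].

Definition heavy E c r s : {set T} := [set v | (ty v == r) && (c s < #|nbr E s v|)%N].

(** Between any two types the graph is a Ferrers graph, that is, it has no induced pair of disjoint
    edges. *)
Definition nested E : Prop := forall r u v, ty u = ty v ->
  (nbr E r u \subset nbr E r v) || (nbr E r v \subset nbr E r u).

Definition coverable_off E c r : Prop :=
  exists C, covers_off E r C /\ forall t, t != r -> (#|C :&: tyset t| <= c t)%N.

(* Vertex covers with prescribed type counts, found separately for each pair of types, exist
   simultaneously. *)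
Definition glueable E : Prop := forall c, (forall r, coverable_off E c r) ->
  exists C, covers E C /\ forall t, (#|C :&: tyset t| <= c t)%N.

(** A form of glueability that can be carried to induced subgraphs: in type [r] the cover consists
    exactly of vertices that the bound [c s] forces into any cover. *)
Definition tight E : Prop := forall c r, coverable_off E c r ->
  exists C s, [/\ covers E C, forall t, t != r -> (#|C :&: tyset t| <= c t)%N,
    s != r & C :&: tyset r = heavy E c r s].

(* [E] without the vertices of [S]. *)
Definition hollow E (S : {set T}) : rel T := [rel u v | [&& E u v, u \notin S & v \notin S]].

Definition cset c r i : 'I_3 -> nat := fun t => if t == r then i else c t.

Section OneGraph.
Variable E : rel T.
Hypotheses (symE : forall u v, E u v = E v u) (Ety : forall u v, E u v -> ty u != ty v).

Lemma nested_union (A : {set T}) r s k : nested E -> A \subset tyset r ->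
  (forall v, v \in A -> (#|nbr E s v| <= k)%N) -> (#|\bigcup_(v in A) nbr E s v| <= k)%N.
Proof.
move=> nE Ar; have [->|A0] := eqVneq A set0; first by rewrite big_set0 cards0.
have [v0 v0A] := set0Pn _ A0.
case: (arg_maxnP (fun v => #|nbr E s v|) v0A) => v vA0 vmax Ak.
have vA : v \in A := vA0.
apply: leq_trans (Ak v vA); apply: subset_leq_card; apply/bigcupsP => u uA.
have tuv : ty u = ty v.
  by move/subsetP: Ar => Ar; have := Ar _ uA; have := Ar _ vA; rewrite !inE => /eqP-> /eqP->.
case/orP: (nE s u v tuv) => // vu.
by rewrite (_ : nbr E s u = nbr E s v) //; apply/esym/eqP; rewrite eqEcard vu; apply: vmax.
Qed.

(** Heavy vertices together with all neighbours of the light ones: by nestedness the latter form the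
    neighbourhood of a single light vertex, hence number at most [c s]. *)
Lemma ferrers_cover c r s : nested E -> s != r -> exists X : {set T}, [/\
    forall u v, E u v -> ty u = r -> ty v = s -> (u \in X) || (v \in X),
    X :&: tyset r = heavy E c r s, (#|X :&: tyset s| <= c s)%N &
    forall v, v \in X -> (ty v == r) || (ty v == s)].
Proof.
move=> nE sr; pose D := heavy E c r s; pose U := \bigcup_(v in tyset r :\: D) nbr E s v.
have cardU : (#|U| <= c s)%N.
  apply: (@nested_union _ r) => //; first exact: subsetDl.
  by move=> v; rewrite !inE => /andP[+ tv]; rewrite tv -leqNgt.
have Us v : v \in U -> ty v = s by case/bigcupP => u _; rewrite inE => /andP[_ /eqP].
have Dr v : v \in D -> ty v = r by rewrite inE => /andP[/eqP].
exists (D :|: U); split.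
- move=> u v Euv tu tv; rewrite !in_setU.
  case: (boolP (u \in D)) => //= uD; apply/orP; right; apply/orP; right.
  by apply/bigcupP; exists u; rewrite inE ?uD ?inE ?tu ?Euv ?tv /=.
- apply/setP => v; rewrite in_setI in_setU [v \in tyset r]inE.
  apply/idP/idP => [/andP[/orP[//|/Us->]]|vD]; first by rewrite (negPf sr).
  by rewrite vD (Dr v vD) eqxx.
- apply: leq_trans cardU; apply: subset_leq_card.
  apply/subsetP => v; rewrite in_setI in_setU [v \in tyset s]inE => /andP[/orP[/Dr->|//]].
  by rewrite eq_sym (negPf sr).
- by move=> v; rewrite in_setU => /orP[/Dr->|/Us->]; rewrite eqxx ?orbT.
Qed.

(** For [t] other than [r] the pair to be covered is [r] with the third type [s], and
    [ferrers_cover] spends in type [r] only the vertices heavy for [s]. *)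
Lemma coverable_off_max c r : nested E -> coverable_off E c r ->
  forall t, coverable_off E (cset c r (\max_(s | s != r) #|heavy E c r s|)) t.
Proof.
move=> nE [C [Coff Cle]] t; set i := (\max_(s | _) _)%N.
have [->|tr] := eqVneq t r.
  by exists C; split=> // s sr; rewrite /cset (negPf sr); apply: Cle.
have [s [sr st third]] : exists s, [/\ s != r, s != t & forall x, [|| x == r, x == s | x == t]].
  have [s /andP[sr st]|] := pickP [pred s | (s != r) && (s != t)]; last first.
    move: tr; move: r t {C Coff Cle i}; do 2![case=> [[|[|[|?]]] ?] //] => _;
    move=> h; by [have := h ord0 | have := h ord_max | have := h (Ordinal (isT : (1 < 3)%N))].
  exists s; split=> // x; have := ord3_pigeonhole r s t x.
  by rewrite (eq_sym r s) (negPf sr) (eq_sym r t) (negPf tr) (negPf st) ![_ == x]eq_sym.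
have [X [half Xr Xs Xty]] := ferrers_cover c nE sr.
exists X; split.
  move=> u v Euv tut tvt; have tuv := Ety Euv.
  have /or3P[/eqP tu|/eqP tu|] := third (ty u); last by rewrite (negPf tut).
    apply: half => //; have /or3P[|/eqP//|] := third (ty v); last by rewrite (negPf tvt).
    by rewrite eq_sym -tu (negPf tuv).
  rewrite orbC; apply: half => //; first by rewrite symE.
  have /or3P[/eqP//||] := third (ty v); last by rewrite (negPf tvt).
  by rewrite eq_sym -tu (negPf tuv).
move=> x xt; have /or3P[/eqP->|/eqP->|] := third x; last by rewrite (negPf xt).
  by rewrite /cset eqxx Xr; apply: (leq_bigmax_cond (F := fun s => #|heavy E c r s|)).
by rewrite /cset (negPf sr).
Qed.

Lemma heavy_sub c r s C : (forall u v, E u v -> ty u = r -> ty v = s -> (u \in C) || (v \in C)) ->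
  (#|C :&: tyset s| <= c s)%N -> heavy E c r s \subset C.
Proof.
move=> cov cs; apply/subsetP => v; rewrite inE => /andP[/eqP tv].
apply: contraTT => vC; rewrite -leqNgt; apply: leq_trans cs.
apply: subset_leq_card; apply/subsetP => u; rewrite !inE => /andP[Evu tu]; rewrite tu andbT.
by have := cov _ _ Evu tv (eqP tu); rewrite (negPf vC).
Qed.

(** The glued cover has no more vertices of type [r] than the largest heavy set, and it must contain
    that set; so the two agree. *)
Lemma glueable_tight : nested E -> glueable E -> tight E.
Proof.
move=> nE gE c r cov; have [C [covC cC]] := gE _ (coverable_off_max nE cov).
have [s sr smax] : {s | s != r & (\max_(s | s != r) #|heavy E c r s|)%N = #|heavy E c r s|}.
  apply: eq_bigmax_cond; apply/card_gt0P.
  by case: (eqVneq r ord0) => [->|r0]; [exists ord_max | exists ord0]; rewrite /in_mem //= eq_sym.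
exists C, s; split=> // [t tr|]; first by have := cC t; rewrite /cset (negPf tr).
have := cC r; rewrite /cset eqxx smax => le.
apply/esym/eqP; rewrite eqEcard le andbT subsetI; apply/andP; split.
  apply: heavy_sub => [u v /covC//|]; by have := cC s; rewrite /cset (negPf sr).
by apply/subsetP => v; rewrite !inE => /andP[].
Qed.

(** A tight cover minus [S] works. Its vertices of type [r] are heavy for [s], and deleting vertices
    of type [r] does not change their neighbours of type [s]; so the cover given for the pair [r],
    [s] contains them all and bounds their number by [c r]. *)
Lemma tight_glueable_hollow r (S : {set T}) : S \subset tyset r -> tight E ->
  glueable (hollow E S).
Proof.
move=> /subsetP Sr tE c cov.
have [C [s [covC cC sr Cr]]] : exists C s, [/\ covers E C,
    forall t, t != r -> (#|C :&: tyset t| <= c t)%N, s != r & C :&: tyset r = heavy E c r s].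
  apply: tE; have [C [covC cC]] := cov r; exists C; split=> // u v Euv ur vr.
  apply: covC => //; rewrite /hollow /= Euv /=; apply/andP; split; apply/negP => /Sr; rewrite inE.
    by rewrite (negPf ur).
  by rewrite (negPf vr).
exists (C :\: S); split.
  by move=> u v /and3P[/covC + uS vS]; rewrite !inE uS vS.
move=> t; have [->|tr] := eqVneq t r; last first.
  by apply: leq_trans (cC t tr); apply/subset_leq_card/setSI/subsetDl.
have [x [xr xs]] : exists x, x != r /\ x != s.
  move: sr; move: r s {Sr cov cC Cr}; do 2![case=> [[|[|[|?]]] ?] //] => _;
  by [exists ord0 | exists ord_max | exists (Ordinal (isT : (1 < 3)%N))].
have [C' [covC' cC']] := cov x.
apply: leq_trans (cC' r _); last by rewrite eq_sym.
apply: subset_leq_card; apply/subsetP => v; rewrite !inE => /andP[/andP[vS vC] vr].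
rewrite vr andbT; have : v \in heavy E c r s by rewrite -Cr !inE vC.
rewrite inE => /andP[_]; apply: contraTT => vC'; rewrite -leqNgt.
apply: leq_trans (cC' s _); last by rewrite eq_sym.
apply: subset_leq_card; apply/subsetP => u; rewrite !inE => /andP[Evu us]; rewrite us andbT.
have := covC' v u; rewrite (negPf vC') /hollow /= Evu vS (eqP vr) (eqP us) ![_ == x]eq_sym xr xs.
by apply=> //; apply/negP => /Sr; rewrite inE (eqP us) (negPf sr).
Qed.

End OneGraph.

Lemma nested_hollow E (S : {set T}) : nested E -> nested (hollow E S).
Proof.
move=> nE r u v tuv.
have nb w : nbr (hollow E S) r w = if w \in S then set0 else nbr E r w :\: S.
  apply/setP => x; case: ifP => wS; rewrite !inE /hollow /= wS ?andbF //=.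
  by case: (E w x); case: (x \in S); rewrite ?andbF ?andbT.
rewrite !nb; case: ifP => _; first by rewrite sub0set.
case: ifP => _; first by rewrite sub0set orbT.
by case/orP: (nE r u v tuv) => h; apply/orP; [left|right]; apply: setSD.
Qed.

Lemma hollow_sym E S : (forall u v, E u v = E v u) ->
  forall u v, hollow E S u v = hollow E S v u.
Proof. by move=> symE u v; rewrite /hollow /= symE; congr (_ && _); apply: andbC. Qed.

Lemma hollow_ty E S : (forall u v, E u v -> ty u != ty v) ->
  forall u v, hollow E S u v -> ty u != ty v.
Proof. by move=> Ety u v /= /andP[/Ety]. Qed.

Section Induced.
Variable E : rel T.
Hypotheses (symE : forall u v, E u v = E v u) (Ety : forall u v, E u v -> ty u != ty v).
Hypotheses (nE : nested E) (tE : tight E).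

Lemma tight_hollow r (S : {set T}) : S \subset tyset r -> tight (hollow E S).
Proof.
move=> Sr; apply: glueable_tight; [exact: hollow_sym | exact: hollow_ty | exact: nested_hollow |].
exact: tight_glueable_hollow Sr tE.
Qed.

End Induced.

Section Rainbow.
Variable E : rel T.
Hypotheses (symE : forall u v, E u v = E v u) (Ety : forall u v, E u v -> ty u != ty v).
Hypotheses (nE : nested E) (tE : tight E).

(* Glueability of the graph induced on [W], for one vertex fewer than [W] in each type. *)
Lemma rainbow_independent (W : {set T}) :
  (forall s t, s != t -> exists p q, [/\ p \in W, q \in W, ty p = s, ty q = t & ~~ E p q]) ->
  exists x : 'I_3 -> T, forall s, [/\ x s \in W, ty (x s) = s & forall t, ~~ E (x s) (x t)].
Proof.
move=> pairs; pose S r := tyset r :\: W.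
have Sr r : S r \subset tyset r by apply: subsetDl.
pose o1 : 'I_3 := Ordinal (isT : (1 < 3)%N).
pose E1 := hollow E (S ord0); pose E2 := hollow E1 (S o1); pose E3 := hollow E2 (S ord_max).
have sym1 := @hollow_sym _ (S ord0) symE; have ty1 := @hollow_ty _ (S ord0) Ety.
have sym2 := @hollow_sym _ (S o1) sym1; have ty2 := @hollow_ty _ (S o1) ty1.
have n1 := nested_hollow (S ord0) nE; have n2 := nested_hollow (S o1) n1.
have t1 := tight_hollow symE Ety nE tE (Sr ord0).
have t2 := tight_hollow sym1 ty1 n1 t1 (Sr o1).
have g3 : glueable E3 by apply: (@tight_glueable_hollow E2 ord_max _ _ t2).
have E3E u v : u \in W -> v \in W -> E3 u v = E u v.
  by move=> uW vW; rewrite /E3 /E2 /E1 /hollow /= /S !inE uW vW /= !andbT.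
have E3W u v : E3 u v -> (u \in W) && (v \in W).
  have inW w : w \notin S ord0 -> w \notin S o1 -> w \notin S ord_max -> w \in W.
    rewrite !inE; case: (w \in W) => //=.
    by case: (ty w) => [[|[|[|?]]] ?].
  move=> /andP[/andP[/andP[_ /andP[u0 v0]] /andP[u1 v1]] /andP[u2 v2]].
  by rewrite !inW.
have [C [covC cC]] : exists C, covers E3 C /\
    forall t, (#|C :&: tyset t| <= #|W :&: tyset t|.-1)%N.
  apply: g3 => r.
  have [s [t [st sr tr]]] : exists s t : 'I_3, [/\ s != t, s != r & t != r].
    by case: r => [[|[|[|?]]] ?] //; [exists o1, ord_max | exists ord0, ord_max | exists ord0, o1].
  have [p [q [pW qW tp tq Epq]]] := pairs _ _ st.
  (* A non-adjacent pair may be left out together when only the edges between its two types have to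
     be covered. *)
  exists (W :\: [set p; q]); split.
    move=> u v uv ur vr; have /andP[uW vW] := E3W _ _ uv.
    rewrite !in_setD uW vW !andbT -negb_and; apply/negP; rewrite !inE.
    have Euv : E u v by rewrite -E3E.
    case/andP => /orP[]/eqP eu /orP[]/eqP ev; move: Euv; rewrite eu ev; try exact/negP.
    - by move/Ety; rewrite eqxx.
    - by rewrite symE; apply/negP.
    - by move/Ety; rewrite eqxx.
  move=> x xr.
  have [y [yW tyx ypq]] : exists y, [/\ y \in W, ty y = x & y \in [set p; q]].
    have := ord3_pigeonhole r s t x; rewrite (eq_sym r s) (negPf sr) (eq_sym r t) (negPf tr).
    rewrite (eq_sym r x) (negPf xr) (negPf st) /= => /orP[]/eqP <-.
      by exists p; rewrite pW tp !inE eqxx.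
    by exists q; rewrite qW tq !inE eqxx orbT.
  rewrite -ltnS prednK; last by apply/card_gt0P; exists y; rewrite !inE yW tyx /=.
  apply: proper_card; apply/properP; split; first by apply/setSI/subsetDl.
  by exists y; rewrite !inE ?yW ?tyx //=; move: ypq; rewrite !inE => ->.
have pick s : exists x, [&& x \in W, x \notin C & ty x == s].
  have [t st] : exists t : 'I_3, s != t.
    by case: (eqVneq s ord0) => [->|s0]; [exists ord_max | exists ord0].
  have [p [_ [pW _ tp _ _]]] := pairs _ _ st.
  have Wpos : (0 < #|W :&: tyset s|)%N by apply/card_gt0P; exists p; rewrite !inE pW tp /=.
  apply/existsP; apply: contraLR (cC s); rewrite -ltnNge negb_exists => /forallP h.
  rewrite prednK //; apply: subset_leq_card; apply/subsetP => x; rewrite !inE => /andP[xW xs].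
  by have := h x; rewrite xW xs andbT negbK => ->.
exists (fun s => xchoose (pick s)) => s.
have /and3P[xW xC /eqP xs] := xchooseP (pick s); split=> // t.
have /and3P[yW yC _] := xchooseP (pick t).
by apply/negP; rewrite -E3E // => /covC; rewrite (negPf xC) (negPf yC).
Qed.

End Rainbow.
End Covers.

(** * Tight nested graphs have no antiholes *)

Section NoAntihole.
Variables (T : finType) (ty : T -> 'I_3) (E : rel T).
Hypotheses (symE : forall u v, E u v = E v u) (Ety : forall u v, E u v -> ty u != ty v).
Hypotheses (nE : nested ty E) (tE : tight ty E).

(** The sides of the closed polygon [a :: l], in both orientations. *)
Definition steps (A : Type) (a : A) (l : seq A) : seq (A * A) :=
  zip (a :: l) (rcons l a) ++ zip (rcons l a) (a :: l).

Let meets (s t : 'I_3) (L : seq ('I_3 * 'I_3)) : bool :=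
  has (fun p => (p.1 == s) && (p.2 == t)) L.

Lemma meets5 (a b c d e s t : 'I_3) : a != c -> a != d -> b != d -> b != e -> c != e ->
  s != t -> meets s t (steps a [:: b; c; d; e]).
Proof. by move: a b c d e s t; do 7![case=> [[|[|[|?]]] ?] //]. Qed.

Lemma meets6 (a b c d e f s t : 'I_3) : a != c -> a != d -> a != e -> b != d -> b != e ->
  b != f -> c != e -> c != f -> d != f -> s != t -> meets s t (steps a [:: b; c; d; e; f]).
Proof.
move=> ac ad ae bd be bf ce cf df; move: s t ac ad ae bd be bf ce cf df.
by move: a b c d e f; do 6![case=> [[|[|[|?]]] ?] //]; do 2![case=> [[|[|[|?]]] ?] //].
Qed.

(** Only for length four can a pair of types fail to occur on consecutive vertices. The two
    exceptional patterns are induced pairs of disjoint edges between two types, which [nested]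
    forbids. *)
Lemma meets4 (a b c d : 'I_3) : a != c -> b != d ->
  (a == b) && (c == d) \/ (b == c) && (d == a) \/
  forall s t, s != t -> meets s t (steps a [:: b; c; d]).
Proof.
move: a b c d; do 4![case=> [[|[|[|?]]] ?] //] => _ _;
by [left | right; left | right; right; do 2![case=> [[|[|[|?]]] ?] //]].
Qed.

Lemma rainbow_of_steps (a : T) (l : seq T) :
  all (fun p => ~~ E p.1 p.2) (steps a l) ->
  (forall s t, s != t -> meets s t (steps (ty a) (map ty l))) ->
  exists x y z, [/\ [/\ x \in a :: l, y \in a :: l & z \in a :: l],
    [/\ ty x != ty y, ty x != ty z & ty y != ty z] & [/\ ~~ E x y, ~~ E x z & ~~ E y z]].
Proof.
move=> /allP nadj types.
have stepsE : steps (ty a) (map ty l) = [seq (ty p.1, ty p.2) | p <- steps a l].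
  rewrite /steps map_cat -map_rcons -map_cons.
  have mz (s t : seq T) : zip (map ty s) (map ty t) = [seq (ty p.1, ty p.2) | p <- zip s t].
    by elim: s t => [|x s IH] [|y t] //=; rewrite IH.
  by rewrite !mz.
have [|x xP] := @rainbow_independent T ty E symE Ety nE tE [set x in a :: l].
  move=> s t /types; rewrite stepsE /meets has_map => /hasP[[p q] pq /= /andP[/eqP ps /eqP qt]].
  have mem_zip (u v : seq T) : (p, q) \in zip u v -> (p \in u) && (q \in v).
    elim: u v => [|y u IH] [|z v] //=; rewrite !inE => /predU1P[[-> ->]|/IH/andP[-> ->]].
      by rewrite !eqxx.
    by rewrite !orbT.
  have /andP[pl ql] : (p \in a :: l) && (q \in a :: l).
    by move: pq; rewrite mem_cat => /orP[]/mem_zip; rewrite mem_rcons => /andP[-> ->].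
  by exists p, q; split=> //; [rewrite inE | rewrite inE | exact: (nadj _ pq)].
pose o1 : 'I_3 := Ordinal (isT : (1 < 3)%N).
have [[W0 t0 n0] [W1 t1 n1] [W2 t2 n2]] := And3 (xP ord0) (xP o1) (xP ord_max).
by exists (x ord0), (x o1), (x ord_max); rewrite t0 t1 t2; split=> //; split=> //; move: W0 W1 W2; rewrite !inE.
Qed.

Definition far n i j : bool := [&& i != j, j != i.+1 %% n & i != j.+1 %% n]%N.

(* The complement of an antihole is a cycle, hence has no triangle. *)
Lemma antihole_contra (a : T) (l : seq T) : let n := size (a :: l) in
  all (fun i => all (fun j => all (fun k =>
    [|| i == j, i == k, j == k, far n i j, far n i k | far n j k])
    (iota 0 n)) (iota 0 n)) (iota 0 n) ->
  all (fun i => all (fun j => far n i j ==> E (nth a (a :: l) i) (nth a (a :: l) j))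
    (iota 0 n)) (iota 0 n) ->
  all (fun p => ~~ E p.1 p.2) (steps a l) ->
  (forall s t, s != t -> meets s t (steps (ty a) (map ty l))) -> False.
Proof.
move=> n /allP tri /allP dist adj types.
have [x [y [z [[xl yl zl] [xy xz yz] [nxy nxz nyz]]]]] := rainbow_of_steps adj types.
have idx w : w \in a :: l -> index w (a :: l) \in iota 0 n.
  by rewrite mem_iota add0n index_mem.
have nfar v w : v \in a :: l -> w \in a :: l -> ~~ E v w ->
    far n (index v (a :: l)) (index w (a :: l)) = false.
  move=> vl wl nvw; apply: contraNF nvw => h.
  have /allP/(_ _ (idx _ wl)) := dist _ (idx _ vl).
  by rewrite h /= !nth_index.
have neq v w : v \in a :: l -> w \in a :: l -> ty v != ty w ->
    (index v (a :: l) == index w (a :: l)) = false.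
  move=> vl wl; apply: contraNF => /eqP e.
  by rewrite -(nth_index a vl) -(nth_index a wl) e.
have /allP/(_ _ (idx _ yl))/allP/(_ _ (idx _ zl)) := tri _ (idx _ xl).
by rewrite !nfar // !neq.
Qed.

Lemma tight_no_antihole4 : no_antihole4 E.
Proof.
move=> a b c d Eac Ebd; apply/negP => /negP; rewrite !negb_or => /and4P[ab bc cd da].
have Eca : E c a by rewrite symE.
have Edb : E d b by rewrite symE.
have [/andP[/eqP tab /eqP tcd]|[/andP[/eqP tbc /eqP tda]|types]] := meets4 (Ety Eac) (Ety Ebd).
- case/orP: (nE (ty c) tab) => /subsetP.
    by move/(_ c); rewrite !inE Eac eqxx (negPf bc) => /(_ isT).
  by move/(_ d); rewrite !inE Ebd tcd eqxx symE (negPf da) => /(_ isT).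
- case/orP: (nE (ty d) tbc) => /subsetP.
    by move/(_ d); rewrite !inE Ebd eqxx (negPf cd) => /(_ isT).
  by move/(_ a); rewrite !inE Eca tda eqxx symE (negPf ab) => /(_ isT).
apply: (@antihole_contra a [:: b; c; d] _ _ _ types) => //; first by rewrite /= Eac Ebd Eca Edb.
by rewrite /= ab bc cd da (symE b) ab (symE c) bc (symE d) cd symE da.
Qed.

Lemma tight_no_antihole5 : no_antihole5 E.
Proof.
move=> a b c d e Eac Ead Ebd Ebe Ece; apply/negP => /negP.
rewrite !negb_or => /and5P[ab bc cd de ea].
have [Eca Eda Edb Eeb Eec] : [/\ E c a, E d a, E d b, E e b & E e c].
  by rewrite (symE c a) (symE d a) (symE d b) (symE e b) (symE e c).
have types s t : s != t -> meets s t (steps (ty a) (map ty [:: b; c; d; e])).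
  by apply: meets5; apply: Ety.
apply: (@antihole_contra a [:: b; c; d; e] _ _ _ types) => //.
  by rewrite /= Eac Ead Ebd Ebe Ece Eca Eda Edb Eeb Eec.
by rewrite /= ab bc cd de ea (symE b) ab (symE c) bc (symE d) cd (symE e) de symE ea.
Qed.

Lemma tight_no_antihole6 : no_antihole6 E.
Proof.
move=> a b c d e f Eac Ead Eae Ebd Ebe Ebf Ece Ecf Edf; apply/negP => /negP.
rewrite !negb_or => /and5P[ab bc cd de /andP[ef fa]].
have [Eca Eda Eea] : [/\ E c a, E d a & E e a] by rewrite (symE c a) (symE d a) (symE e a).
have [Edb Eeb Efb] : [/\ E d b, E e b & E f b] by rewrite (symE d b) (symE e b) (symE f b).
have [Eec Efc Efd] : [/\ E e c, E f c & E f d] by rewrite (symE e c) (symE f c) (symE f d).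
have types s t : s != t -> meets s t (steps (ty a) (map ty [:: b; c; d; e; f])).
  by apply: meets6; apply: Ety.
apply: (@antihole_contra a [:: b; c; d; e; f] _ _ _ types) => //.
  by rewrite /= Eac Ead Eae Ebd Ebe Ebf Ece Ecf Edf Eca Eda Eea Edb Eeb Efb Eec Efc Efd.
by rewrite /= ab bc cd de ef fa (symE b) ab (symE c) bc (symE d) cd (symE e) de (symE f) ef
  symE fa.
Qed.

End NoAntihole.

(** * Translations and gradings as expansions *)

Section Expansions.
Variables (F : fieldType) (n : nat).
Local Notation R := {mpoly F[n]}.
Implicit Types (N : R -> Prop) (u : 'rV[F]_n) (f g w : R).

(** With one extra variable, translations and gradings both become ring morphisms, so stability of
    an ideal can be checked on its generators. *)
Definition expand (x : 'I_n -> {poly R}) : R -> {poly R} :=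
  mmap (polyC \o @mpolyC n F) x.
HB.instance Definition _ x := GRing.RMorphism.copy (expand x) (mmap (polyC \o @mpolyC n F) x).

Lemma expandC x c : expand x c%:MP = c%:MP%:P.
Proof. by rewrite /expand mmapC. Qed.

Lemma expandX x i : expand x 'X_i = x i.
Proof. by rewrite /expand mmapX mmap1U. Qed.

Lemma expand_lin x u : expand x (linform u) = \sum_i (u 0 i)%:MP%:P * x i.
Proof.
rewrite /linform rmorph_sum; apply: eq_bigr => i _ /=.
by rewrite -mul_mpolyC rmorphM /= expandC expandX.
Qed.

Lemma horner_expand x (a : R) : (forall i, (x i).[a] = 'X_i) -> forall f, (expand x f).[a] = f.
Proof.
move=> xa f; apply: (rmorph_ext (phi := horner_eval a \o expand x) (psi := idfun)) => [c|i] /=.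
  by rewrite expandC /horner_eval hornerC.
by rewrite expandX /horner_eval xa.
Qed.

Definition stable (phi : R -> {poly R}) N : Prop := forall f, N f -> forall k, N (phi f)`_k.

Section Stable.
Variable phi : {rmorphism R -> {poly R}}.

Lemma stable_adjoin N l q : ideal N -> phi l = l%:P * q -> stable phi N -> stable phi (adjoin N l).
Proof.
move=> idN phil sN _ [f [g [Nf ->]]] k; rewrite rmorphD rmorphM /= phil coefD.
exists (phi f)`_k, (phi g * q)`_k; split; first exact: sN.
by rewrite mulrCA coefCM mulrC.
Qed.

Lemma stable_linideal m (M : 'M[F]_(m, n)) :
  (forall i, exists q, phi (linform (row i M)) = (linform (row i M))%:P * q) ->
  stable phi (linideal M).
Proof.
move=> phiM f /linidealP[c ->] k; rewrite rmorph_sum coef_sum.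
apply: (ideal_sum (linideal_ideal M)) => i _; have [q phil] := phiM i.
rewrite rmorphM /= phil mulrCA coefCM.
by apply: (idealMr (linideal_ideal M)); apply/linideal_lin; apply: row_sub.
Qed.

End Stable.

(** ** Translations *)

Definition translate i : R -> {poly R} := expand (fun j => ('X_j)%:P + (j == i)%:R *: 'X).
HB.instance Definition _ i := GRing.RMorphism.copy (translate i)
  (expand (fun j => ('X_j)%:P + (j == i)%:R *: 'X)).

Lemma translate_lin i u : translate i (linform u) = (linform u)%:P + (u 0 i)%:MP *: 'X.
Proof.
rewrite /translate expand_lin.
under eq_bigr do rewrite mulrDr -polyCM mul_mpolyC.
rewrite big_split /= -rmorph_sum; congr (_ + _).
rewrite (bigD1 i) //= eqxx scale1r mul_polyC big1 ?addr0 // => j /negPf->.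
by rewrite scale0r mulr0.
Qed.

Lemma translate0 i f : (translate i f)`_0 = f.
Proof.
rewrite -horner_coef0; apply: horner_expand => j.
by rewrite hornerD hornerC hornerZ hornerX mulr0 addr0.
Qed.

(* A linear form that involves a direction of translation is regular modulo a
   translation-stable ideal: compare the coefficients from the top. *)
Lemma translate_regular N i u : ideal N -> stable (translate i) N -> u 0 i != 0 ->
  regular N (linform u).
Proof.
move=> idN sN ui w /sN; rewrite rmorphM /= translate_lin; set p := translate i w => Nk.
suff Np k : N p`_k by rewrite -(translate0 i w); apply: Np.
have [m] := ubnP (size p - k); elim: m => // m IH in k *; rewrite ltnS => km.
have [pk|kp] := leqP (size p) k; first by rewrite nth_default //; apply: ideal0.
have := Nk k.+1; rewrite mulrDl coefD coefCM -scalerAl coefZ coefXM /= => h.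
have Nk1 : N p`_k.+1.
  by apply: IH; apply: leq_trans km; rewrite ltn_sub2l.
have := idealDr idN (idealMl idN (linform u) Nk1) h.
move=> /(idealMl idN (u 0 i)^-1%:MP).
by rewrite mulrA -mpolyCM mulVf // mul1r.
Qed.

(** ** Gradings *)

Section Grading.
Variables (J : finType) (vt : 'I_n -> J).
Implicit Types (r s : J) (c : J -> nat).

Definition grade r : R -> {poly R} :=
  expand (fun j => ('X_j)%:P * (if vt j == r then 'X else 1)).
HB.instance Definition _ r := GRing.RMorphism.copy (grade r)
  (expand (fun j => ('X_j)%:P * (if vt j == r then 'X else 1))).

Definition tdeg r (m : 'X_{1..n}) : nat := (\sum_(j | vt j == r) m j)%N.

Definition of_type r u : Prop := forall j, vt j != r -> u 0 j = 0.

Lemma gradeC r a : grade r a%:MP = a%:MP%:P.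
Proof. exact: expandC. Qed.

Lemma grade_lin r u : of_type r u -> grade r (linform u) = (linform u)%:P * 'X.
Proof.
move=> ur; rewrite /grade expand_lin rmorph_sum mulr_suml; apply: eq_bigr => j _ /=.
rewrite -mul_mpolyC polyCM mulrA; case: eqVneq => // /ur->.
by rewrite mpolyC0 !mul0r.
Qed.

Lemma grade_lin_neq r s u : of_type s u -> s != r -> grade r (linform u) = (linform u)%:P.
Proof.
move=> us sr; rewrite /grade expand_lin rmorph_sum; apply: eq_bigr => j _ /=.
rewrite -mul_mpolyC polyCM; case: eqVneq => [e|]; last by rewrite mulr1.
by rewrite us ?mpolyC0 ?mul0r // e eq_sym.
Qed.

Lemma grade_lin_ex r s u : of_type s u -> exists q, grade r (linform u) = (linform u)%:P * q.
Proof.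
have [<-|sr] := eqVneq s r; first by exists 'X; rewrite grade_lin.
by move=> us; exists 1; rewrite (grade_lin_neq us) ?mulr1.
Qed.

Lemma grade_monomial r m : grade r 'X_[m] = 'X_[m] *: 'X^(tdeg r m).
Proof.
rewrite {1}mpolyXE_id rmorph_prod -mul_polyC [X in X%:P * _]mpolyXE_id rmorph_prod /=.
rewrite /tdeg expr_sum.
rewrite [X in _ * X]big_mkcond -big_split; apply: eq_bigr => j _ /=.
rewrite rmorphXn /= [grade r _]expandX exprMn -polyC_exp; congr (_ * _).
by case: ifP => _; rewrite ?expr1n.
Qed.

Lemma gradeE r f : grade r f = \sum_(m <- msupp f) (f@_m *: 'X_[m]) *: 'X^(tdeg r m).
Proof.
rewrite {1}[f]mpolyE rmorph_sum; apply: eq_bigr => m _ /=.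
rewrite -mul_mpolyC rmorphM /= gradeC grade_monomial -mul_polyC -[LHS]mulr1.
by rewrite mulr1 -mul_polyC mulrA -polyCM mul_polyC.
Qed.

Definition component r k f : R := (grade r f)`_k.

Lemma component_coef r k f m : (component r k f)@_m = f@_m *+ (tdeg r m == k).
Proof.
rewrite /component gradeE coef_sum raddf_sum /=.
have [mf|mf] := boolP (m \in msupp f); last first.
  rewrite memN_msupp_eq0 // mul0rn big_seq big1 // => m' m'f.
  rewrite coefZ coefXn mulr_natr mcoeffMn mcoeffZ mcoeffX.
  by case: eqVneq => [e|]; [rewrite -e m'f in mf | rewrite mulr0 mul0rn].
rewrite (bigD1_seq m) //= big1_seq ?addr0 => [|m' /andP[ne _]].
  by rewrite coefZ coefXn mulr_natr mcoeffMn mcoeffZ mcoeffX eqxx mulr1 eq_sym.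
by rewrite coefZ coefXn mulr_natr mcoeffMn mcoeffZ mcoeffX (negPf ne) mulr0 mul0rn.
Qed.

Lemma component_is_additive r k : additive (component r k).
Proof. by move=> f g; rewrite /component rmorphB coefB. Qed.
HB.instance Definition _ r k :=
  GRing.isZmodMorphism.Build R R (component r k) (component_is_additive r k).

(** Zero has every degree, whence the separate conditions that a form is nonzero in what follows. *)
Definition thom c f : Prop := forall r, grade r f = f *: 'X^(c r).

Lemma thom_coef c f : (forall r m, m \in msupp f -> tdeg r m = c r) -> thom c f.
Proof.
move=> fc r; apply/polyP => k; rewrite coefZ coefXn mulr_natr; apply/mpolyP => m.
rewrite -/(component r k f) component_coef mcoeffMn.
have [mf|/memN_msupp_eq0->] := boolP (m \in msupp f); last by rewrite !mul0rn.
by rewrite (fc r m mf) eq_sym.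
Qed.

Lemma component_thom c f r k : thom c f -> component r k f = f *+ (k == c r).
Proof. by move=> fc; rewrite /component fc coefZ coefXn mulr_natr. Qed.

Lemma sum_components r f : f = \sum_(k < size (grade r f)) component r k f.
Proof.
have {1}<- : (grade r f).[1] = f.
  apply: horner_expand => j; rewrite hornerM hornerC.
  by case: ifP => _; rewrite ?hornerX ?hornerC mulr1.
by rewrite horner_coef; apply: eq_bigr => k _; rewrite expr1n mulr1.
Qed.

Definition multicomponent c f : R :=
  foldr (fun r g => component r (c r) g) f (enum J).

Lemma multicomponent_coef c f m :
  (multicomponent c f)@_m = f@_m *+ [forall r, tdeg r m == c r].
Proof.
rewrite /multicomponent.
have -> : [forall r, tdeg r m == c r] = all (fun r => tdeg r m == c r) (enum J).
  by apply/forallP/allP => [h r _|h r]; [apply: h | apply: h; rewrite mem_enum].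
elim: (enum J) => [|r s IH] /=; first by rewrite mulr1n.
by rewrite component_coef IH -mulrnA mulnb andbC.
Qed.

Lemma multicomponent_thom c f : thom c (multicomponent c f).
Proof.
apply: thom_coef => r m; rewrite mcoeff_msupp multicomponent_coef.
by case: forallP => [/(_ r)/eqP//|]; rewrite mulr0n eqxx.
Qed.

Lemma multicomponent_id c f : thom c f -> multicomponent c f = f.
Proof.
move=> fc; rewrite /multicomponent; elim: (enum J) => //= r s ->.
by rewrite (component_thom _ _ fc) eqxx.
Qed.

Lemma multicomponent_is_additive c : additive (multicomponent c).
Proof.
move=> f g; rewrite /multicomponent; elim: (enum J) => //= r s ->.
exact: raddfB.
Qed.

Lemma multicomponentB c f g : multicomponent c (f - g) = multicomponent c f - multicomponent c g.
Proof. exact: multicomponent_is_additive. Qed.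

Lemma stable_multicomponent N c f : (forall r, stable (grade r) N) -> N f ->
  N (multicomponent c f).
Proof.
by move=> sN Nf; rewrite /multicomponent; elim: (enum J) => //= r s IH; apply: sN.
Qed.

Lemma thomM c d f g : thom c f -> thom d g -> thom (fun r => c r + d r)%N (f * g).
Proof.
move=> fc gd r; rewrite rmorphM /= fc gd exprD -!mul_polyC polyCM.
by rewrite mulrACA.
Qed.

Lemma thom_lin s u : of_type s u -> thom (fun r => (r == s) : nat) (linform u).
Proof.
move=> us r; have [->|sr] := eqVneq r s; first by rewrite grade_lin // -mul_polyC.
by rewrite (grade_lin_neq us) 1?eq_sym // expr0 -mul_polyC mulr1.
Qed.

Lemma eq_thom c d f : c =1 d -> thom c f -> thom d f.
Proof. by move=> e fc r; rewrite -e. Qed.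

Lemma thom_prod (I : finType) (P : pred I) (e : I -> J -> nat) (G : I -> R) :
  (forall i, P i -> thom (e i) (G i)) ->
  thom (fun r => \sum_(i | P i) e i r)%N (\prod_(i | P i) G i).
Proof.
move=> Ge r; rewrite rmorph_prod /= expr_sum -mul_polyC rmorph_prod -big_split.
by apply: eq_bigr => i Pi /=; rewrite Ge // -mul_polyC.
Qed.

Lemma thomX c f k : thom c f -> thom (fun r => c r * k)%N (f ^+ k).
Proof.
by move=> fc r; rewrite rmorphXn /= fc -!mul_polyC exprMn -polyC_exp exprM.
Qed.

Lemma thom_divide c s u g : of_type s u -> u != 0 -> thom c (linform u * g) -> g != 0 ->
  (0 < c s)%N /\ thom (fun r => c r - (r == s))%N g.
Proof.
move=> us u0 ugc g0.
have lu0 : linform u != 0 by rewrite (raddf_eq0 _ (@linform_inj F n)).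
have lg r : (linform u)%:P * ('X^(r == s) * grade r g) = (linform u)%:P * (g *: 'X^(c r)).
  have := ugc r; rewrite rmorphM /= (thom_lin us) -!mul_polyC polyCM -!mulrA.
  by move=> ->.
have {}lg r : 'X^(r == s) * grade r g = g *: 'X^(c r).
  by apply: (mulfI _ (lg r)); rewrite polyC_eq0.
have cs : (0 < c s)%N.
  rewrite lt0n; apply: contra g0 => /eqP cs0.
  have := congr1 (fun p : {poly R} => p`_0) (lg s).
  by rewrite cs0 eqxx expr1 coefXM expr0 coefZ coef1 mulr1 => <-.
split=> // r; have := lg r; have [->|rs] := eqVneq r s; last by rewrite expr0 mul1r subn0.
move=> e; apply: (mulfI (negbT (polyX_eq0 _))); rewrite -[X in X * _]expr1 e.
by rewrite -[in LHS](subnK cs) addn1 exprS -!mul_polyC mulrCA.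
Qed.

End Grading.
End Expansions.

(** * Ideals of lines *)

Section LinidealSums.
Variables (F : fieldType) (n : nat).
Implicit Types (u w : 'rV[F]_n) (f g : {mpoly F[n]}).

Lemma linideal_adds m (M : 'M[F]_(m, n)) u f :
  linideal (M + u)%MS f <-> adjoin (linideal M) (linform u) f.
Proof.
by rewrite -linideal_col; split; apply: linideal_sub; rewrite addsmxE.
Qed.

Lemma linideal_mcoeff0 m (M : 'M[F]_(m, n)) f : linideal M f -> f@_0%MM = 0.
Proof.
move=> /linidealP[c ->]; rewrite raddf_sum big1 // => i _ /=.
rewrite [LHS](rmorphM (mcoeff 0%MM)) /= [X in _ * X](_ : _ = 0) ?mulr0 //.
rewrite /linform raddf_sum big1 // => j _ /=.
by rewrite mcoeffZ mcoeffX mnm1_eq0 mulr0.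
Qed.

(** Modulo [M] the forms [h x] are pairwise non-associate primes, so divisibility by each gives
    divisibility by the product. In the induction the product found so far is regular modulo
    [M + h u], so the new factor divides the cofactor [b]. *)
Lemma pencil m (M : 'M[F]_(m, n)) (T : eqType) (h : T -> 'rV[F]_n) (s : seq T) f : uniq s ->
  {in s &, forall x y, x != y -> ~~ (h x <= M + h y)%MS} ->
  {in s, forall x, linideal (M + h x)%MS f} ->
  exists b, linideal M (f - b * \prod_(x <- s) linform (h x)).
Proof.
elim: s => [|u s IH] /=.
  by move=> _ _ _; exists f; rewrite big_nil mulr1 subrr; apply: ideal0 (linideal_ideal M).
move=> /andP[us un] indep fs.
have [||b Mb] := IH un.
- by move=> v w vs ws; apply: indep; rewrite inE ?vs ?ws orbT.
- by move=> w ws; apply: fs; rewrite inE ws orbT.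
have idMu := linideal_ideal (M + h u)%MS.
have : linideal (M + h u)%MS (\prod_(w <- s) linform (h w) * b).
  have MMu : linideal (M + h u)%MS (f - b * \prod_(w <- s) linform (h w)).
    by apply: linideal_sub Mb; apply: addsmxSl.
  rewrite mulrC -[_ * _]opprK -[- (b * _)](addKr f); apply: (idealN idMu).
  apply: (idealD idMu); last exact: MMu.
  by apply: (idealN idMu); apply: fs; apply: mem_head.
have reg : regular (linideal (M + h u)%MS) (\prod_(w <- s) linform (h w)).
  rewrite big_seq; apply: regular_prod => w ws; apply: linideal_regular.
  by apply: indep; rewrite ?inE ?eqxx ?ws ?orbT //; apply: contraNneq us => <-.
move=> /reg/linideal_adds[m' [c [Mm' def_b]]].
exists c; rewrite big_cons.
have -> : f - c * (linform (h u) * \prod_(w <- s) linform (h w)) =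
   (f - b * \prod_(w <- s) linform (h w)) + m' * \prod_(w <- s) linform (h w).
  by rewrite def_b; ring.
apply: (idealD (linideal_ideal M)) => //; exact: (idealMr (linideal_ideal M)).
Qed.

Lemma addsmx_exchange (A : 'M[F]_n) u w :
  ~~ (w <= A)%MS -> ~~ (u <= A + w)%MS -> ~~ (w <= A + u)%MS.
Proof.
move=> wA; apply: contra => /sub_addsmxP[[a b]] /= def_w.
have b0 : b 0 0 != 0.
  apply: contraNneq wA => b0; rewrite def_w (_ : b = 0); last first.
    by apply/matrixP => i j; rewrite !ord1 b0 mxE.
  by rewrite mul0mx addr0 submxMl.
have -> : u = (b 0 0)^-1 *: (w - a *m A).
  by rewrite def_w addrC addKr [b]mx11_scalar mul_scalar_mx mxE eqxx mulr1n scalerA mulVf // scale1r.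
by apply/scalemx_sub/addmx_sub; rewrite ?addsmxSr // -mulNmx (submx_trans (submxMl _ _)) ?addsmxSl.
Qed.

End LinidealSums.

(** On the moment curve a linear equation of a proper subspace becomes a nonzero polynomial in [t],
    and finitely many nonzero polynomials have a common non-root. *)
Lemma avoid_subspaces (F : closedFieldType) n (Ms : seq 'M[F]_n) :
  all (fun M => ~~ row_full M) Ms -> exists u : 'rV[F]_n, all (fun M => ~~ (u <= M)%MS) Ms.
Proof.
move=> properM; pose curve (t : F) : 'rV[F]_n := \row_i t ^+ i.
suff [p p0 pP] : exists2 p : {poly F}, p != 0 &
    forall t, ~~ root p t -> all (fun M => ~~ (curve t <= M)%MS) Ms.
  by have /closed_nonrootP[t /pP] := p0; exists (curve t).
elim: Ms properM => [|M Ms IH] /=; first by exists 1; rewrite ?oner_eq0.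
move=> /andP[Mp /IH[p p0 pP]].
have : cokermx M != 0.
  rewrite -mxrank_eq0 mxrank_coker subn_eq0 -ltnNge ltn_neqAle rank_leq_col andbT.
  exact: Mp.
case/matrix0Pn => i [j cij].
pose q : {poly F} := \poly_(k < n) (if insub k is Some k' then cokermx M k' j else 0).
have qE (k : 'I_n) : q`_k = cokermx M k j.
  by rewrite coef_poly ltn_ord insubT // => lt; congr (cokermx M _ j); apply: val_inj.
exists (p * q).
  rewrite mulf_neq0 //; apply: contraNneq cij => q0.
  by rewrite -qE q0 coef0.
move=> t; rewrite rootM negb_or => /andP[/pP-> qt]; rewrite andbT.
apply: contra qt; rewrite submxE => /eqP/matrixP/(_ 0 j); rewrite !mxE => e.
apply/rootP; rewrite (horner_coef_wide _ (size_poly _ _)) -[RHS]e; apply: eq_bigr => k _.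
by rewrite qE [curve t 0 k]mxE mulrC.
Qed.

(** * The ideal of lines modulo general linear forms *)

Section LineIdeals.
Variables (F : closedFieldType) (n : nat) (T : finType) (E : rel T) (h : T -> 'rV[F]_n).
Local Notation R := {mpoly F[n]}.
Implicit Types (f g : R) (U : {set T}).
Hypotheses (symE : forall u v, E u v = E v u).

Definition line_ideal f : Prop := forall u v, E u v -> linideal (h u + h v)%MS f.

Lemma line_ideal_ideal : ideal line_ideal.
Proof.
split=> [u v Euv|f g If Ig u v Euv|f g Ig u v Euv];
  have idL := linideal_ideal (h u + h v)%MS.
- exact: ideal0.
- by apply: idealD; [| apply: If | apply: Ig].
- by apply: idealMl => //; apply: Ig.
Qed.

Definition plus (I J : R -> Prop) f : Prop := exists g, I g /\ J (f - g).

Definition generic_for (L : 'M[F]_n) : Prop :=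
  forall u v w, E u v -> w != u -> w != v -> ~~ (h w <= (h u + h v)%MS + L)%MS.

Section Generators.
Hypothesis simplicial_ex : forall U, U != set0 ->
  exists v, v \in U /\ {in U &, forall a b, ~~ E v a -> ~~ E v b -> ~~ E a b}.
Hypothesis irrE : forall u, E u u = false.
Variable L : 'M[F]_n.
Hypothesis genL : generic_for L.

Lemma sum_rot u v : ((h u + h v)%MS + L <= (L + h v)%MS + h u)%MS.
Proof.
by rewrite !addsmx_sub addsmxSr /= -!addsmxA !addsmxSl andbT (submx_trans (addsmxSl (h v) (h u))) ?addsmxSr.
Qed.

Lemma sum_rot' u v : ((L + h v)%MS + h u <= (h v + h u)%MS + L)%MS.
Proof.
by rewrite !addsmx_sub addsmxSr /= andbC !(submx_trans _ (addsmxSl (h v + h u)%MS L)) ?addsmxSl ?addsmxSr.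
Qed.

(* Peeling off a simplicial vertex [v] with neighbours [N], the ideal of the lines is
   [(h v) I' + (prod_N h)], where [I'] is the ideal of the lines avoiding [v]. *)
Lemma line_ideal_mod_in U f :
  (forall u v, u \in U -> v \in U -> E u v -> linideal ((h u + h v)%MS + L)%MS f) ->
  exists g, (forall u v, u \in U -> v \in U -> E u v -> linideal (h u + h v)%MS g) /\
            linideal L (f - g).
Proof.
have [m] := ubnP #|U|; elim: m => // m IH in U f *; rewrite ltnS => Um fU.
have idL := linideal_ideal L.
have [U0|U0] := eqVneq U set0.
  exists f; rewrite subrr; split; last exact: ideal0.
  by move=> u v; rewrite U0 inE.
have [v [vU simp]] := simplicial_ex U0.
pose N := [set u in U | E v u]; pose U' := U :\ v.
pose P : R := \prod_(u <- enum N) linform (h u).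
have PN u M : u \in N -> (h u <= (M : 'M[F]_n))%MS -> linideal M P.
  move=> uN uM; rewrite /P (big_rem u) ?mem_enum //=.
  by apply: (idealMr (linideal_ideal M)); apply/linideal_lin.
(* As [v] is simplicial in the complement, every edge inside [U] has an end adjacent to [v], so [P]
   vanishes on all its lines. *)
have PU u w : u \in U -> w \in U -> E u w -> linideal (h u + h w)%MS P.
  move=> uU wU Euw; have [uN|uN] := boolP (E v u).
    by apply: (PN u); rewrite ?inE ?uU // addsmxSl.
  have [wN|wN] := boolP (E v w); last by have := simp _ _ uU wU uN wN; rewrite Euw.
  by apply: (PN w); rewrite ?inE ?wU // addsmxSr.
have [||b] := @pencil F n n (L + h v)%MS T h (enum N) f (enum_uniq _).
- move=> u w; rewrite !mem_enum !inE => /andP[uU Evu] /andP[wU Evw] uw.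
  apply: contra (genL Evw _ uw) => [h1|]; last by apply: contraTneq Evu => ->; rewrite irrE.
  exact: submx_trans h1 (sum_rot' _ _).
- move=> u; rewrite mem_enum inE => /andP[uU Evu]; apply: linideal_sub (sum_rot _ _) _.
  by apply: fU; rewrite // symE.
rewrite -/P => /linideal_adds[l [a [Ll def_f]]].
(* On the lines avoiding [v] the form [h v] is regular even after adding [L], so the cofactor [a]
   inherits the vanishing of [f]. *)
have [||g [gU Lg]] := IH U' a.
- by apply: leq_trans Um; rewrite [X in (_ < X)%N](cardsD1 v) vU.
- move=> u w; rewrite !in_setD1 => /andP[uv uU] /andP[wv wU] Euw.
  have idM := linideal_ideal ((h u + h w)%MS + L)%MS.
  apply: (@linideal_regular F n n _ (h v)); first by apply: genL; rewrite // eq_sym.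
  have -> : linform (h v) * a = f - b * P - l by rewrite def_f; ring.
  apply: (idealB idM); last by apply: linideal_sub Ll; apply: addsmxSr.
  apply: (idealB idM); first exact: fU.
  by apply: (idealMl idM); apply: linideal_sub (PU _ _ uU wU Euw); apply: addsmxSl.
exists (g * linform (h v) + b * P); split; last first.
  have -> : f - (g * linform (h v) + b * P) = l + (a - g) * linform (h v).
    by rewrite mulrBl addrA -def_f; ring.
  by apply: (idealD idL) => //; apply: (idealMr idL).
move=> u w uU wU Euw; have idM := linideal_ideal (h u + h w)%MS.
apply: (idealD idM); last by apply: (idealMl idM); apply: PU.
have [->|uv] := eqVneq u v.
  by apply: (idealMl (linideal_ideal _)); apply/linideal_lin; apply: addsmxSl.
have [->|wv] := eqVneq w v.
  by apply: (idealMl (linideal_ideal _)); apply/linideal_lin; apply: addsmxSr.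
by apply: (idealMr idM); apply: gU; rewrite // !inE ?uv ?wv.
Qed.

Lemma line_ideal_mod f : (forall u v, E u v -> linideal ((h u + h v)%MS + L)%MS f) ->
  plus line_ideal (linideal L) f.
Proof.
move=> fE; have [|g [gI Lg]] := @line_ideal_mod_in [set: T] f.
  by move=> u v _ _; apply: fE.
exists g; split; last exact: Lg.
by move=> u v Euv; apply: gI; rewrite ?inE.
Qed.

(** By [line_ideal_mod] the sum of the ideal of lines and that of [L] is again an intersection of
    linear primes, one per line, and the form avoids each of them. *)
Lemma plus_regular u : (forall v w, E v w -> ~~ (u <= (h v + h w)%MS + L)%MS) ->
  regular (plus line_ideal (linideal L)) (linform u).
Proof.
move=> uE f [g [Ig Lg]]; apply: line_ideal_mod => v w Evw.
apply: (linideal_regular (uE _ _ Evw)).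
have idM := linideal_ideal ((h v + h w)%MS + L)%MS.
rewrite -[X in linideal _ X](subrK g); apply: (idealD idM).
  by apply: linideal_sub Lg; apply: addsmxSr.
by apply: linideal_sub (Ig _ _ Evw); apply: addsmxSl.
Qed.

End Generators.

Lemma plus_adjoin (L : 'M[F]_n) u f :
  adjoin (plus line_ideal (linideal L)) (linform u) f <->
  plus line_ideal (linideal (L + u)%MS) f.
Proof.
split=> [[p [a [[g [Ig Lg]] ->]]]|[g [Ig /linideal_adds[l [a [Ll def]]]]]].
  exists g; split; first exact: Ig.
  apply/linideal_adds.
  by exists (p - g), a; rewrite addrAC.
exists (g + l), a; split; last by rewrite -addrA -def addrC subrK.
by exists g; rewrite addrAC subrr add0r.
Qed.

Definition span (us : seq 'rV[F]_n) : 'M[F]_n := foldl (fun L u => (L + u)%MS) 0 us.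

Lemma adjoins_span us f :
  adjoins line_ideal (map (@linform F n) us) f <-> plus line_ideal (linideal (span us)) f.
Proof.
elim/last_ind: us f => [|us u IH] f.
  rewrite /span /=; split=> [If|[g [Ig]]].
    by exists f; rewrite subrr; split=> //; apply: ideal0 (linideal_ideal _).
  rewrite /linideal => e.
  suff -> : f = g by [].
  apply/eqP; rewrite -subr_eq0; apply/eqP; have /linidealP[c ->] : linideal (0 : 'M_n) (f - g) by [].
  by rewrite big1 // => i _; rewrite row0 linear0 mulr0.
rewrite map_rcons /adjoins /span !foldl_rcons -plus_adjoin.
by split; apply: adjoin_mono => g; rewrite -/(adjoins _ _) => /IH.
Qed.

Lemma span_rank us : (\rank (span us) <= size us)%N.
Proof.
elim/last_ind: us => [|us u IH]; first by rewrite mxrank0.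
rewrite /span foldl_rcons size_rcons.
apply: leq_trans (mxrank_adds_leqif _ _) _; rewrite -[(size us).+1]addn1.
by apply: leq_add => //; apply: rank_leq_row.
Qed.

Lemma span_rcons us u : span (rcons us u) = (span us + u)%MS.
Proof. by rewrite /span foldl_rcons. Qed.

(** With [j] vectors chosen, the next must avoid the spans of a line, these vectors and one more
    hyperplane. Their dimension is at most [j + 3], less than [n] as long as [j < k]. *)
Lemma generic_vectors k : (k + 3 <= n)%N ->
  (forall u v w, E u v -> w != u -> w != v -> ~~ (h w <= h u + h v)%MS) ->
  exists us, [/\ size us = k,
    forall j, (j <= k)%N -> generic_for (span (take j us)) &
    forall j, (j < k)%N -> forall u v, E u v ->
      ~~ (nth 0 us j <= (h u + h v)%MS + span (take j us))%MS].
Proof.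
move=> + h_gen; elim: k => [|k IH] kn.
  exists [::]; split=> // j _ u v w Euv wu wv; rewrite take_oversize //.
  by rewrite addsmx0 /=; apply: h_gen.
have [us [szus genus indus]] := IH (ltnW kn).
pose Ms := [seq (((h p.1.1 + h p.1.2)%MS + span us) + h p.2)%MS | p <- enum {: T * T * T}].
have [|x /allP xMs] := @avoid_subspaces F n Ms.
  apply/allP => _ /mapP[[[u v] w] _ ->] /=; rewrite /row_full neq_ltn; apply/orP; left.
  have rk2 : (\rank (h u + h v)%MS <= 2)%N.
    apply: leq_trans (mxrank_adds_leqif _ _) _.
    by apply: (@leq_add _ _ 1 1); apply: rank_leq_row.
  apply: leq_ltn_trans (mxrank_adds_leqif _ _) _; apply: (@leq_ltn_trans (2 + k + 1)).
    apply: leq_add; last exact: rank_leq_row.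
    by apply: leq_trans (mxrank_adds_leqif _ _) _; apply: leq_add; rewrite // -szus span_rank.
  by apply: leq_trans kn; rewrite addn1 addn3 add2n.
have {}xMs u v w : ~~ (x <= ((h u + h v)%MS + span us) + h w)%MS.
  by apply: xMs; apply/mapP; exists (u, v, w); rewrite ?mem_enum.
exists (rcons us x); split; first by rewrite size_rcons szus.
- move=> j; rewrite leq_eqVlt => /predU1P[->|jk]; last first.
    by rewrite -cats1 takel_cat ?szus //; apply: genus.
  rewrite take_oversize ?size_rcons ?szus // span_rcons => u v w Euv wu wv.
  rewrite addsmxA; apply: addsmx_exchange => //.
  by have := genus k (leqnn k) u v w Euv wu wv; rewrite take_oversize ?szus.
- move=> j; rewrite ltnS leq_eqVlt => /predU1P[->|jk] u v Euv; last first.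
    rewrite -cats1 takel_cat ?szus 1?ltnW // nth_cat szus jk; exact: indus.
  rewrite -cats1 takel_cat ?szus // take_oversize ?szus // nth_cat szus ltnn subnn /=.
  by apply: contra (xMs u v u) => /submx_trans; apply; apply: addsmxSl.
Qed.

End LineIdeals.

Lemma in_ideal_plusP (K : fieldType) (I : Rpoly K -> Prop) fs f : ideal I ->
  in_ideal_plus I fs f <-> adjoins I fs f.
Proof.
move=> idI; elim/last_ind: fs f => [|fs x IH] f.
  rewrite /adjoins /=; split=> [[g [Ig [c]]]|If]; first by rewrite big_ord0 addr0 => ->.
  by exists f; split=> //; exists (fun=> 0); rewrite big_ord0 addr0.
rewrite /adjoins foldl_rcons; split.
  move=> [g [Ig [c ->]]]; rewrite size_rcons big_ord_recr /= nth_rcons ltnn eqxx addrA.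
  exists (g + \sum_(i < size fs) c i * nth 0 (rcons fs x) i), (c (size fs)); split=> //.
  apply/IH; exists g; split=> //; exists c; congr (_ + _); apply: eq_bigr => i _.
  by rewrite nth_rcons ltn_ord.
move=> [_ [a [/IH[g [Ig [c ->]]] ->]]]; exists g; split=> //.
exists (fun i => if i == size fs then a else c i).
rewrite size_rcons big_ord_recr /= nth_rcons ltnn !eqxx addrA; congr (_ + _ + _).
by apply: eq_bigr => i _; rewrite nth_rcons ltn_ord ltn_eqF.
Qed.

(** * Dimension four, and Cohen-Macaulayness from simplicial vertices *)

Section CohenMacaulay.
Variables (K : closedFieldType) (T : finType) (E : rel T) (h : T -> 'rV[K]_6).
Hypotheses (symE : forall u v, E u v = E v u) (irrE : forall u, E u u = false).
Hypothesis h_gen : forall u v w, E u v -> w != u -> w != v -> ~~ (h w <= h u + h v)%MS.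
Hypotheses (h_neq0 : forall u, h u != 0) (h_edge : forall u v, E u v -> ~~ (h v <= h u)%MS).
Local Notation I := (line_ideal E h).

Lemma is_primeP (P : Rpoly K -> Prop) : is_prime_ideal P <-> prime_pred P.
Proof.
split=> [[P0 [PD [PM [P1 Pp]]]]|[[P0 PD PM] P1 Pp]]; first by do !split.
by do !split.
Qed.

Lemma linideal_prime_pred m (M : 'M[K]_(m, 6)) : prime_pred (linideal M).
Proof.
split; [exact: linideal_ideal | exact: linideal1 | exact: linideal_prime].
Qed.

(** Independent forms are adjoined to the prime of one line. [generic_vectors] supplies three in
    dimension six; the fourth only has to avoid a space of dimension at most five. *)
Lemma line_chain4 u v : E u v -> prime_chain I 4.
Proof.
move=> Euv; have [us [szus _ indus]] := @generic_vectors K 6 T E h 3 isT h_gen.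
pose M := (h u + h v)%MS.
have [x xM] : exists x : 'rV_6, ~~ (x <= M + span us)%MS.
  have [|x] := @avoid_subspaces K 6 [:: (M + span us)%MS].
    rewrite /= andbT /row_full neq_ltn; apply/orP; left.
    apply: leq_ltn_trans (mxrank_adds_leqif _ _) _; apply: (@leq_ltn_trans (2 + 3)) => //.
    apply: leq_add; last by have := span_rank us; rewrite szus.
    apply: leq_trans (mxrank_adds_leqif _ _) _.
    by apply: (@leq_add _ _ 1 1); apply: rank_leq_row.
  by rewrite /= andbT; exists x.
exists (fun k => linideal (M + span (take k (rcons us x)))%MS); split.
  by move=> k _; apply/is_primeP; apply: linideal_prime_pred.
split=> [f If|k k4].
  rewrite take0; apply: linideal_sub (If _ _ Euv); exact: addsmxSl.
have szx : (k < size (rcons us x))%N by rewrite size_rcons szus.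
rewrite (take_nth 0 szx) span_rcons addsmxA; split.
  by move=> f; apply: linideal_sub; apply: addsmxSl.
exists (linform (nth 0 (rcons us x) k)); split; first by apply/linideal_lin; apply: addsmxSr.
rewrite linideal_lin; apply/negP; rewrite nth_rcons szus; move: k4.
rewrite ltnS leq_eqVlt => /predU1P[->|k3]; first by rewrite ltnn eqxx -cats1 take_size_cat.
rewrite k3 -cats1 takel_cat ?szus 1?ltnW //; exact: indus.
Qed.

(** A prime over the ideal contains both forms of some line; otherwise an element outside it could
    be chosen in the prime of each line, and their product would be in the ideal. The zero ideal and
    the prime of [h u] fit below, so a chain of length five would extend to one of length seven in
    six variables. *)
Lemma line_no_chain5 : ~ prime_chain I 5.
Proof.
move=> [P [prP [IP incP]]].
have prP0 : prime_pred (P 0%N) by apply/is_primeP; apply: prP.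
have [u [v [Euv [Pu Pv]]]] :
    exists u v, E u v /\ P 0%N (linform (h u)) /\ P 0%N (linform (h v)).
  apply: NNPP => noE.
  have sel (p : T * T) : exists f, E p.1 p.2 -> linideal (h p.1 + h p.2)%MS f /\ ~ P 0%N f.
    case: (classic (P 0%N (linform (h p.1)))) => [P1|P1]; last first.
      by exists (linform (h p.1)) => _; split=> //; apply/linideal_lin; apply: addsmxSl.
    exists (linform (h p.2)) => Ep; split; first by apply/linideal_lin; apply: addsmxSr.
    by move=> P2; apply: noE; exists p.1, p.2.
  have [g gP] := fin_all_exists sel.
  have /IP : I (\prod_(p | E p.1 p.2) g p).
    move=> u v Euv; rewrite (bigD1 (u, v)) //=.
    by apply: (idealMr (linideal_ideal _)); case: (gP (u, v) Euv).
  by case/(prime_prod prP0) => p [Ep Pg]; case: (gP p Ep).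
have idP0 := prime_idealP prP0.
pose Q k := match k with 0 => linideal (0 : 'M[K]_6) | 1 => linideal (h u) | k.+2 => P k end.
apply: (@mpoly_dimension K 6 Q) => [[|[|k]] k7|[|[|k]] k7] /=.
- exact: linideal_prime_pred.
- exact: linideal_prime_pred.
- by apply/is_primeP; apply: prP.
- split=> [f|]; first by apply: linideal_sub; apply: sub0mx.
  by exists (linform (h u)); rewrite !linideal_lin submx_refl submx0; split=> //; apply/negP.
- split=> [f /linidealP[c ->]|].
    by apply: ideal_sum => // i _; apply: idealMl => //; rewrite row_id.
  by exists (linform (h v)); split=> //; rewrite linideal_lin; apply/negP; apply: h_edge.
- exact: incP.
Qed.

Lemma line_dim u v d : E u v -> krull_dim_eq I d <-> d = 4%N.
Proof.
move=> Euv; have trunc (e e' : nat) : (e' <= e)%N -> prime_chain I e -> prime_chain I e'.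
  move=> le [P [prP [IP incP]]]; exists P; split; last split=> //.
    by move=> k /leq_trans/(_ le); apply: prP.
  by move=> k /leq_trans/(_ le); apply: incP.
split=> [[cd ncd]|->]; last first.
  by split; [apply: line_chain4 Euv | apply: line_no_chain5].
case: (ltngtP d 4) => // d4; first by case: ncd; apply: trunc d4 (line_chain4 Euv).
by case: line_no_chain5; apply: trunc d4 cd.
Qed.

Lemma line_ideal_no_edge : (forall u v, ~~ E u v) -> I 1.
Proof. by move=> noE u v Euv; have := noE u v; rewrite Euv. Qed.

Hypothesis simplicial_ex : forall U : {set T}, U != set0 ->
  exists v, v \in U /\ {in U &, forall a b, ~~ E v a -> ~~ E v b -> ~~ E a b}.

Theorem lines_cohen_macaulay : cohen_macaulay I.
Proof.
have [/existsP[u /existsP[v Euv]]|] := boolP [exists u, exists v, E u v]; last first.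
  rewrite negb_exists => /forallP noE; left; apply: line_ideal_no_edge => u v.
  by have := noE u; rewrite negb_exists => /forallP.
right; exists 4%N; split; first by apply/(line_dim _ Euv).
have [us [szus genus indus]] := @generic_vectors K 6 T E h 3 isT h_gen.
(* The fourth form is chosen apart: no form follows it, so it only has to be independent of each
   line enlarged by the first three, and there is no dimension left for [generic_for]. *)
pose Ms := [seq ((h p.1 + h p.2)%MS + span us)%MS | p <- enum {: T * T}].
have [|x /allP xMs] := @avoid_subspaces K 6 Ms.
  apply/allP => _ /mapP[[w w'] _ ->] /=; rewrite /row_full neq_ltn; apply/orP; left.
  apply: leq_ltn_trans (mxrank_adds_leqif _ _) _; apply: (@leq_ltn_trans (2 + 3)) => //.
  apply: leq_add; last by have := span_rank us; rewrite szus.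
  apply: leq_trans (mxrank_adds_leqif _ _) _.
  by apply: (@leq_add _ _ 1 1); apply: rank_leq_row.
pose xs := rcons us x; have szxs : size xs = 4 by rewrite size_rcons szus.
exists (map (@linform K 6) xs); split; first by rewrite size_map.
have idI : ideal I := line_ideal_ideal E h.
split.
  move=> _ /mapP[y _ ->]; apply: (linideal_mcoeff0 (M := y)).
  by apply/linideal_lin.
split=> [k|].
  rewrite size_map szxs => k4 g; rewrite -map_take (nth_map 0) ?szxs //.
  rewrite !in_ideal_plusP // !adjoins_span.
  have take3 : (k <= 3)%N -> take k xs = take k us by move=> k3; rewrite /xs -cats1 takel_cat ?szus.
  apply: plus_regular => //; first by rewrite take3 //; apply: genus.
  rewrite take3 // => w w' Eww'; rewrite nth_rcons szus.
  have [k3|k3] := ltnP k 3; first exact: indus.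
  have {k4 k3}-> : k = 3 by apply/eqP; rewrite eqn_leq k3 -ltnS k4.
  rewrite eqxx take_oversize ?szus //; apply: xMs.
  by apply/mapP; exists (w, w'); rewrite ?mem_enum.
rewrite in_ideal_plusP // adjoins_span => -[g [/(_ _ _ Euv)/linideal_mcoeff0 g0]].
move=> /linideal_mcoeff0; rewrite mcoeffB g0 subr0 mcoeff1 eqxx => /eqP.
by rewrite oner_eq0.
Qed.

End CohenMacaulay.

(** * Depth of the ideal of lines *)

Section Radical.
Variable A : comNzRingType.
Implicit Types (N J : A -> Prop).

Definition radical J : A -> Prop := fun f => exists k, J (f ^+ k).

Lemma ideal_radical J : ideal J -> ideal (radical J).
Proof.
move=> idJ; split=> [|f g [k Jf] [l Jg]|f g [k Jg]].
- by exists 1%N; rewrite expr1; apply: ideal0.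
- exists (k + l)%N; rewrite exprDn; apply: ideal_sum => // i _.
  rewrite -mulr_natr; apply: idealMr => //.
  have [li|il] := leqP l i.
    by rewrite -(subnK li) exprD mulrA; apply: idealMl.
  have ki : (k <= k + l - i)%N by rewrite -addnBA ?leq_addr // ltnW.
  by rewrite -(subnKC ki) exprD -mulrA; apply: idealMr.
- by exists k; rewrite exprMn; apply: idealMl.
Qed.

Lemma kpairing_ideal (us : seq A) : ideal (fun f => exists cs, f = kpairing us cs).
Proof.
split=> [|f g [cs ->] [ds ->]|f g [cs ->]].
- by exists [::]; elim: us => //= u us <-; rewrite mulr0 addr0.
- elim: us cs ds => [|u us IH] cs ds /=; first by exists [::]; rewrite addr0.
  have [es e] := IH (behead cs) (behead ds); exists (head 0 cs + head 0 ds :: es) => /=.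
  by rewrite -e mulrDr addrACA.
- elim: us cs => [|u us IH] cs /=; first by exists [::]; rewrite mulr0.
  have [es e] := IH (behead cs); exists (f * head 0 cs :: es) => /=.
  by rewrite -e mulrDr mulrCA.
Qed.

Lemma kpairing_mem (us : seq A) u : u \in us -> exists cs, u = kpairing us cs.
Proof.
have [cs0 c0] : exists cs, 0 = kpairing us cs by apply: ideal0 (kpairing_ideal us).
elim: us {cs0 c0} => //= v us IH; rewrite inE => /predU1P[->|/IH[cs ->]]; last first.
  by exists (0 :: cs); rewrite /= mulr0 add0r.
have [cs0 c0] := ideal0 (kpairing_ideal us); exists (1 :: cs0).
by rewrite /= mulr1 -c0 addr0.
Qed.

Definition colon N w : A -> Prop := fun f => N (f * w).

Lemma ideal_colon N w : ideal N -> ideal (colon N w).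
Proof.
move=> idN; rewrite /colon; split=> [|f g Nf Ng|f g Ng].
- by rewrite mul0r; apply: ideal0.
- by rewrite mulrDl; apply: idealD.
- by rewrite -mulrA; apply: idealMl.
Qed.

Lemma acyclic_leq N d d' (us : seq A) : (d' <= d)%N -> acyclic N d us -> acyclic N d' us.
Proof. by move=> le ac k x kd; apply: ac; apply: leq_trans kd le. Qed.

(** Only powers of the sequence have to lie in the ideal of [us]; this trades an arbitrary regular
    sequence for chosen generators. *)
Lemma acyclic_regular_seq N (fs us : seq A) : ideal N ->
  (forall k, (k < size fs)%N -> regular (adjoins N (take k fs)) (nth 0 fs k)) ->
  (forall f, f \in fs -> radical (fun f => exists cs, f = kpairing us cs) f) ->
  acyclic N (size fs) us.
Proof.
elim: fs N => [|f fs IH] N idN reg rad; first exact: acyclic0.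
have [t [cs ft]] := rad f (mem_head _ _).
apply: (acyclicS idN (f := f) _ ft); first exact: (reg 0%N).
apply: IH => [|k kfs|g gfs]; first exact: ideal_adjoin.
  exact: (reg k.+1).
by apply: rad; rewrite inE gfs orbT.
Qed.

End Radical.

Lemma irrelevant_in_ideal (F : fieldType) n (J : {mpoly F[n]} -> Prop) f : ideal J ->
  (forall i, J 'X_i) -> f@_0%MM = 0 -> J f.
Proof.
move=> idJ JX f0; rewrite [f]mpolyE big_seq; apply: ideal_sum => // m mf.
rewrite -mul_mpolyC; apply: idealMl => //.
have [i mi] : exists i, m i != 0%N.
  apply/existsP; apply: contraTT mf; rewrite negb_exists => /forallP h.
  suff -> : m = 0%MM by rewrite mcoeff_msupp f0 eqxx.
  by apply/mnmP => i; have := h i; rewrite negbK mnmE => /eqP.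
rewrite mpolyXE_id (bigD1 i) //=; apply: idealMr => //.
by case: (m i) mi => // k _; rewrite exprS; apply: idealMr.
Qed.

Section Associates.
Variables (F : fieldType) (n : nat) (N : {mpoly F[n]} -> Prop).
Hypothesis idN : ideal N.

(** Hides the scalars that appear when the hyperplanes of one type are replaced by one variable;
    membership in [N] is insensitive to them. *)
Definition assoc f g : Prop := exists2 c : F, c != 0 & N (f - c *: g).

Lemma assoc_refl f : assoc f f.
Proof. by exists 1; rewrite ?oner_eq0 // scale1r subrr; apply: ideal0. Qed.

Lemma assocM f g f' g' : assoc f g -> assoc f' g' -> assoc (f * f') (g * g').
Proof.
move=> [c c0 Nc] [d d0 Nd]; exists (c * d); first exact: mulf_neq0.
have -> : f * f' - (c * d) *: (g * g') = (f - c *: g) * f' + (c *: g) * (f' - d *: g').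
  by rewrite -!mul_mpolyC mpolyCM; ring.
by apply: idealD => //; [apply: idealMr | apply: idealMl].
Qed.

Lemma assoc_prod (I : finType) (P : pred I) (f g : I -> {mpoly F[n]}) :
  (forall i, P i -> assoc (f i) (g i)) -> assoc (\prod_(i | P i) f i) (\prod_(i | P i) g i).
Proof.
move=> fg; apply: (big_ind2 assoc) => //; first exact: assoc_refl.
by move=> *; apply: assocM.
Qed.

Lemma assoc_mem f g : assoc f g -> N f -> N g.
Proof.
move=> [c c0 Nc] Nf; have : N (c *: g) by rewrite -(subKr f (c *: g)); apply: idealB.
move=> /(idealMl idN c^-1%:MP); rewrite mul_mpolyC scalerA mulVf // scale1r.
exact.
Qed.

End Associates.

(** * Hyperplanes in three pairs of variables, with a general form of each type *)

Section LineConfiguration.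
Variables (K : closedFieldType) (n : nat) (vt : 'I_n -> 'I_3) (x0 x1 : 'I_3 -> 'I_n).
Hypotheses (vt0 : forall r, vt (x0 r) = r) (vt1 : forall r, vt (x1 r) = r).
Hypotheses (x01 : forall r, x0 r != x1 r) (vt_x : forall k, k = x0 (vt k) \/ k = x1 (vt k)).
Variables (T : finType) (ty : T -> 'I_3) (h : T -> 'rV[K]_n).
Hypotheses (h_ty : forall v, of_type vt (ty v) (h v)) (h_neq0 : forall v, h v != 0).
Hypothesis h_indep : forall u v, u != v -> ty u = ty v -> ~~ (h u <= h v)%MS.
Variable tau : K.
Local Notation R := {mpoly K[n]}.
Implicit Types (f g w : R) (r s t : 'I_3) (E : rel T).

(* A form of type [r] general enough to avoid all hyperplanes [h v], see [avec_h]. *)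
Definition avec r : 'rV[K]_n := delta_mx 0 (x1 r) + tau *: delta_mx 0 (x0 r).
Hypothesis avec_h : forall r v, ~~ (avec r <= h v)%MS.

Local Notation a r := (linform (avec r)).
Local Notation x r := ('X_(x0 r) : R).
Local Notation H v := (linform (h v)).

Definition tproj r : 'M[K]_n := \matrix_(i, j) ((i == j) && (vt i == r))%:R.

Lemma tproj_id r (u : 'rV[K]_n) : of_type vt r u -> u *m tproj r = u.
Proof.
move=> ur; apply/rowP => j; rewrite !mxE (bigD1 j) //= big1 => [|i /negPf ij].
  rewrite mxE eqxx /= addr0; case: eqVneq => [_|/ur->]; by rewrite ?mulr1 ?mul0r.
by rewrite mxE ij mulr0.
Qed.

Lemma tproj_0 r s (u : 'rV[K]_n) : of_type vt s u -> s != r -> u *m tproj r = 0.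
Proof.
move=> us sr; apply/rowP => j; rewrite !mxE big1 // => i _; rewrite mxE.
have [/= ->|_] := eqVneq i j; last by rewrite mulr0.
case: eqVneq => [e|_]; last by rewrite mulr0.
by rewrite us ?mul0r // e eq_sym.
Qed.

(** Projection to the variables of type [r] keeps [w] and kills at least one of [u] and [v], whose
    types differ. *)
Lemma sep_types r s t (w u v : 'rV[K]_n) : of_type vt r w -> of_type vt s u -> of_type vt t v ->
  s != t -> w != 0 -> (r = s -> ~~ (w <= u)%MS) -> (r = t -> ~~ (w <= v)%MS) ->
  ~~ (w <= u + v)%MS.
Proof.
move=> wr us vt' st w0 wu wv; apply/negP => /sub_addsmxP[[c d]] /= e.
have {e} := congr1 (fun M => M *m tproj r) e; rewrite tproj_id // mulmxDl -!mulmxA.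
have [rs|rs] := eqVneq s r.
  rewrite (tproj_0 vt') -?rs 1?eq_sym // mulmx0 addr0 tproj_id // => e.
  by case/negP: (wu (esym rs)); rewrite e submxMl.
rewrite (tproj_0 us) // mulmx0 add0r; have [rt|rt] := eqVneq t r.
  rewrite -rt tproj_id // => e.
  by case/negP: (wv (esym rt)); rewrite e submxMl.
by rewrite (tproj_0 vt') // mulmx0 => e; rewrite e eqxx in w0.
Qed.

Lemma h_sub u v : u != v -> ~~ (h u <= h v)%MS.
Proof.
move=> uv; have [e|e] := eqVneq (ty u) (ty v); first exact: h_indep.
have [s sv] : exists s, ty v != s.
  by case: (eqVneq (ty v) ord0) => [->|]; [exists ord_max | exists ord0].
have : ~~ (h u <= h v + (0 : 'rV[K]_n))%MS.
  apply: (@sep_types (ty u) (ty v) s) => //; first by move=> j _; rewrite mxE.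
    by move=> e'; rewrite e' eqxx in e.
  by move=> _; apply: contra (h_neq0 u) => /submxP[D ->]; rewrite mulmx0.
by apply: contra => /submx_trans; apply; apply: addsmxSl.
Qed.

Lemma h_gen (u v w : T) : ty u != ty v -> w != u -> w != v -> ~~ (h w <= h u + h v)%MS.
Proof. by move=> uv wu wv; apply: sep_types; rewrite // => _; apply: h_sub. Qed.

Lemma avec_ty r : of_type vt r (avec r).
Proof.
move=> j jr; rewrite !mxE eqxx /=.
have -> : (j == x1 r) = false by apply: contraNF jr => /eqP->; rewrite vt1.
have -> : (j == x0 r) = false by apply: contraNF jr => /eqP->; rewrite vt0.
by rewrite mulr0 addr0.
Qed.

Lemma avec_x1 r : avec r 0 (x1 r) = 1.
Proof. by rewrite !mxE !eqxx /= eq_sym (negPf (x01 r)) mulr0 addr0. Qed.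

Lemma avec_neq0 r : avec r != 0.
Proof. by apply/eqP => /rowP/(_ (x1 r))/eqP; rewrite avec_x1 mxE oner_eq0. Qed.

Lemma avec_gen u v r : ty u != ty v -> ~~ (avec r <= h u + h v)%MS.
Proof.
move=> uv; apply: sep_types; rewrite ?avec_neq0 //; exact: avec_ty.
Qed.

Lemma avecE r : a r = 'X_(x1 r) + tau *: x r.
Proof. by rewrite /avec linearD linearZ /= !linform_delta. Qed.

(** There are two variables per type, so [h v] is a combination of [avec] and the variable [x]. The
    coefficient of [x] is nonzero, as otherwise [avec] would be a multiple of [h v]. *)
Lemma assoc_h N v : ideal N -> N (a (ty v)) -> assoc N (H v) (x (ty v)).
Proof.
move=> idN Na; set r := ty v in Na *.
have hE : h v = h v 0 (x1 r) *: avec r + (h v 0 (x0 r) - tau * h v 0 (x1 r)) *: delta_mx 0 (x0 r).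
  apply/rowP => j; rewrite !mxE eqxx /=; have [e|jr] := eqVneq (vt j) r; last first.
    rewrite h_ty //; have -> : (j == x1 r) = false by apply: contraNF jr => /eqP->; rewrite vt1.
    have -> : (j == x0 r) = false by apply: contraNF jr => /eqP->; rewrite vt0.
    by rewrite !(mulr0, addr0).
  have [->|->] := vt_x j; rewrite e ?eqxx.
    by rewrite (negPf (x01 r)) /=; ring.
  by rewrite eq_sym (negPf (x01 r)) /=; ring.
exists (h v 0 (x0 r) - tau * h v 0 (x1 r)).
  apply: contra (avec_h r v) => /eqP e; move: hE; rewrite e scale0r addr0 => hE.
  have c0 : h v 0 (x1 r) != 0.
    by apply: contraNneq (h_neq0 v) => c0; rewrite hE c0 scale0r.
  have := congr1 (fun z => (h v 0 (x1 r))^-1 *: z) hE.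
  by rewrite scalerA mulVf // scale1r => <-; apply: scalemx_sub.
have -> : linform (h v) = h v 0 (x1 r) *: a r + (h v 0 (x0 r) - tau * h v 0 (x1 r)) *: x r.
  by rewrite {1}hE linearD linearZ [X in _ + X]linearZ /= linform_delta.
rewrite addrK -mul_mpolyC.
exact: idealMl.
Qed.

Lemma grade_linideal r m (M : 'M[K]_(m, n)) :
  (forall i, exists s, of_type vt s (row i M)) -> stable (grade vt r) (linideal M).
Proof.
move=> Mt; apply: stable_linideal => i; have [s Ms] := Mt i; exact: grade_lin_ex Ms.
Qed.

Lemma stable_eq phi (N N' : R -> Prop) : (forall f, N f <-> N' f) -> stable phi N -> stable phi N'.
Proof. by move=> e sN f /e/sN Nf k; apply/e. Qed.

Lemma linideal1P (u : 'rV[K]_n) f : linideal u f <-> exists g, f = linform u * g.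
Proof.
split=> [/linidealP[c ->]|[g ->]]; first by exists (c 0); rewrite big_ord1 row_id mulrC.
by apply: (idealMr (linideal_ideal u)); apply/linideal_lin.
Qed.

Lemma grade_linideal1 r s (u : 'rV[K]_n) : of_type vt s u -> stable (grade vt r) (linideal u).
Proof. by move=> us; apply: grade_linideal => i; exists s; rewrite row_id. Qed.

Lemma stable_linideal2 (phi : {rmorphism R -> {poly R}}) (u v : 'rV[K]_n) :
  (exists q, phi (linform u) = (linform u)%:P * q) ->
  (exists q, phi (linform v) = (linform v)%:P * q) -> stable phi (linideal (u + v)%MS).
Proof.
move=> [p pu] [q qv].
apply: (@stable_eq _ (adjoin (linideal u) (linform v))) => [f|].
  by rewrite linideal_adds.
apply: (stable_adjoin (linideal_ideal u) qv).
by apply: stable_linideal => i; exists p; rewrite row_id.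
Qed.

Lemma translate_lin_fixed i (u : 'rV[K]_n) : u 0 i = 0 ->
  exists q, translate i (linform u) = (linform u)%:P * q.
Proof. by move=> ui; exists 1; rewrite translate_lin ui mpolyC0 scale0r addr0 mulr1. Qed.

Lemma stable_line_ideal (phi : {rmorphism R -> {poly R}}) E :
  (forall u v, E u v -> exists q, phi (H u) = (H u)%:P * q) ->
  (forall u v, E u v -> E v u) -> stable phi (line_ideal E h).
Proof.
move=> phiE sE f If k u v Euv; apply: (stable_linideal2 _ _ (If u v Euv)).
  exact: phiE Euv.
exact: phiE (sE _ _ Euv).
Qed.

Section Depth.
Variable E : rel T.
Hypotheses (symE : forall u v, E u v = E v u) (Ety : forall u v, E u v -> ty u != ty v).
Local Notation I := (line_ideal E h).

(** Dropping the lines with a hyperplane of type [r] acts as a localisation: the smaller set of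
    lines has an ideal stable under translations in type [r], and [Phi r], the product of all
    hyperplanes of type [r], multiplies that ideal into [I]. *)
Definition off r : rel T := [rel u v | [&& E u v, ty u != r & ty v != r]].
Local Notation Ioff r := (line_ideal (off r) h).
Local Notation Phi r := (\prod_(v | ty v == r) H v).

Lemma off_ideal r : ideal (Ioff r).
Proof. exact: line_ideal_ideal. Qed.

Lemma I_ideal : ideal I.
Proof. exact: line_ideal_ideal. Qed.

Lemma off_sub r f : I f -> Ioff r f.
Proof. by move=> If u v /and3P[Euv _ _]; apply: If. Qed.

Lemma Phi_linideal r v M : ty v = r -> (h v <= (M : 'M[K]_n))%MS -> linideal M (Phi r).
Proof.
move=> vr vM; rewrite (bigD1 v) ?vr //=.
by apply: (idealMr (linideal_ideal M)); apply/linideal_lin.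
Qed.

Lemma Phi_off r f : Ioff r f -> I (Phi r * f).
Proof.
move=> If u v Euv; have [ur|ur] := eqVneq (ty u) r.
  by apply: (idealMr (linideal_ideal _)); apply: (Phi_linideal ur); apply: addsmxSl.
have [vr|vr] := eqVneq (ty v) r.
  by apply: (idealMr (linideal_ideal _)); apply: (Phi_linideal vr); apply: addsmxSr.
by apply: (idealMl (linideal_ideal _)); apply: If; rewrite /off /= Euv ur vr.
Qed.

Lemma adjoin_Phi r g (N N' : R -> Prop) w : (forall f, N f -> N' (Phi r * f)) ->
  adjoin N g w -> adjoin N' g (Phi r * w).
Proof.
move=> NN' [m [q [Nm ->]]]; exists (Phi r * m), (Phi r * q).
by split; [apply: NN' | rewrite mulrDr mulrA].
Qed.

Lemma off_translate r i : vt i = r -> stable (translate i) (Ioff r).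
Proof.
move=> ir; apply: stable_line_ideal => [u v /and3P[_ ur _]|u v].
  by apply: translate_lin_fixed; apply: h_ty; rewrite ir eq_sym.
by rewrite /off /= symE andbCA andbC -andbA => /and3P[-> -> ->].
Qed.

Lemma translate_adjoin i s (N : R -> Prop) : ideal N -> vt i != s -> stable (translate i) N ->
  stable (translate i) (adjoin N (a s)).
Proof.
move=> idN si sN; have [q e] := @translate_lin_fixed i (avec s) (avec_ty si).
exact: stable_adjoin idN e sN.
Qed.

Lemma free_a r (N : R -> Prop) : ideal N -> stable (translate (x1 r)) N -> regular N (a r).
Proof. by move=> idN sN; apply: translate_regular sN _; rewrite // avec_x1 oner_neq0. Qed.

Lemma free_h v (N : R -> Prop) : ideal N -> (forall i, vt i = ty v -> stable (translate i) N) ->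
  regular N (H v).
Proof.
move=> idN sN; have [i vi] : exists i, h v 0 i != 0 by apply/rV0Pn.
apply: (translate_regular (i := i)) => //; apply: sN.
by apply/eqP; apply: contraNT vi => vi; rewrite h_ty.
Qed.

Lemma free_Phi r (N : R -> Prop) : ideal N -> (forall i, vt i = r -> stable (translate i) N) ->
  regular N (Phi r).
Proof.
by move=> idN sN; apply: regular_prod => v /eqP vr; apply: free_h; rewrite // vr.
Qed.

Lemma a_regular E' r : (forall u v, E' u v -> E u v) -> regular (line_ideal E' h) (a r).
Proof.
move=> sE w aw u v E'uv; apply: linideal_regular (aw _ _ E'uv).
by apply: avec_gen; apply/Ety/sE.
Qed.

Lemma off_E r u v : off r u v -> E u v.
Proof. by case/and3P. Qed.

Lemma grade_a_ex r s : exists q, grade vt r (a s) = (a s)%:P * q.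
Proof. exact: grade_lin_ex (@avec_ty s). Qed.

Lemma I_grade r : stable (grade vt r) I.
Proof.
apply: stable_line_ideal => [u v _|u v]; last by rewrite symE.
exact: grade_lin_ex (h_ty (v := u)).
Qed.

Lemma off_grade r s : stable (grade vt r) (Ioff s).
Proof.
apply: stable_line_ideal => [u v _|u v]; first exact: grade_lin_ex (h_ty (v := u)).
by rewrite /off /= symE andbCA andbC -andbA => /and3P[-> -> ->].
Qed.

Lemma adjoin_grade r s (N : R -> Prop) : ideal N -> stable (grade vt r) N ->
  stable (grade vt r) (adjoin N (a s)).
Proof. by move=> idN sN; have [q e] := grade_a_ex r s; apply: stable_adjoin idN e sN. Qed.

Lemma component_high t (l : R) d k (q : R) : grade vt t l = l%:P * 'X -> (k < d)%N ->
  component vt t k (q * l ^+ d) = 0.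
Proof. by move=> gl kd; rewrite /component rmorphM rmorphXn /= gl exprMn mulrA coefMXn kd. Qed.

(** A graded Krull intersection theorem: once [k] exceeds the degree of [w] in type [t], multiples
    of [x t ^+ k] and [a t ^+ k] have no components in the degrees where [w] has any. *)
Lemma graded_separated t (N : R -> Prop) w : ideal N -> stable (grade vt t) N ->
  (forall k, adjoins N [:: x t ^+ k; a t ^+ k] w) -> N w.
Proof.
move=> idN sN Nw; rewrite (sum_components vt t w); apply: ideal_sum => // k _.
have [_ [q [[m [p [Nm ->]]] def_w]]] := Nw (size (grade vt t w)).
move: (ltn_ord k) def_w; set d := size _ => kd def_w.
have gx : grade vt t (x t) = (x t)%:P * 'X.
  rewrite -linform_delta grade_lin // => j jt.
  by rewrite mxE eqxx /=; case: (eqVneq j) jt => // ->; rewrite vt0 eqxx.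
have ga : grade vt t (a t) = (a t)%:P * 'X by apply: grade_lin; apply: avec_ty.
rewrite def_w raddfD raddfD /= (component_high _ gx kd) (component_high _ ga kd) !addr0.
exact: sN.
Qed.

(** As [x r] and [a r] span the forms of type [r], these are sequences whose ideal has all variables
    in its radical. *)
Definition has_powers (us : seq R) : Prop :=
  forall r, (exists k, x r ^+ k \in us) /\ (exists k, a r ^+ k \in us).

Hypothesis depth4 : exists fs : seq R, [/\ size fs = 4%N, forall f, f \in fs -> f@_0%MM = 0 &
  forall k, (k < 4)%N -> regular (adjoins I (take k fs)) (nth 0 fs k)].

Lemma acyclic4 us : has_powers us -> acyclic I 4 us.
Proof.
move=> pus; have [fs [szfs fs0 reg]] := depth4.
rewrite -szfs; apply: acyclic_regular_seq; first exact: I_ideal.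
  by rewrite szfs.
move=> f /fs0 f0; pose J g := exists cs, g = kpairing us cs.
have idJ : ideal (radical J) by apply/ideal_radical/kpairing_ideal.
apply: (irrelevant_in_ideal idJ) => // i.
have Jx r : radical J (x r).
  by have [[k kus] _] := pus r; exists k; apply: kpairing_mem.
have Ja r : radical J (a r).
  by have [_ [k kus]] := pus r; exists k; apply: kpairing_mem.
case: (vt_x i) => ->; first exact: Jx.
have -> : 'X_(x1 (vt i)) = a (vt i) - tau%:MP * x (vt i) :> R.
  by rewrite /= avecE mul_mpolyC addrK.
by apply: (idealB idJ) => //; apply: (idealMl idJ).
Qed.

Lemma acyclic_I1 r us : has_powers us -> acyclic (adjoin I (a r)) 3 us.
Proof.
by move=> pus; apply: (acyclic_adjoin I_ideal (a_regular _)) (acyclic4 pus).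
Qed.

Lemma colon_power r (J : R -> Prop) : ideal J -> J (Phi r) -> J (a r) ->
  J (x r ^+ #|[pred v | ty v == r]|).
Proof.
move=> idJ JPhi Ja; apply: (assoc_mem idJ _ JPhi).
rewrite -prodr_const; apply: (assoc_prod idJ) => v /eqP vr.
by rewrite -vr; apply: assoc_h; rewrite ?vr.
Qed.

Section Triple.
Variables (r s t : 'I_3).
Hypotheses (rs : r != s) (rt : r != t) (st : s != t).

Lemma third_type q : [|| q == r, q == s | q == t].
Proof.
have := ord3_pigeonhole r s t q.
by rewrite (negPf rs) (negPf rt) (negPf st) ![_ == q]eq_sym.
Qed.

(** Let [a s] kill [w] modulo [N]. For the lines off type [s] or off type [r] the form [a s] is
    regular, so [Phi s] and [Phi r] kill [w], and with them powers of the variables of both types.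
    Three degrees of vanishing cohomology then put [w] in [N] plus the powers [x t ^+ k] and
    [a t ^+ k], for every [k], and the grading in type [t] concludes. *)
Lemma regular2 : regular (adjoin I (a r)) (a s).
Proof.
have idI := I_ideal; have idN : ideal (adjoin I (a r)) by apply: ideal_adjoin.
move=> w; set N := adjoin I (a r) => Nw.
have idJ := ideal_colon w idN; set J := colon N w in idJ.
have Jas : J (a s) by [].
have Jar : J (a r) by apply: (idealMr idN); apply: adjoin_mem.
have JPs : J (Phi s).
  apply: (@adjoin_Phi s (a r) (Ioff s)); first exact: Phi_off.
  have idS := off_ideal s.
  apply: (free_a (r := s) (ideal_adjoin idS _)).
    by apply: translate_adjoin; rewrite ?vt1 1?eq_sym //; apply: off_translate; rewrite vt1.
  by apply: adjoin_mono Nw; apply: off_sub.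
have JPr : J (Phi r).
  apply: (@adjoin_Phi r (a r) (Ioff r)); first exact: Phi_off.
  have idRr := off_ideal r.
  (* Off type [r] it is [a r] that is free, so it is taken second and the order is then
     exchanged. *)
  have reg : regular (adjoin (Ioff r) (a r)) (a s).
    apply: regular_swap => //; first by apply: a_regular => u v; apply: off_E.
    apply: free_a; first exact: ideal_adjoin.
    by apply: translate_adjoin; rewrite ?vt1 //; apply: off_translate; rewrite vt1.
  by apply: reg; apply: adjoin_mono Nw; apply: off_sub.
apply: (graded_separated (t := t)) => //; first by apply: adjoin_grade => //; apply: I_grade.
move=> k; pose m q := #|[pred v | ty v == q]|.
have hp : has_powers ([:: x t ^+ k; a t ^+ k] ++
                       [:: x r ^+ m r; a r ^+ 1; x s ^+ m s; a s ^+ 1]).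
  move=> q; have := third_type q; rewrite /= => /or3P[]/eqP->; split;
  by [exists (m r); rewrite !inE eqxx ?orbT | exists (m s); rewrite !inE eqxx ?orbT
     | exists k; rewrite !inE eqxx ?orbT | exists 1%N; rewrite !inE eqxx ?orbT].
apply: (acyclic_torsion idN (acyclic_I1 (r := r) hp)).
move=> g; rewrite !inE => /or4P[]/eqP->; rewrite ?expr1.
- exact: (colon_power idJ JPr Jar).
- exact: Jar.
- exact: (colon_power idJ JPs Jas).
- exact: Jas.
Qed.

End Triple.

Section Triple2.
Variables (r s t : 'I_3).
Hypotheses (rs : r != s) (rt : r != t) (st : s != t).

(** Multiplication by [Phi r], which is regular here, brings the question back to [I], where
    [regular2] applies with the types [s], [t]. *)
Lemma regular_off : regular (adjoin (Ioff r) (a s)) (a t).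
Proof.
have idI := I_ideal; have idRr := off_ideal r.
have idN : ideal (adjoin (Ioff r) (a s)) by apply: ideal_adjoin.
move=> w Nw; apply: (free_Phi (r := r) idN).
  by move=> i ir; apply: translate_adjoin; rewrite ?ir //; apply: off_translate.
apply: (adjoin_mono (@off_sub r)).
apply: (@regular2 s t r); rewrite // 1?eq_sym //.
rewrite mulrCA; apply: adjoin_Phi Nw; exact: Phi_off.
Qed.

End Triple2.

Section Triple3.
Variables (r s t : 'I_3).
Hypotheses (rs : r != s) (rt : r != t) (st : s != t).

(** The argument of [regular2], but now powers of the variables of all three types kill [w], so
    vanishing in degree 0 already gives the claim. *)
Lemma regular3 : regular (adjoin (adjoin I (a r)) (a s)) (a t).
Proof.
have idI := I_ideal; have idN1 : ideal (adjoin I (a r)) by apply: ideal_adjoin.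
have idN : ideal (adjoin (adjoin I (a r)) (a s)) by apply: ideal_adjoin.
move=> w; set N := adjoin (adjoin I (a r)) (a s) => Nw.
have idJ := ideal_colon w idN; set J := colon N w in idJ.
have [sr tr ts] : [/\ s != r, t != r & t != s] by rewrite ![_ == r]eq_sym (eq_sym t).
have Jat : J (a t) by [].
have Jas : J (a s) by apply: (idealMr idN); apply: adjoin_mem.
have Jar : J (a r) by apply: (idealMr idN); apply: adjoin_sub => //; apply: adjoin_mem.
have toPhi q : adjoin (adjoin (Ioff q) (a r)) (a s) w -> J (Phi q).
  by apply: adjoin_Phi => f; apply: adjoin_Phi; apply: Phi_off.
have offN q f : N f -> adjoin (adjoin (Ioff q) (a r)) (a s) f.
  by apply: adjoin_mono => g; apply: adjoin_mono; apply: off_sub.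
have id1 q p := ideal_adjoin (off_ideal q) (a p).
have id2 q p p' := ideal_adjoin (id1 q p) (a p').
have st1 q p : q != p -> stable (translate (x1 q)) (adjoin (Ioff q) (a p)).
  move=> qp; apply: translate_adjoin; rewrite ?vt1 //; first exact: off_ideal.
  by apply: off_translate; rewrite vt1.
have st2 q p p' : q != p -> q != p' ->
    stable (translate (x1 q)) (adjoin (adjoin (Ioff q) (a p)) (a p')).
  by move=> qp qp'; apply: translate_adjoin; rewrite ?vt1 //; apply: st1.
have JPt : J (Phi t).
  apply: toPhi; apply: (free_a (id2 _ _ _) (st2 _ _ _ tr ts)); exact: offN.
have JPs : J (Phi s).
  apply: toPhi; have reg : regular (adjoin (adjoin (Ioff s) (a r)) (a s)) (a t).
    apply: regular_swap; [exact: id1 | exact: regular_off |].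
    by apply: free_a (id2 _ _ _) (st2 _ _ _ _ _).
  by apply: reg; apply: offN.
have JPr : J (Phi r).
  apply: toPhi; apply: adjoin_comm.
  have reg : regular (adjoin (adjoin (Ioff r) (a s)) (a r)) (a t).
    apply: regular_swap; [exact: id1 | exact: regular_off |].
    by apply: free_a (id2 _ _ _) (st2 _ _ _ _ _).
  by apply: reg; apply: adjoin_comm; apply: offN.
pose m q := #|[pred v | ty v == q]|.
have hp : has_powers ([::] ++
    [:: x r ^+ m r; a r ^+ 1; x s ^+ m s; a s ^+ 1; x t ^+ m t; a t ^+ 1]).
  move=> q; have := third_type rs rt st q; rewrite /= => /or3P[]/eqP->; split;
  by [exists (m r); rewrite !inE eqxx ?orbT | exists (m s); rewrite !inE eqxx ?orbT
     | exists (m t); rewrite !inE eqxx ?orbT | exists 1%N; rewrite !inE eqxx ?orbT].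
have ac2 := acyclic_adjoin idN1 (regular2 rs rt st) (acyclic_I1 (r := r) hp).
apply: (acyclic_torsion idN (acyclic_leq (isT : 1 <= 2)%N ac2)).
move=> g; rewrite !inE => /or4P[/eqP->|/eqP->|/eqP->|/or3P[]/eqP->]; rewrite ?expr1.
- exact: (colon_power idJ JPr Jar).
- exact: Jar.
- exact: (colon_power idJ JPs Jas).
- exact: Jas.
- exact: (colon_power idJ JPt Jat).
- exact: Jat.
Qed.

End Triple3.

Definition full : R -> Prop :=
  adjoin (adjoin (adjoin I (a ord0)) (a (Ordinal (isT : (1 < 3)%N)))) (a ord_max).

Lemma full_ideal : ideal full.
Proof. do 3!apply: ideal_adjoin; exact: I_ideal. Qed.

Lemma full_a r : full (a r).
Proof.
have id1 := ideal_adjoin I_ideal (a ord0).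
have id2 := ideal_adjoin id1 (a (Ordinal (isT : (1 < 3)%N))).
have := ord3_pigeonhole ord0 (Ordinal (isT : (1 < 3)%N)) ord_max r.
rewrite /= => /or3P[]/eqP <-; rewrite /full.
- by apply: adjoin_sub; apply: adjoin_sub; apply: adjoin_mem I_ideal _.
- by apply: adjoin_sub; apply: adjoin_mem.
- exact: adjoin_mem.
Qed.

(** The last unit of depth: after the three forms, degree 0 cohomology still vanishes. *)
Lemma full_torsion_free w (m : 'I_3 -> nat) : (forall r, full (x r ^+ m r * w)) -> full w.
Proof.
move=> xw; pose o1 : 'I_3 := Ordinal (isT : (1 < 3)%N).
have id1 := ideal_adjoin I_ideal (a ord0).
have id2 := ideal_adjoin id1 (a o1).
have hp : has_powers ([::] ++ [:: x ord0 ^+ m ord0; x o1 ^+ m o1;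
    x ord_max ^+ m ord_max; a ord0 ^+ 1; a o1 ^+ 1; a ord_max ^+ 1]).
  move=> q; have := @third_type ord0 o1 ord_max isT isT isT q.
  rewrite /= => /or3P[]/eqP->; split;
  by [exists (m ord0); rewrite !inE eqxx ?orbT | exists (m o1); rewrite !inE eqxx ?orbT
     | exists (m ord_max); rewrite !inE eqxx ?orbT | exists 1%N; rewrite !inE eqxx ?orbT].
have ac2 := acyclic_adjoin id1 (@regular2 ord0 o1 ord_max isT isT isT)
  (acyclic_I1 (r := ord0) hp).
have ac1 := acyclic_adjoin id2 (@regular3 ord0 o1 ord_max isT isT isT) ac2.
apply: (acyclic_torsion full_ideal ac1).
move=> g; rewrite !inE => /or4P[/eqP->|/eqP->|/eqP->|/or3P[]/eqP->]; rewrite ?expr1 //;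
  by apply: (idealMr full_ideal); apply: full_a.
Qed.

End Depth.

(** * Forms in the ideal of lines *)

Lemma big_enum_thom (A : {set T}) :
  thom vt (fun r => #|A :&: tyset ty r|) (\prod_(v in A) H v).
Proof.
apply: (@eq_thom _ _ _ _ (fun r => \sum_(v in A) (r == ty v))%N) => [r|].
  rewrite -sum1_card [RHS](eq_bigl (fun v => (v \in A) && (ty v == r))); last first.
    by move=> v; rewrite !inE.
  by rewrite big_mkcondr; apply: eq_bigr => v _; rewrite eq_sym; case: eqP.
apply: (@thom_prod _ _ _ vt _ _ (fun v r => (r == ty v) : nat)) => v _.
by apply: thom_lin; apply: h_ty.
Qed.

(* On the hyperplane of [v], a form of degree [c s] in type [s] with more than [c s] zeros
   vanishes. *)
Lemma thom_heavy c f v s (A : {set T}) : thom vt c f -> ty v != s -> (c s < #|A|)%N ->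
  (forall u, u \in A -> ty u = s /\ linideal (h v + h u)%MS f) -> linideal (h v) f.
Proof.
move=> fc vs cA fA.
have [||b Mb] := @pencil K n 1 (h v) T h (enum A) f (enum_uniq _).
- move=> u w; rewrite !mem_enum => /fA[us _] /fA[ws _] uw; apply: h_gen => //.
    by rewrite ws.
  by apply: contraNneq vs => <-; rewrite us.
- by move=> u; rewrite mem_enum => /fA[].
have := grade_linideal1 s (h_ty (v := v)) Mb (c s).
have -> : \prod_(u <- enum A) H u = \prod_(u in A) H u by rewrite big_enum.
rewrite (rmorphB (grade vt s)) (rmorphM (grade vt s)) /= big_enum_thom fc coefB coefZ coefXn eqxx mulr1.
rewrite (_ : A :&: tyset ty s = A); last first.
  by apply/setIidPl/subsetP => u /fA[us _]; rewrite inE us.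
by rewrite -mul_polyC mulrA coefMXn cA subr0.
Qed.

(** Each factor split off costs one unit of degree in its type. This is what turns degrees of forms
    into bounds on numbers of vertices. *)
Lemma divide_heavy (A : {set T}) c f : thom vt c f -> f != 0 ->
  (forall v, v \in A -> linideal (h v) f) -> exists g, [/\ f = \prod_(v in A) H v * g, g != 0,
    forall r, (#|A :&: tyset ty r| <= c r)%N & thom vt (fun r => c r - #|A :&: tyset ty r|)%N g].
Proof.
move=> fc f0; have [m] := ubnP #|A|; elim: m => // m IH in A *; rewrite ltnS => Am fA.
have [->|A0] := eqVneq A set0.
  exists f; split=> //; first by rewrite big_set0 mul1r.
    by move=> r; rewrite set0I cards0.
  by apply: eq_thom fc => r; rewrite set0I cards0 subn0.
have [v vA] := set0Pn _ A0.
have [||g [def_f g0 cg gc]] := IH (A :\ v).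
- by apply: leq_trans Am; rewrite [X in (_ < X)%N](cardsD1 v) vA.
- by move=> u /setD1P[_ /fA].
have cardA r : #|A :&: tyset ty r| = ((r == ty v) + #|(A :\ v) :&: tyset ty r|)%N.
  rewrite (cardsD1 v) !inE vA eq_sym; congr (_ + _)%N.
  by apply: eq_card => u; rewrite !inE andbA.
have /linideal1P[q def_g] : linideal (h v) g.
  have : linideal (h v) f := fA v vA; rewrite def_f; apply: regular_prod => u.
  by move=> /setD1P[uv _]; apply: linideal_regular; apply: h_sub.
have q0 : q != 0 by apply: contraNneq g0 => q0; rewrite def_g q0 mulr0.
rewrite def_g in gc; have [cv qc] := thom_divide (h_ty (v := v)) (h_neq0 v) gc q0.
exists q; split=> //.
- by rewrite [in RHS](big_setD1 v) //= def_f def_g mulrA [H v * _]mulrC.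
- move=> r; rewrite cardA; case: eqVneq => [->|_]; last exact: cg.
  by rewrite /= add1n -subn_gt0.
by apply: eq_thom qc => r; rewrite cardA addnC subnDA.
Qed.

(** Modulo [h u] the form is a multiple of [H v], which has no component of degree 0 in the type of
    [v], while the form has no other. *)
Lemma thom_degree0 c g u v : thom vt c g -> c (ty v) = 0%N -> ty u != ty v ->
  linideal (h v + h u)%MS g -> linideal (h u) g.
Proof.
move=> gc cv uv guv.
have /linideal_adds[m [q [Mm def_g]]] : linideal (h u + h v)%MS g.
  by apply: linideal_sub guv; rewrite addsmxC.
have := grade_linideal1 (ty v) (h_ty (v := u)) Mm 0%N.
have -> : m = g - q * H v by rewrite def_g addrK.
rewrite (rmorphB (grade vt _)) (rmorphM (grade vt _)) /= gc cv expr0 grade_lin; last exact: h_ty.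
by rewrite mulrA coefB coefZ coef1 mulr1 coefMX /= subr0.
Qed.

Lemma linideal_strip (A : {set T}) u v g : ty u != ty v -> u \notin A -> v \notin A ->
  linideal (h u + h v)%MS (\prod_(w in A) H w * g) -> linideal (h u + h v)%MS g.
Proof.
move=> uv uA vA; apply: regular_prod => w wA; apply: linideal_regular.
by apply: h_gen => //; [apply: contraNneq uA => <- | apply: contraNneq vA => <-].
Qed.

(** A common zero of all [a r] at which each [x r] is 1; it certifies that forms are nonzero. *)
Definition apoint (k : 'I_n) : K := if k == x0 (vt k) then 1 else - tau.

Lemma apoint_x r : (x r).@[apoint] = 1.
Proof. by rewrite mevalXU /apoint vt0 eqxx. Qed.

Lemma apoint_a r : (a r).@[apoint] = 0.
Proof.
rewrite avecE mevalD mevalZ !mevalXU /apoint vt0 vt1 eqxx eq_sym (negPf (x01 r)).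
by rewrite mulr1 addNr.
Qed.

Lemma apoint_ideal : ideal (fun f : R => f.@[apoint] = 0).
Proof.
split=> [|f g ef eg|f g eg]; first by rewrite meval0.
  by rewrite mevalD ef eg addr0.
by rewrite mevalM eg mulr0.
Qed.

Lemma apoint_adjoins (l : seq 'I_3) (N : R -> Prop) f : (forall g, N g -> g.@[apoint] = 0) ->
  adjoins N [seq a r | r <- l] f -> f.@[apoint] = 0.
Proof.
rewrite /adjoins; elim: l N => [|r l IH] N N0 /=; first exact: N0.
apply: IH => _ [g [q [/N0 g0 ->]]].
by rewrite mevalD g0 mevalM apoint_a mulr0 addr0.
Qed.

Lemma apoint_h v : (H v).@[apoint] != 0.
Proof.
have [c c0 e] := assoc_h (v := v) apoint_ideal (apoint_a _).
move: e; rewrite /= mevalB mevalZ apoint_x mulr1 => /eqP; rewrite subr_eq0 => /eqP->.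
exact: c0.
Qed.

Lemma assoc_h_power (J : R -> Prop) (A : {set T}) : ideal J ->
  (forall v, v \in A -> J (a (ty v))) ->
  assoc J (\prod_(v in A) H v) (\prod_r x r ^+ #|A :&: tyset ty r|).
Proof.
move=> idJ Ja; have -> : \prod_r x r ^+ #|A :&: tyset ty r| = \prod_(v in A) x (ty v).
  rewrite (partition_big ty predT) //=; apply: eq_bigr => r _.
  rewrite -prodr_const; apply: eq_big => [v|v]; first by rewrite !inE.
  by rewrite !inE => /andP[_ /eqP->].
by apply: assoc_prod => // v vA; apply: assoc_h => //; apply: Ja.
Qed.

Lemma thom_monomial c : thom vt c (\prod_r x r ^+ c r).
Proof.
apply: (@eq_thom _ _ _ _ (fun q => \sum_r (q == r) * c r)%N) => [q|].
  rewrite (bigD1 q) //= eqxx mul1n big1 ?addn0 // => r rq.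
  by rewrite eq_sym (negPf rq).
apply: (@thom_prod _ _ _ vt _ _ (fun r q => (q == r) * c r)%N) => r _.
apply: (@thomX _ _ _ _ (fun q => (q == r) : nat)).
rewrite -linform_delta; apply: thom_lin => j jr; rewrite mxE eqxx /=.
by have -> : (j == x0 r) = false by apply: contraNF jr => /eqP->; rewrite vt0.
Qed.

Section Forms.
Variable E : rel T.
Hypotheses (symE : forall u v, E u v = E v u) (Ety : forall u v, E u v -> ty u != ty v).
Local Notation I := (line_ideal E h).
Local Notation Ioff r := (line_ideal (off E r) h).
Hypothesis depth4 : exists fs : seq R, [/\ size fs = 4%N, forall f, f \in fs -> f@_0%MM = 0 &
  forall k, (k < 4)%N -> regular (adjoins I (take k fs)) (nth 0 fs k)].

(** The component of [f] of degree [c] differs from [m] by a combination of the [a r], so it takes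
    the same nonzero value at [apoint]. *)
Lemma homogenize (N : R -> Prop) c f m : (forall r, stable (grade vt r) N) -> thom vt c m ->
  N f -> adjoins (fun g => g = 0) [seq a r | r <- enum 'I_3] (m - f) -> m.@[apoint] != 0 ->
  exists F, [/\ F != 0, N F & thom vt c F].
Proof.
move=> gN mc Nf Jmf m0; exists (multicomponent vt c f); split.
- pose J := adjoins (fun g : R => g = 0) [seq a r | r <- enum 'I_3].
  have J1 : J (m - multicomponent vt c f).
    rewrite -{1}(multicomponent_id mc) -multicomponentB.
    apply: stable_multicomponent Jmf => r; rewrite /adjoins.
    have id0 : ideal (fun g : R => g = 0).
      by split=> // [g1 g2 -> ->|g1 g2 ->]; rewrite ?addr0 ?mulr0.
    have : stable (grade vt r) (fun g : R => g = 0).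
      by move=> g -> k; rewrite rmorph0 coef0.
    elim: (enum 'I_3) (fun g : R => g = 0) id0 => [|s l IH] N' idN' //= sN'.
    by apply: IH; [apply: ideal_adjoin | apply: adjoin_grade].
  apply: contraNneq m0 => F0; move: J1; rewrite F0 subr0 => J1; apply/eqP; move: J1.
  by move=> J1; apply: (apoint_adjoins _ J1) => g ->; rewrite meval0.
- exact: stable_multicomponent.
- exact: multicomponent_thom.
Qed.

Lemma full_split f : full E f ->
  exists g, I g /\ adjoins (fun g => g = 0) [seq a r | r <- enum 'I_3] (f - g).
Proof.
move=> [_ [q2 [[_ [q1 [[g [q0 [Ig ->]]] ->]]] ->]]]; exists g; split=> //.
have id0 : ideal (fun g : R => g = 0).
  by split=> // [g1 g2 -> ->|g1 g2 ->]; rewrite ?addr0 ?mulr0.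
have idA := ideal_adjoins [seq a r | r <- enum 'I_3] id0.
have aA r : adjoins (fun g => g = 0) [seq a r | r <- enum 'I_3] (a r).
  by apply: adjoins_mem => //; apply/mapP; exists r; rewrite ?mem_enum.
set p := _ - g; have -> : p = q0 * a ord0 + q1 * a (Ordinal (isT : (1 < 3)%N)) + q2 * a ord_max.
  by rewrite /p; ring.
by do 2?[apply: idealD => //]; apply: idealMl.
Qed.

(** Modulo [full] only counts per type matter. Hence the monomial with exponents [c], times a power
    of [x r], is associate to a padded product of [Phi r] with the hyperplanes of a cover off [r],
    an element of [I]. Having this for all [r], torsion freeness removes the powers. *)
Lemma glue_form c : (forall r, coverable_off ty E c r) ->
  exists F, [/\ F != 0, I F & thom vt c F].
Proof.
move=> cov; pose m : R := \prod_r x r ^+ c r.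
have idF := full_ideal E.
suff /full_split[g [Ig Jmg]] : full E m.
  apply: (homogenize (I_grade symE) (thom_monomial c) Ig Jmg).
  rewrite rmorph_prod /=; apply/prodf_neq0 => r _.
  by rewrite rmorphXn /= apoint_x expr1n oner_neq0.
apply: (full_torsion_free symE Ety depth4 (m := fun r => #|[pred v | ty v == r]|)) => r.
have [C [covC cC]] := cov r; pose B := C :\: tyset ty r.
have BC q : q != r -> B :&: tyset ty q = C :&: tyset ty q.
  move=> qr; apply/setP => v; rewrite !inE; case: eqVneq => [->|] //=.
  by rewrite eq_sym (negPf qr) andbF.
have Br : B :&: tyset ty r = set0.
  by apply/setP => v; rewrite !inE; case: (ty v == r); rewrite ?andbF.
(* Fills every degree up to [c]; in type [r], absent from [B], it supplies all of [c r]. *)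
pose pad : R := \prod_q x q ^+ (c q - #|B :&: tyset ty q|).
have IG : I (\prod_(v | ty v == r) H v * (\prod_(v in B) H v * pad)).
  apply: Phi_off => u v /and3P[Euv ur vr]; rewrite mulrC.
  apply: (idealMl (linideal_ideal _)).
  have BU (z : T) (M : 'M[K]_n) : z \in B -> (h z <= M)%MS -> linideal M (\prod_(v in B) H v).
    move=> zB zM; rewrite (bigD1 z) //=; apply: (idealMr (linideal_ideal _)).
    by apply/linideal_lin.
  have /orP[uC|vC] := covC u v Euv ur vr.
    by apply: (BU u); rewrite ?inE ?ur ?uC ?addsmxSl.
  by apply: (BU v); rewrite ?inE ?vr ?vC ?addsmxSr.
have : full E (\prod_(v | ty v == r) H v * (\prod_(v in B) H v * pad)).
  do 3![apply: adjoin_sub]; exact: IG.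
apply: (assoc_mem idF).
have fa q := full_a E q.
apply: (assocM idF).
  rewrite -prodr_const; apply: (assoc_prod idF) => v /eqP vr.
  by rewrite -vr; apply: assoc_h.
have -> : m = \prod_q x q ^+ #|B :&: tyset ty q| * pad.
  rewrite /m /pad -big_split; apply: eq_bigr => q _ /=; rewrite -exprD subnKC //.
  by have [->|qr] := eqVneq q r; [rewrite Br cards0 | rewrite BC // cC].
by apply: (assocM idF); [apply: assoc_h_power | apply: assoc_refl].
Qed.


Section Ferrers.
Variables (r s t : 'I_3).
Hypotheses (rs : r != s) (rt : r != t) (st : s != t).

Lemma off_line_ideal f : (forall p q, E p q -> ty p = s -> ty q = r ->
  linideal (h p + h q)%MS f) -> Ioff t f.
Proof.
move=> fE p q /and3P[Epq pt qt].
have tyP v : ty v != t -> ty v = r \/ ty v = s.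
  move=> vt'; have := third_type rs rt st (ty v); rewrite (negPf vt') orbF.
  by case/orP => /eqP; [left | right].
have [pr|ps] := tyP p pt; have [qr|qs] := tyP q qt; move: (Ety Epq).
- by rewrite pr qr eqxx.
- by move=> _; apply: linideal_sub (fE q p _ qs pr); [rewrite addsmxC | rewrite symE].
- by move=> _; apply: fE.
- by rewrite ps qs eqxx.
Qed.

Variable j : nat.
Let D := [set v | (ty v == s) && (j < #|nbr ty E r v|)%N].
Let J := adjoin (Ioff t) (a r).
Let g (Z : {set T}) : R := x r ^+ j * \prod_(v in tyset ty s :\: Z) H v.

Lemma ferrers_ideal : ideal J.
Proof. exact: ideal_adjoin (line_ideal_ideal _ _) _. Qed.

(* Remove from the product over all hyperplanes of type [s] those of [Z], all light: two of
   them generate the general form of type [s], which is regular modulo [J]. *)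
Lemma ferrers_product (Z : {set T}) : Z \subset tyset ty s :\: D -> J (g Z).
Proof.
have idJ := ferrers_ideal; have [m] := ubnP #|Z|; elim: m => // m IH in Z *; rewrite ltnS => Zm ZD.
have [Z0|Z0] := eqVneq Z set0.
  apply: (idealMl idJ); apply: adjoin_sub; apply: off_line_ideal => p q Epq ps qr.
  rewrite Z0 (bigD1 p) ?inE ?ps //=; apply: (idealMr (linideal_ideal _)).
  by apply/linideal_lin; apply: addsmxSl.
have [v vZ] := set0Pn _ Z0; have := subsetP ZD v vZ; rewrite !inE => /andP[+ vs].
rewrite vs /= -leqNgt => vj.
have gD u : u \in Z -> g (Z :\ u) = H u * g Z.
  move=> uZ; have := subsetP ZD u uZ; rewrite !inE => /andP[_ us].
  rewrite /g mulrCA; congr (_ * _); rewrite (bigD1 u) /=; last by rewrite !inE uZ us eqxx.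
  congr (_ * _); apply: eq_bigl => w; rewrite !inE.
  by case: eqVneq => [->|_]; rewrite ?uZ ?andbF //= andbT.
(* If only the light vertex [v] is left out, the factor [x r ^+ j] stands for its neighbours, at
   most [j] in number, which cover its lines. *)
have [Z1|/set0Pn[u /setD1P[uv uZ]]] := eqVneq (Z :\ v) set0.
  pose P : R := \prod_(w in nbr ty E r v) H w * x r ^+ (j - #|nbr ty E r v|).
  have JP : J (P * \prod_(w in tyset ty s :\: Z) H w).
    apply: adjoin_sub; apply: off_line_ideal => p q Epq ps qr.
    have [pv|pv] := eqVneq p v.
      apply: (idealMr (linideal_ideal _)); apply: (idealMr (linideal_ideal _)).
      rewrite (bigD1 q) /=; last by rewrite inE -pv Epq qr eqxx.
      by apply: (idealMr (linideal_ideal _)); apply/linideal_lin; apply: addsmxSr.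
    apply: (idealMl (linideal_ideal _)); rewrite (bigD1 p) /=; last first.
      rewrite !inE ps eqxx andbT; apply/negP => pZ.
      by have := in_set0 p; rewrite -Z1 !inE pv pZ.
    by apply: (idealMr (linideal_ideal _)); apply/linideal_lin; apply: addsmxSl.
  apply: (assoc_mem idJ _ JP); apply: (assocM idJ); last exact: assoc_refl.
  rewrite -{1}(subnKC vj) exprD /P; apply: (assocM idJ); last exact: assoc_refl.
  rewrite -prodr_const; apply: (assoc_prod idJ) => w; rewrite inE => /andP[_ /eqP wr].
  by rewrite -wr; apply: assoc_h; rewrite // wr; apply: adjoin_mem (line_ideal_ideal _ _) _.
have reg : regular J (a s) by apply: (regular_off symE Ety depth4); rewrite // eq_sym.
have us : ty u = s by have := subsetP ZD u uZ; rewrite !inE => /andP[_ /eqP].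
apply: reg.
have small (w : T) : w \in Z -> J (H w * g Z).
  move=> wZ; rewrite -gD //; apply: IH; last exact: subset_trans (subsetDl _ _) ZD.
  by apply: leq_trans Zm; rewrite [X in (_ < X)%N](cardsD1 w) wZ.
have : (avec s <= h u + h v)%MS.
  have key (w : 'rV[K]_n) : of_type vt s w -> w = w 0 (x0 s) *: delta_mx 0 (x0 s) +
      w 0 (x1 s) *: delta_mx 0 (x1 s).
    move=> ws; apply/rowP => k; rewrite !mxE eqxx /=.
    have [e|ks] := eqVneq (vt k) s.
      have [->|->] := vt_x k; rewrite e eqxx; first by rewrite (negPf (x01 s)) /=; ring.
      by rewrite eq_sym (negPf (x01 s)) /=; ring.
    rewrite (ws _ ks); have -> : (k == x1 s) = false by apply: contraNF ks => /eqP->; rewrite vt1.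
    have -> : (k == x0 s) = false by apply: contraNF ks => /eqP->; rewrite vt0.
    by rewrite !(mulr0, addr0).
  pose B : 'M[K]_n := (delta_mx (0 : 'I_1) (x0 s) + delta_mx (0 : 'I_1) (x1 s))%MS.
  have inB (w : 'rV[K]_n) : of_type vt s w -> (w <= B)%MS.
    by move=> /key->; apply: addmx_sub; apply: scalemx_sub; [apply: addsmxSl | apply: addsmxSr].
  have rB : (\rank B <= 2)%N.
    apply: leq_trans (mxrank_adds_leqif _ _) _.
    by apply: (@leq_add _ _ 1 1); apply: rank_leq_row.
  apply: submx_trans (inB _ (@avec_ty s)) _.
  have sub : (h u + h v <= B)%MS.
    by rewrite addsmx_sub !inB //; [rewrite -(eqP vs) | rewrite -us]; apply: h_ty.
  have rk : (2 <= \rank (h u + h v)%MS)%N.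
    have lt : (h v < h u + h v)%MS.
      rewrite /ltmx addsmxSr /= addsmx_sub submx_refl andbT.
      by apply: h_sub.
    by apply: leq_trans (rank_ltmx lt); rewrite rank_rV h_neq0.
  have := (mxrank_leqif_sup sub).2; rewrite eqn_leq mxrankS //= => <-.
  exact: leq_trans rB rk.
case/sub_addsmxP => -[c d] /= ->; rewrite [c]mx11_scalar [d]mx11_scalar !mul_scalar_mx.
rewrite linearD !linearZ /= mulrDl -!mul_mpolyC -!mulrA.
by apply: (idealD idJ); apply: (idealMl idJ); apply: small.
Qed.

(** A form of degree [#|D|] in type [s] and [j] in type [r] vanishes on the lines between these
    types. Dividing by the heavy vertices exhausts type [s]; the rest is divisible by all neighbours
    of the light vertices [u] and [v], and degree [j] has room for those of [v] only. *)
Lemma nested_type u v : ty u = s -> ty v = s -> (#|nbr ty E r u| <= j)%N -> #|nbr ty E r v| = j ->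
  nbr ty E r u \subset nbr ty E r v.
Proof.
move=> us vs uj vj.
have Ds : D \subset tyset ty s by apply/subsetP => w; rewrite !inE => /andP[].
pose c q : nat := if q == s then #|D| else if q == r then j else 0.
pose m : R := x r ^+ j * \prod_(w in D) H w.
have [f [f0 If fc]] : exists F, [/\ F != 0, Ioff t F & thom vt c F].
  have [b [q [Ib def_m]]] : J m.
    by have := ferrers_product (subxx (tyset ty s :\: D)); rewrite /g setDDr setDv set0U (setIidPr Ds).
  apply: (homogenize (m := m) _ _ Ib).
  - by move=> q'; apply: off_grade.
  - apply: (@eq_thom _ _ _ _ (fun q => (q == r) * j + #|D :&: tyset ty q|)%N) => [q'|].
      rewrite /c; case: (eqVneq q' s) => [->|qs].
        by rewrite eq_sym (negPf rs) mul0n; congr #|pred_of_set _|; apply/setIidPl.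
      rewrite (_ : D :&: tyset ty q' = set0) ?cards0 ?addn0.
        by case: eqP; rewrite ?mul1n.
      apply/setP => w; rewrite !inE; case: eqVneq => //= ->.
      by rewrite eq_sym (negPf qs) andbF.
    apply: thomM; last exact: big_enum_thom.
    apply: (@thomX _ _ _ vt (fun q => (q == r) : nat)).
    rewrite -linform_delta; apply: thom_lin => k kr; rewrite mxE eqxx /=.
    by have -> : (k == x0 r) = false by apply: contraNF kr => /eqP->; rewrite vt0.
  - rewrite def_m addrC addKr.
    have id0 : ideal (fun g : R => g = 0).
      by split=> // [g1 g2 -> ->|g1 g2 ->]; rewrite ?addr0 ?mulr0.
    apply: (idealMl (ideal_adjoins _ id0)); apply: adjoins_mem => //.
    by apply/mapP; exists r; rewrite ?mem_enum.
  - rewrite rmorphM rmorphXn /= apoint_x expr1n mul1r rmorph_prod /=.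
    by apply/prodf_neq0 => w _; apply: apoint_h.
have cr : c r = j by rewrite /c (negPf rs) eqxx.
have fline p q : E p q -> ty p = s -> ty q = r -> linideal (h p + h q)%MS f.
  move=> Epq ps qr; apply: If; rewrite /off /= Epq ps qr st rt //.
have [w wD|g1 [def_f g10 _ g1c]] := divide_heavy (A := D) fc f0.
  move: (wD); rewrite inE => /andP[/eqP ws wj].
  apply: (thom_heavy (s := r) (A := nbr ty E r w) fc).
  - by rewrite ws eq_sym.
  - by rewrite cr.
  - by move=> q; rewrite inE => /andP[Ewq /eqP qr]; split=> //; apply: fline.
pose U := nbr ty E r u :|: nbr ty E r v.
have [q|g2 [_ _ cU _]] := divide_heavy (A := U) g1c g10.
  have half p : ty p = s -> (#|nbr ty E r p| <= j)%N -> q \in nbr ty E r p -> linideal (h q) g1.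
    move=> ps pj; rewrite inE => /andP[Epq /eqP qr].
    apply: (thom_degree0 (v := p) g1c).
    - by rewrite ps /c eqxx (setIidPl Ds) subnn.
    - by rewrite ps qr.
    - apply: (@linideal_strip D); rewrite ?ps ?qr 1?eq_sym //.
      + by rewrite inE ps eqxx /= -leqNgt.
      + by rewrite inE qr (negPf rs).
      + by rewrite -def_f; apply: fline.
  by rewrite inE => /orP[]; apply: half; rewrite ?vj.
have {cU} : (#|U| <= j)%N.
  have := cU r; rewrite (_ : U :&: tyset ty r = U); last first.
    by apply/setIidPl/subsetP => q; rewrite !inE => /orP[]/andP[].
  by rewrite cr (_ : D :&: tyset ty r = set0) ?cards0 ?subn0 //;
    apply/setP => w; rewrite !inE; case: eqVneq => //= ->; rewrite eq_sym (negPf rs) andbF.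
rewrite -vj => Uv.
have /eqP -> : nbr ty E r v == U by rewrite eqEcard subsetUr.
exact: subsetUl.
Qed.

End Ferrers.

Lemma lines_nested : nested ty E.
Proof.
move=> r u v uv; have [ur|ur] := eqVneq (ty u) r.
  have -> : nbr ty E r u = set0; last by rewrite sub0set.
  apply/setP => w; rewrite !inE; apply/negP => /andP[/Ety + /eqP wr].
  by rewrite wr ur eqxx.
have [t [rt st]] : exists t, r != t /\ ty u != t.
  move: (ty u) ur => q; move: r q; do 2![case=> [[|[|[|?]]] ?] //] => _;
  by [exists ord0 | exists ord_max | exists (Ordinal (isT : (1 < 3)%N))].
have ru : r != ty u by rewrite eq_sym.
have [le|/ltnW le] := leqP #|nbr ty E r u| #|nbr ty E r v|.
  by rewrite (nested_type ru rt st (j := #|nbr ty E r v|)).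
by rewrite orbC (nested_type ru rt st (j := #|nbr ty E r u|)).
Qed.


(** The form from [glue_form], with the degree [i] in type [r], is divided three times: by the
    vertices [D] of type [r] that are heavy, which uses up that degree; by the neighbours [W] of the
    other vertices of type [r]; and by the vertices of type [s] still heavy for [t], which
    [ferrers_cover] completes. *)
Lemma lines_tight : tight ty E.
Proof.
move=> c r cov; pose i := (\max_(s | s != r) #|heavy ty E c r s|)%N.
have [F [F0 IF Fc]] := glue_form (coverable_off_max symE Ety lines_nested cov).
have [s sr smax] : {s | s != r & i = #|heavy ty E c r s|}.
  apply: eq_bigmax_cond; apply/card_gt0P.
  by case: (eqVneq r ord0) => [->|r0]; [exists ord_max | exists ord0]; rewrite /in_mem //= eq_sym.
pose D := \bigcup_(q | q != r) heavy ty E c r q.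
have Dr v : v \in D -> ty v = r by case/bigcupP => q _; rewrite inE => /andP[/eqP].
have Dtr : D :&: tyset ty r = D by apply/setIidPl/subsetP => v /Dr; rewrite inE => ->.
have cr : cset c r i r = i by rewrite /cset eqxx.
have cq q : q != r -> cset c r i q = c q by move=> qr; rewrite /cset (negPf qr).
have [v|G [def_F G0 cD Gc]] := divide_heavy (A := D) Fc F0.
  case/bigcupP => q qr; rewrite inE => /andP[/eqP vr nv].
  apply: (thom_heavy (s := q) (A := nbr ty E q v) Fc); first by rewrite vr eq_sym.
    by rewrite cq.
  by move=> u; rewrite inE => /andP[Evu /eqP uq]; split=> //; apply: IF.
(* Degree [i] allows at most [i] elements in the union, and one of the heavy sets already has that
   many. *)
have DE : D = heavy ty E c r s.
  apply/esym/eqP; rewrite eqEcard -smax -{2}Dtr; apply/andP; split; last by rewrite -cr cD.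
  by apply/subsetP => v vs; apply/bigcupP; exists s.
have GE u v : E u v -> u \notin D -> v \notin D -> linideal (h u + h v)%MS G.
  by move=> Euv uD vD; apply: (linideal_strip (Ety Euv) uD vD); rewrite -def_F; apply: IF.
pose W := [set v | [exists u, [&& ty u == r, u \notin D & E u v]]].
have Wr v : v \in W -> ty v != r.
  by rewrite inE => /existsP[u /and3P[/eqP <- _ /Ety]]; rewrite eq_sym.
have [v|G' [def_G G'0 cW G'c]] := divide_heavy (A := W) Gc G0.
  move=> vW; have := Wr v vW; move: vW; rewrite inE => /existsP[u /and3P[/eqP ur uD Euv]] vr.
  apply: (thom_degree0 (v := u) Gc).
  - by rewrite ur cr Dtr DE -smax subnn.
  - by rewrite ur.
  - by apply: GE => //; apply: contra vr => /Dr->.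
have D0 q : q != r -> #|D :&: tyset ty q| = 0.
  move=> qr; apply/eqP; rewrite cards_eq0 -subset0; apply/subsetP => v.
  rewrite inE => /andP[/Dr vr]; rewrite inE vr => /eqP e.
  by rewrite e eqxx in qr.
have {}cW q : q != r -> (#|W :&: tyset ty q| <= c q)%N.
  by move=> qr; have := cW q; rewrite cq // D0 // subn0.
have [t [tr ts]] : exists t, t != r /\ t != s.
  move: sr; clear; move: r s; do 2![case=> [[|[|[|?]]] ?] //] => _;
  by [exists ord0 | exists ord_max | exists (Ordinal (isT : (1 < 3)%N))].
have [rs rt st] : [/\ r != s, r != t & s != t] by rewrite eq_sym sr eq_sym tr eq_sym ts.
have third q : [|| q == r, q == s | q == t] := third_type rs rt st q.
pose c' q := (c q - #|W :&: tyset ty q|)%N.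
have G'c' q : q != r -> (cset c r i q - #|D :&: tyset ty q| - #|W :&: tyset ty q| = c' q)%N.
  by move=> qr; rewrite cq // D0 // subn0.
pose E' := hollow E W; have nE' : nested ty E' := nested_hollow W lines_nested.
have symE' := @hollow_sym T E W symE.
have G'E u v : E' u v -> ty u != r -> ty v != r -> linideal (h u + h v)%MS G'.
  case/and3P => Euv uW vW ur vr; apply: (linideal_strip (Ety Euv) uW vW); rewrite -def_G.
  by apply: GE => //; [apply: contra ur | apply: contra vr] => /Dr->.
have [X [covX Xs Xt Xty]] := ferrers_cover (ty := ty) c' nE' ts.
have [v|_ [_ _ cX _]] := divide_heavy (A := heavy ty E' c' s t) G'c G'0.
  rewrite inE => /andP[/eqP vs nv].
  apply: (thom_heavy (s := t) (A := nbr ty E' t v) G'c); first by rewrite vs.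
    by rewrite G'c'.
  move=> u; rewrite inE => /andP[E'vu /eqP ut]; split=> //.
  by apply: G'E; rewrite ?vs ?ut.
have {}cX : (#|X :&: tyset ty s| <= c' s)%N.
  rewrite Xs; have := cX s; rewrite G'c' //; congr (_ <= _)%N.
  by congr #|pred_of_set _|; apply/setIidPl/subsetP => v; rewrite !inE => /andP[].
exists (D :|: W :|: X), s; split=> //.
- move=> u v Euv; rewrite !in_setU.
  have inW p q : E p q -> ty p = r -> (p \in D) || (q \in W).
    move=> Epq pr; case: (boolP (p \in D)) => //= pD; rewrite inE.
    by apply/existsP; exists p; rewrite pr eqxx pD.
  have [ur|ur] := eqVneq (ty u) r.
    by case/orP: (inW u v Euv ur) => ->; rewrite ?orbT.
  have [vr|vr] := eqVneq (ty v) r.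
    have Evu : E v u by rewrite symE.
    by case/orP: (inW v u Evu vr) => ->; rewrite ?orbT.
  have [_|uW] := boolP (u \in W); first by rewrite ?orbT.
  have [_|vW] := boolP (v \in W); first by rewrite ?orbT.
  have E'uv : E' u v by rewrite /E' /hollow /= Euv uW vW.
  have tuv := Ety Euv; move: (third (ty u)) (third (ty v)) tuv.
  rewrite (negPf ur) (negPf vr) /= => /orP[]/eqP tu /orP[]/eqP tv; rewrite tu tv ?eqxx // => _.
    by case/orP: (covX u v E'uv tu tv) => ->; rewrite ?orbT.
  have E'vu : E' v u by rewrite /E' symE'.
  by case/orP: (covX v u E'vu tv tu) => ->; rewrite ?orbT.
- move=> q qr; rewrite !setIUl.
  have Xq : (#|X :&: tyset ty q| <= c' q)%N.
    by have := third q; rewrite (negPf qr) /= => /orP[]/eqP->.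
  apply: leq_trans (leq_card_setU _ _) _; apply: (@leq_trans (#|W :&: tyset ty q| + c' q)%N).
    apply: leq_add => //; apply: leq_trans (leq_card_setU _ _) _.
    by rewrite D0 // add0n.
  by rewrite subnKC // cW.
- rewrite !setIUl Dtr DE.
  have -> : W :&: tyset ty r = set0.
    by apply/setP => v; rewrite in_set0 in_setI [v \in tyset _ _]inE; apply/negP => /andP[/Wr/negPf->].
  have -> : X :&: tyset ty r = set0.
    apply/setP => v; rewrite in_set0 in_setI [v \in tyset _ _]inE; apply/negP => /andP[/Xty].
    by move=> + /eqP vr; rewrite vr (negPf rs) (negPf rt).
  by rewrite !setU0.
Qed.

End Forms.
End LineConfiguration.

(** * From hyperplanes to the graph of lines *)

Section Coordinates.

Definition vtype (k : 'I_6) : 'I_3 := inord (k %/ 2).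
Definition xv0 (r : 'I_3) : 'I_6 := xv r ord0.
Definition xv1 (r : 'I_3) : 'I_6 := xv r ord_max.

Lemma xv0E r : val (xv0 r) = (2 * r)%N.
Proof. by rewrite /xv0 /xv /= inordK addn0 //; case: r => [[|[|[|?]]] ?]. Qed.

Lemma xv1E r : val (xv1 r) = (2 * r + 1)%N.
Proof. by rewrite /xv1 /xv /= inordK //; case: r => [[|[|[|?]]] ?]. Qed.

Lemma vtypeE k : val (vtype k) = (k %/ 2)%N.
Proof. by rewrite /vtype /= inordK // ltn_divLR. Qed.

Lemma vtype0 r : vtype (xv0 r) = r.
Proof. by apply: val_inj; rewrite vtypeE xv0E mulKn. Qed.

Lemma vtype1 r : vtype (xv1 r) = r.
Proof. by apply: val_inj; rewrite vtypeE xv1E mulnC divnMDl // addn0. Qed.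

Lemma xv01 r : xv0 r != xv1 r.
Proof. by rewrite -val_eqE xv0E xv1E -{1}[(2 * r)%N]addn0 eqn_add2l. Qed.

Lemma xvP k : k = xv0 (vtype k) \/ k = xv1 (vtype k).
Proof.
have : (k %% 2 < 2)%N by rewrite ltn_mod.
have kE := divn_eq k 2.
case: (k %% 2)%N kE => [|[|m]] // kE _; [left | right]; apply: val_inj.
  by rewrite xv0E vtypeE /= mulnC -[RHS]addn0.
by rewrite xv1E vtypeE /= mulnC.
Qed.

End Coordinates.

Section Normalization.
Variables (K : fieldType) (n : nat).
Implicit Types (u v : 'rV[K]_n).

(** Canonical representative up to scalars, so that hyperplanes become points of an [eqType] and
    coincide exactly when the vectors do. *)
Definition normv u : 'rV[K]_n :=
  if [pick k | u 0 k != 0] is Some k then (u 0 k)^-1 *: u else u.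

Lemma normv_scale c u : c != 0 -> normv (c *: u) = normv u.
Proof.
move=> c0; rewrite /normv (eq_pick (Q := fun k => u 0 k != 0)); last first.
  by move=> k; rewrite /= mxE mulf_eq0 (negPf c0).
case: pickP => [k uk|u0]; first by rewrite mxE scalerA invfM mulrAC mulVf // mul1r.
by apply/rowP => k; have := u0 k; rewrite mxE => /negbFE/eqP->; rewrite mulr0.
Qed.

Lemma normvE u : u != 0 -> exists2 c, c != 0 & u = c *: normv u.
Proof.
move=> u0; rewrite /normv; case: pickP => [k uk|h0].
  by exists (u 0 k) => //; rewrite scalerA mulfV // scale1r.
case/negP: u0; apply/eqP/rowP => k; have := h0 k; rewrite mxE.
by move/negbFE/eqP.
Qed.

Lemma normv_neq0 u : u != 0 -> normv u != 0.
Proof.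
by move=> u0; have [c c0 e] := normvE u0; apply: contraNneq u0 => e'; rewrite e e' scaler0.
Qed.

Lemma normvK u : u != 0 -> normv (normv u) = normv u.
Proof. by move=> u0; have [c c0 e] := normvE u0; rewrite [in RHS]e normv_scale. Qed.

Lemma normv_sub u v : u != 0 -> (u <= v)%MS -> normv u = normv v.
Proof.
move=> u0 /sub_rVP[c e]; rewrite e normv_scale //.
by apply: contraNneq u0 => c0; rewrite e c0 scale0r.
Qed.

End Normalization.

Section Loci.
Variable K : fieldType.
Implicit Types (u w g : 'rV[K]_6) (v : 'I_6 -> K) (z : 'I_3 -> K * K).
Local Notation of_type := (of_type vtype).

Definition mkpoint z (k : 'I_6) : K :=
  if k == xv0 (vtype k) then (z (vtype k)).1 else (z (vtype k)).2.

Lemma mkpoint0 z r : mkpoint z (xv0 r) = (z r).1.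
Proof. by rewrite /mkpoint vtype0 eqxx. Qed.

Lemma mkpoint1 z r : mkpoint z (xv1 r) = (z r).2.
Proof. by rewrite /mkpoint vtype1 eq_sym (negPf (xv01 r)). Qed.

Lemma mkpoint_is_point z : (forall r, ((z r).1 != 0) || ((z r).2 != 0)) -> is_point (mkpoint z).
Proof. by move=> z0 r; have := z0 r; rewrite -mkpoint0 -mkpoint1. Qed.

Lemma linform_type r u : of_type r u ->
  linform u = u 0 (xv0 r) *: 'X_(xv0 r) + u 0 (xv1 r) *: 'X_(xv1 r).
Proof.
move=> ur; rewrite /linform (bigD1 (xv0 r)) //= (bigD1 (xv1 r)) /=; last by rewrite eq_sym xv01.
rewrite big1 ?addr0 // => k /andP[k0 k1]; rewrite ur ?scale0r //.
by apply: contra k0 => /eqP kr; have [e|e] := xvP k; rewrite e kr ?eqxx // -kr -e eqxx in k1 *.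
Qed.

Lemma eval_mkpoint r u z : of_type r u ->
  (linform u).@[mkpoint z] = u 0 (xv0 r) * (z r).1 + u 0 (xv1 r) * (z r).2.
Proof.
by move=> /linform_type->; rewrite mevalD !mevalZ !mevalXU mkpoint0 mkpoint1.
Qed.

Definition root_of r u : K * K := (u 0 (xv1 r), - u 0 (xv0 r)).
Definition nonroot_of r u : K * K := if u 0 (xv0 r) != 0 then (1, 0) else (0, 1).

Lemma of_type_neq0 r u : of_type r u -> u != 0 -> (u 0 (xv0 r) != 0) || (u 0 (xv1 r) != 0).
Proof.
move=> ur; apply: contraTT; rewrite negb_or !negbK => /andP[/eqP u0 /eqP u1].
apply/eqP/rowP => k; rewrite mxE; have [e|/ur//] := eqVneq (vtype k) r.
by have [->|->] := xvP k; rewrite e.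
Qed.

Lemma root_ofP r u : u 0 (xv0 r) * (root_of r u).1 + u 0 (xv1 r) * (root_of r u).2 = 0.
Proof. by rewrite /= mulrN mulrC subrr. Qed.

Lemma root_of_neq0 r u : of_type r u -> u != 0 ->
  ((root_of r u).1 != 0) || ((root_of r u).2 != 0).
Proof. by move=> ur u0; rewrite /= oppr_eq0 orbC of_type_neq0. Qed.

Lemma nonroot_ofP r u : of_type r u -> u != 0 ->
  u 0 (xv0 r) * (nonroot_of r u).1 + u 0 (xv1 r) * (nonroot_of r u).2 != 0.
Proof.
move=> ur u0; rewrite /nonroot_of; have := of_type_neq0 ur u0.
by case: eqVneq => [->|h _] /=; rewrite ?mul0r ?add0r ?mulr1 // mulr0 addr0.
Qed.

Lemma nonroot_of_neq0 r u : ((nonroot_of r u).1 != 0) || ((nonroot_of r u).2 != 0).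
Proof. by rewrite /nonroot_of; case: ifP; rewrite /= oner_neq0 ?orbT. Qed.

Lemma same_root r u g : of_type r u -> of_type r g -> u != 0 -> g != 0 ->
  u 0 (xv0 r) * (root_of r g).1 + u 0 (xv1 r) * (root_of r g).2 = 0 -> normv u = normv g.
Proof.
move=> ur gr u0 g0 /= /eqP; rewrite mulrN subr_eq0 => /eqP e.
have prop c : u 0 (xv0 r) = c * g 0 (xv0 r) -> u 0 (xv1 r) = c * g 0 (xv1 r) -> normv u = normv g.
  move=> e0 e1; apply: normv_sub => //; apply/sub_rVP; exists c.
  apply/rowP => k; rewrite mxE; have [ek|kr] := eqVneq (vtype k) r; last by rewrite ur ?gr ?mulr0.
  by have [->|->] := xvP k; rewrite ek.
have := of_type_neq0 gr g0; case: (eqVneq (g 0 (xv0 r)) 0) => [e0|g00] /= h.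
  apply: (prop (u 0 (xv1 r) / g 0 (xv1 r))); last by rewrite divfK.
  by move/eqP: e; rewrite e0 mulr0 mulf_eq0 (negPf h) orbF mulr0 => /eqP.
apply: (prop (u 0 (xv0 r) / g 0 (xv0 r))); first by rewrite divfK.
by apply: (mulIf g00); rewrite mulrAC divfK // -e.
Qed.

Section Line.
Variables (i j : 'I_3) (g g' : 'rV[K]_6).
Hypotheses (ij : i != j) (gi : of_type i g) (gj : of_type j g') (g0 : g != 0) (g0' : g' != 0).

Lemma vanishing_on_line a u : of_type a u -> u != 0 ->
  (forall v, is_point v -> in_locus2 (linform g) (linform g') v -> (linform u).@[v] = 0) ->
  a = i /\ normv u = normv g \/ a = j /\ normv u = normv g'.
Proof.
move=> ua u0 van.
(* A point of the line whose coordinates of any type other than [i] and [j] avoid the zero of [u],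
   so that [u] must have type [i] or [j]. *)
pose z r := if r == i then root_of i g else if r == j then root_of j g' else nonroot_of r u.
have zp : is_point (mkpoint z).
  apply: mkpoint_is_point => r; rewrite /z; case: ifP => _; first exact: root_of_neq0.
  by case: ifP => _; [apply: root_of_neq0 | apply: nonroot_of_neq0].
have zj : z j = root_of j g' by rewrite /z eq_sym (negPf ij) eqxx.
have := van _ zp; rewrite (eval_mkpoint _ ua) /in_locus2 (eval_mkpoint _ gi) (eval_mkpoint _ gj).
rewrite zj {1 2}/z eqxx !root_ofP => /(_ (conj erefl erefl)).
have [ai|ai] := eqVneq a i.
  rewrite ai in ua *; by rewrite /z eqxx => /(same_root ua gi u0 g0) ?; left.
have [aj|aj] := eqVneq a j.
  rewrite aj in ua *; by rewrite zj => /(same_root ua gj u0 g0') ?; right.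
rewrite /z (negPf ai) (negPf aj) => /eqP.
by rewrite (negPf (nonroot_ofP ua u0)).
Qed.

(** Excludes that the two forms cutting out a line are both proportional to [g]: their common zeros
    would not lie in the zeros of [g']. *)
Lemma not_same_type u u' : normv u = normv g -> normv u' = normv g ->
  of_type i u -> of_type i u' -> u != 0 -> u' != 0 ->
  exists2 v, is_point v & in_locus2 (linform u) (linform u') v /\ (linform g').@[v] != 0.
Proof.
move=> ug ug' ui ui' u0 u0'.
pose z r := if r == i then root_of i g else nonroot_of r g'.
exists (mkpoint z).
  apply: mkpoint_is_point => r; rewrite /z; case: ifP => _; first exact: root_of_neq0.
  exact: nonroot_of_neq0.
have zer w : normv w = normv g -> of_type i w -> w != 0 -> (linform w).@[mkpoint z] = 0.
  move=> wg wi w0; rewrite (eval_mkpoint _ wi) /z eqxx.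
  have [c c0 e] := normvE w0; have [d d0 e'] := normvE g0.
  have -> : w = (c / d) *: g by rewrite [in RHS]e' scalerA divfK // -wg.
  by rewrite !mxE -!mulrA -!mulrDr root_ofP !mulr0.
split; first by split; apply: zer.
have zj : z j = nonroot_of j g' by rewrite /z eq_sym (negPf ij).
by rewrite (eval_mkpoint _ gj) zj nonroot_ofP.
Qed.

End Line.

Lemma same_locus2P i j a b g g' u u' : i != j -> of_type i g -> of_type j g' ->
  of_type a u -> of_type b u' -> g != 0 -> g' != 0 -> u != 0 -> u' != 0 ->
  same_locus2 (linform u) (linform u') (linform g) (linform g') <->
  (normv u = normv g /\ normv u' = normv g') \/ (normv u = normv g' /\ normv u' = normv g).
Proof.
move=> ij gi gj ua ub g0 g0' u0 u0'; split=> [same|]; last first.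
  have zer w w' v : normv w = normv w' -> w != 0 -> w' != 0 ->
      (linform w).@[v] = 0 <-> (linform w').@[v] = 0.
    move=> e w0 w0'; have [c c0 ew] := normvE w0; have [d d0 ew'] := normvE w0'.
    have -> : (linform w).@[v] = c * (linform (normv w')).@[v].
      by rewrite [in LHS]ew linearZ /= mevalZ e.
    have -> : (linform w').@[v] = d * (linform (normv w')).@[v].
      by rewrite [in LHS]ew' linearZ /= mevalZ.
    by split=> /eqP; rewrite mulf_eq0 ?(negPf c0) ?(negPf d0) /= => /eqP->; rewrite mulr0.
  case=> [[e e'] v _|[e e'] v _]; rewrite /in_locus2.
    by rewrite (zer _ _ v e) // (zer _ _ v e').
  by rewrite (zer _ _ v e) // (zer _ _ v e') //; split=> -[].
have van := vanishing_on_line ij gi gj g0 g0'.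
have [[ai ug]|[aj ug]] := van _ _ ua u0 (fun v vp l => proj1 ((same v vp).2 l));
  have [[bi ug']|[bj ug']] := van _ _ ub u0' (fun v vp l => proj2 ((same v vp).2 l)).
- rewrite ai bi in ua ub; have [v vp [vu]] := not_same_type ij gi gj g0 g0' ug ug' ua ub u0 u0'.
  by case: (same v vp) => /(_ vu)[_ ->]; rewrite eqxx.
- by left.
- by right.
- rewrite aj bj in ua ub; have ji : j != i by rewrite eq_sym.
  have [v vp [vu]] := not_same_type ji gj gi g0' g0 ug ug' ua ub u0 u0'.
  by case: (same v vp) => /(_ vu)[-> _]; rewrite eqxx.
Qed.

End Loci.

(** * The graph of a variety of lines *)

Section LineGraph.
Variable K : fieldType.
Implicit Types (X : seq (Rpoly K * Rpoly K)) (H G f : Rpoly K) (u w : 'rV[K]_6).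

Definition coefv H : 'rV[K]_6 := \row_k H@_U_(k).

Lemma coefv_linform u : coefv (linform u) = u.
Proof. by apply/rowP => k; rewrite mxE linform_coef. Qed.

Lemma lformP i H : is_lform i H ->
  [/\ of_type vtype i (coefv H), coefv H != 0 & linform (coefv H) = H].
Proof.
move=> [a [b [ab def_H]]]; pose u : 'rV[K]_6 := a *: delta_mx 0 (xv0 i) + b *: delta_mx 0 (xv1 i).
have HE : H = linform u by rewrite linearD !linearZ /= !linform_delta.
rewrite HE coefv_linform; split=> //.
  move=> k ki; rewrite !mxE eqxx /=.
  have -> : (k == xv0 i) = false by apply: contraNF ki => /eqP->; rewrite vtype0.
  have -> : (k == xv1 i) = false by apply: contraNF ki => /eqP->; rewrite vtype1.
  by rewrite !mulr0 addr0.
apply/eqP => u0; have := congr1 (fun w : 'rV[K]_6 => w 0 (xv0 i)) u0.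
have := congr1 (fun w : 'rV[K]_6 => w 0 (xv1 i)) u0; rewrite !mxE !eqxx /= (negPf (xv01 i)).
rewrite eq_sym (negPf (xv01 i)) /= !mulr0 !mulr1 add0r addr0 => b0 a0.
by move: ab; rewrite a0 b0 eqxx.
Qed.

Lemma lform_linform i u : of_type vtype i u -> u != 0 -> is_lform i (linform u).
Proof.
move=> ui u0; exists (u 0 (xv0 i)), (u 0 (xv1 i)); split; last exact: linform_type.
exact: of_type_neq0.
Qed.

Definition node H : 'rV[K]_6 := normv (coefv H).

Definition typev (u : 'rV[K]_6) : 'I_3 :=
  if [pick k | u 0 k != 0] is Some k then vtype k else ord0.

Lemma typevE i u : of_type vtype i u -> u != 0 -> typev u = i.
Proof.
move=> ui u0; rewrite /typev; case: pickP => [k uk|z].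
  by apply/eqP; apply: contraNT uk => /ui->.
by case/negP: u0; apply/eqP/rowP => k; have := z k; rewrite mxE => /negbFE/eqP.
Qed.

Lemma normv_type i u : of_type vtype i u -> of_type vtype i (normv u).
Proof.
move=> ui k ki; rewrite /normv; case: pickP => [l _|_]; last exact: ui.
by rewrite mxE (ui k ki) mulr0.
Qed.

Lemma node_type i H : is_lform i H -> of_type vtype i (node H) /\ node H != 0.
Proof. by move=> /lformP[Hi H0 _]; split; [apply: normv_type | apply: normv_neq0]. Qed.

Lemma node_scale i H : is_lform i H -> exists2 c : K, c != 0 & H = c *: linform (node H).
Proof.
move=> /lformP[_ H0 HE]; have [c c0 e] := normvE H0; exists c => //.
by rewrite -{1}HE {1}e linearZ.
Qed.

Variable X : seq (Rpoly K * Rpoly K).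
Hypothesis linesX : forall L, L \in X ->
  exists i j : 'I_3, i != j /\ is_lform i L.1 /\ is_lform j L.2.

Definition nodes : seq 'rV[K]_6 := map node (map fst X ++ map snd X).
Definition vertex : finType := seq_sub nodes.
Definition vvec (v : vertex) : 'rV[K]_6 := val v.
Definition vty (v : vertex) : 'I_3 := typev (vvec v).
Definition edgev (u w : 'rV[K]_6) : bool :=
  has (fun L => ((node L.1 == u) && (node L.2 == w)) || ((node L.1 == w) && (node L.2 == u))) X.
Definition vedge : rel vertex := fun p q => edgev (vvec p) (vvec q).

Lemma nodesP u : u \in nodes -> exists H i, is_lform i H /\ u = node H.
Proof.
case/mapP => H; rewrite mem_cat => /orP[]/mapP[L LX ->] ->;
  have [i [j [_ [Li Lj]]]] := linesX LX; [by exists L.1, i | by exists L.2, j].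
Qed.

Lemma vvec_props (v : vertex) : [/\ of_type vtype (vty v) (vvec v), vvec v != 0 & normv (vvec v) = vvec v].
Proof.
have [H [i [Hi e]]] := nodesP (valP v); rewrite /vty /vvec e.
have [nt n0] := node_type Hi; rewrite (typevE nt n0); split=> //.
by have [_ H0 _] := lformP Hi; apply: normvK.
Qed.

Lemma vvec_indep (u v : vertex) : u != v -> ~~ (vvec u <= vvec v)%MS.
Proof.
have [_ u0 nu] := vvec_props u; have [_ _ nv] := vvec_props v.
apply: contra => /(normv_sub u0) e; apply/eqP/val_inj.
by rewrite -[val u]nu -[val v]nv.
Qed.

Lemma edgevC u w : edgev u w = edgev w u.
Proof. by apply: eq_has => L; rewrite orbC. Qed.

Lemma vedgeC (u v : vertex) : vedge u v = vedge v u.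
Proof. exact: edgevC. Qed.

Lemma vedge_ty (u v : vertex) : vedge u v -> vty u != vty v.
Proof.
case/hasP => L LX; have [i [j [ij [Li Lj]]]] := linesX LX.
have [ti i0] := node_type Li; have [tj j0] := node_type Lj.
by rewrite /vty => /orP[]/andP[/eqP<- /eqP<-]; rewrite (typevE ti i0) (typevE tj j0) // eq_sym.
Qed.

Lemma mem_nodes L : L \in X -> node L.1 \in nodes /\ node L.2 \in nodes.
Proof.
by move=> LX; split; apply: map_f; rewrite mem_cat; apply/orP; [left|right]; apply: map_f.
Qed.

Lemma line_linideal L f : L \in X ->
  (exists a b, f = a * L.1 + b * L.2) <-> linideal (node L.1 + node L.2)%MS f.
Proof.
move=> LX; have [i [j [_ [Li Lj]]]] := linesX LX.
have [c c0 e1] := node_scale Li; have [d d0 e2] := node_scale Lj.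
split=> [[a [b ->]]|/linideal_adds[m [b [/linidealP[q ->] ->]]]].
  have idL := linideal_ideal (node L.1 + node L.2)%MS.
  have -> : a * L.1 + b * L.2 = (a * c%:MP) * linform (node L.1) + (b * d%:MP) * linform (node L.2).
    by rewrite {1}e1 {1}e2 -!mul_mpolyC !mulrA.
  apply: (idealD idL); apply: (idealMl idL); apply/linideal_lin; first exact: addsmxSl.
  exact: addsmxSr.
have E1 : c^-1%:MP * L.1 = linform (node L.1).
  by rewrite {1}e1 mul_mpolyC scalerA mulVf // scale1r.
have E2 : d^-1%:MP * L.2 = linform (node L.2).
  by rewrite {1}e2 mul_mpolyC scalerA mulVf // scale1r.
by exists (q 0 * c^-1%:MP), (b * d^-1%:MP); rewrite big_ord1 row_id -!mulrA E1 E2.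
Qed.

Lemma ideal_of_lines f : ideal_of X f <->
  (forall u v : vertex, vedge u v -> linideal (vvec u + vvec v)%MS f).
Proof.
split=> [If u v /hasP[L LX]|If L LX].
  have /(line_linideal f LX) Lf := If L LX.
  case/orP => /andP[/eqP<- /eqP<-]; first exact: Lf.
  by apply: linideal_sub Lf; rewrite addsmxC.
apply/(line_linideal f LX); have [n1 n2] := mem_nodes LX.
apply: (If (SeqSub n1) (SeqSub n2)); apply/hasP; exists L => //.
by rewrite !eqxx.
Qed.

Lemma line_ofE H G a b : is_lform a H -> is_lform b G ->
  line_of X H G <-> edgev (node H) (node G).
Proof.
move=> Ha Gb; have [tH H0 HE] := lformP Ha; have [tG G0 GE] := lformP Gb.
have key L : L \in X -> same_locus2 H G L.1 L.2 <->
    (node L.1 == node H) && (node L.2 == node G) || (node L.1 == node G) && (node L.2 == node H).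
  move=> LX; have [i [j [ij [Li Lj]]]] := linesX LX.
  have [ti i0 iE] := lformP Li; have [tj j0 jE] := lformP Lj.
  rewrite -{1}HE -{1}GE -{1}iE -{1}jE (same_locus2P ij ti tj tH tG i0 j0 H0 G0) /node.
  split=> [[[-> ->]|[-> ->]]|/orP[]/andP[/eqP-> /eqP->]]; rewrite ?eqxx ?orbT //; by [left|right].
split=> [[L [LX /(key L LX) e]]|/hasP[L LX e]]; first by apply/hasP; exists L.
by exists L; split=> //; apply/key.
Qed.

Lemma edgev_nodes u w : edgev u w -> (u \in nodes) && (w \in nodes).
Proof.
by case/hasP => L /mem_nodes[n1 n2] /orP[]/andP[/eqP<- /eqP<-]; rewrite n1 n2.
Qed.

Definition no_antihole n : Prop := forall w : 'I_n -> vertex,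
  (forall i j : 'I_n, far n i j -> vedge (w i) (w j)) ->
  exists i j : 'I_n, val j = (i.+1 %% n)%N /\ vedge (w i) (w j).

(** The property ranges over all hyperplanes, the graph only over those through lines of [X]. For
    [n >= 4] each [H i] forms a line with the hyperplane two places further, so it is a vertex. *)
Lemma Hyp_star_graph n : (4 <= n)%N -> Hyp_star n X <-> no_antihole n.
Proof.
move=> n4; split=> [hyp w wE|hole H Hhyp HE].
  have lf v : is_lform (vty v) (linform (vvec v)).
    by have [tv v0 _] := vvec_props v; apply: lform_linform.
  have nd v : node (linform (vvec v)) = vvec v.
    by rewrite /node coefv_linform; have [] := vvec_props v.
  have [||i [j [ij Lij]]] := hyp (fun i => linform (vvec (w i))).
  - by move=> i; exists (vty (w i)); apply: lf.
  - move=> i j ji /eqP jS /eqP iS; apply/(line_ofE (lf _) (lf _)); rewrite !nd.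
    by apply: wE; rewrite /far eq_sym -val_eqE /= in ji *; rewrite ji jS iS.
  exists i, j; split=> //; move/(line_ofE (lf _) (lf _)): Lij; rewrite !nd.
  exact.
have HN i : node (H i) \in nodes.
  have n0 : (0 < n)%N by apply: leq_trans n4.
  pose k := Ordinal (ltn_pmod (i + 2) n0).
  have [mod1 mod2 mod3] : [/\ (i.+1 %% n != (i + 2) %% n)%N, ((i + 2) %% n != i)%N &
      (((i + 2) %% n).+1 %% n != i)%N].
    have ii : (i : nat) = ((i + 0) %% n)%N by rewrite addn0 modn_small.
    have neq a b : (a < n)%N -> (b < n)%N -> a != b -> ((i + a) %% n != (i + b) %% n)%N.
      by move=> an bn ab; rewrite eqn_modDl !modn_small.
    split.
    - by rewrite -addn1; apply: neq => //; apply: leq_trans n4.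
    - by rewrite [X in _ != X]ii; apply: neq => //; apply: leq_trans n4.
    - rewrite -addn1 modnDml -addnA [X in _ != X]ii; apply: neq => //; exact: leq_trans n4.
  have [a Ha] := Hhyp i; have [b Hb] := Hhyp k.
  have : line_of X (H i) (H k).
    apply: HE; first by rewrite -val_eqE.
      by move=> e; rewrite /= in e; rewrite e eqxx in mod1.
    by move=> e; rewrite /= -e eqxx in mod3.
  by move/(line_ofE Ha Hb)/edgev_nodes/andP=> [].
have [|i [j [ij e]]] := hole (fun i => SeqSub (HN i)).
  move=> i j /and3P[ij jS iS]; have [a Ha] := Hhyp i; have [b Hb] := Hhyp j.
  apply/(line_ofE Ha Hb)/HE; first by rewrite eq_sym -val_eqE.
    exact/eqP.
  exact/eqP.
by exists i, j; split=> //; have [a Ha] := Hhyp i; have [b Hb] := Hhyp j; apply/(line_ofE Ha Hb).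
Qed.

Lemma no_antihole4E : no_antihole 4 <-> no_antihole4 vedge.
Proof.
split=> [hole a b c d ac bd|hole w wE].
  have [|i [j [ij e]]] := hole (fun i => nth a [:: a; b; c; d] i).
    by do 2![case=> [[|[|[|[|?]]]] ?] //]; rewrite // /far /= => _; rewrite // vedgeC.
  by case: i j ij e => [[|[|[|[|?]]]] ?] // [[|[|[|[|?]]]] ?] //= _ ->; rewrite ?orbT.
pose o k (lt : (k < 4)%N) := Ordinal lt.
pose o0 := o 0 isT; pose o1 := o 1 isT; pose o2 := o 2 isT; pose o3 := o 3 isT.
by have /or4P[] := hole (w o0) (w o1) (w o2) (w o3) (wE o0 o2 isT) (wE o1 o3 isT);
  [exists o0, o1 | exists o1, o2 | exists o2, o3 | exists o3, o0].
Qed.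

Lemma no_antihole5E : no_antihole 5 <-> no_antihole5 vedge.
Proof.
split=> [hole a b c d e ac ad bd be ce|hole w wE].
  have [|i [j [ij Eij]]] := hole (fun i => nth a [:: a; b; c; d; e] i).
    by do 2![case=> [[|[|[|[|[|?]]]]] ?] //]; rewrite // /far /= => _; rewrite // vedgeC.
  by case: i j ij Eij => [[|[|[|[|[|?]]]]] ?] // [[|[|[|[|[|?]]]]] ?] //= _ ->; rewrite ?orbT.
pose o k (lt : (k < 5)%N) := Ordinal lt.
pose o0 := o 0 isT; pose o1 := o 1 isT; pose o2 := o 2 isT; pose o3 := o 3 isT.
pose o4 := o 4 isT.
by have /or4P[|||/orP[]] := hole (w o0) (w o1) (w o2) (w o3) (w o4) (wE o0 o2 isT) (wE o0 o3 isT)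
    (wE o1 o3 isT) (wE o1 o4 isT) (wE o2 o4 isT);
  [exists o0, o1 | exists o1, o2 | exists o2, o3 | exists o3, o4 | exists o4, o0].
Qed.

Lemma no_antihole6E : no_antihole 6 <-> no_antihole6 vedge.
Proof.
split=> [hole a b c d e f ac ad ae bd be bf ce cf df|hole w wE].
  have [|i [j [ij Eij]]] := hole (fun i => nth a [:: a; b; c; d; e; f] i).
    by do 2![case=> [[|[|[|[|[|[|?]]]]]] ?] //]; rewrite // /far /= => _; rewrite // vedgeC.
  by case: i j ij Eij => [[|[|[|[|[|[|?]]]]]] ?] // [[|[|[|[|[|[|?]]]]]] ?] //= _ ->;
    rewrite ?orbT.
pose o k (lt : (k < 6)%N) := Ordinal lt.
pose o0 := o 0 isT; pose o1 := o 1 isT; pose o2 := o 2 isT; pose o3 := o 3 isT.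
pose o4 := o 4 isT; pose o5 := o 5 isT.
by have /or4P[|||/or3P[]] := hole (w o0) (w o1) (w o2) (w o3) (w o4) (w o5)
    (wE o0 o2 isT) (wE o0 o3 isT) (wE o0 o4 isT) (wE o1 o3 isT) (wE o1 o4 isT)
    (wE o1 o5 isT) (wE o2 o4 isT) (wE o2 o5 isT) (wE o3 o5 isT);
  [exists o0, o1 | exists o1, o2 | exists o2, o3 | exists o3, o4 | exists o4, o5 | exists o5, o0].
Qed.

End LineGraph.

(** The slopes at which [avec] becomes proportional to [h v] are roots of the nonzero polynomial
    [P v]; a non-root of the product serves for all [v]. *)
Lemma general_slope (K : closedFieldType) (T : finType) (ty : T -> 'I_3) (h : T -> 'rV[K]_6) :
  (forall v, of_type vtype (ty v) (h v)) -> (forall v, h v != 0) ->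
  exists tau, forall r v, ~~ (avec xv0 xv1 tau r <= h v)%MS.
Proof.
move=> h_ty h0.
pose P v : {poly K} := (h v 0 (xv1 (ty v))) *: 'X - (h v 0 (xv0 (ty v)))%:P.
have : \prod_v P v != 0.
  apply/prodf_neq0 => v _; apply/eqP => P0.
  have := of_type_neq0 (h_ty v) (h0 v).
  have := congr1 (fun p : {poly K} => p`_0) P0; have := congr1 (fun p : {poly K} => p`_1) P0.
  rewrite !coefB !coefZ !coefX !coefC /= !mulr0 mulr1 subr0 sub0r => -> /eqP.
  by rewrite oppr_eq0 => ->; rewrite eqxx.
case/closed_nonrootP => tau Ptau; exists tau => r v; apply: contra Ptau => /sub_rVP[c e].
have ce k : avec xv0 xv1 tau r 0 k = c * h v 0 k by rewrite e mxE.
have e1 : 1 = c * h v 0 (xv1 r) by rewrite -ce (avec_x1 xv01).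
have e0 : tau = c * h v 0 (xv0 r).
  by rewrite -ce !mxE !eqxx /= (negPf (xv01 r)) mulr1 add0r.
have rv : r = ty v.
  apply/eqP; apply: contraT => rv; have := e1; rewrite h_ty ?vtype1 // mulr0.
  by move/eqP; rewrite oner_eq0.
rewrite rv in e1 e0 *; rewrite rootE horner_prod (bigD1 v) //=.
rewrite [X in X * _](_ : _ = 0) ?mul0r //.
by rewrite hornerD hornerN hornerZ hornerX hornerC e0 mulrCA mulrA -e1 mul1r subrr.
Qed.

Theorem theorem2p17 (K : closedFieldType) (hK : [pchar K] =i pred0)
  (X : seq (Rpoly K * Rpoly K)) (hX : variety_of_lines X) :
  ACM X <-> (Hyp_star 4 X /\ Hyp_star 5 X /\ Hyp_star 6 X).
Proof.
have [linesX _] := hX.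
rewrite !(Hyp_star_graph linesX) // no_antihole4E no_antihole5E no_antihole6E.
have -> : ACM X <-> cohen_macaulay (line_ideal (@vedge K X) (@vvec K X)).
  rewrite /ACM (_ : ideal_of X = line_ideal (@vedge K X) (@vvec K X)) //.
  apply: functional_extensionality => f; apply: propositional_extensionality.
  exact: ideal_of_lines.
have symE := @vedgeC K X; have Ety := vedge_ty linesX.
set E := @vedge K X in symE Ety *; set h := @vvec K X.
have h_ty v : of_type vtype (vty v) (h v) by have [] := vvec_props linesX v.
have h0 v : h v != 0 by have [] := vvec_props linesX v.
have h_ind (u v : vertex X) : u != v -> vty u = vty v -> ~~ (h u <= h v)%MS.
  by move=> uv _; apply: vvec_indep.
have h_edge u v : E u v -> ~~ (h v <= h u)%MS.
  by move=> Euv; apply: vvec_indep => //; apply: contraTneq (Ety _ _ Euv) => ->; rewrite eqxx.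
have h_gen' u v w : E u v -> w != u -> w != v -> ~~ (h w <= h u + h v)%MS.
  by move=> /Ety; apply: (h_gen h_ty h0 h_ind).
have irr := irrE Ety.
split=> [[I1|[d [dimd [fs [szfs [fs0 [reg _]]]]]]]|[h4 [h5 h6]]].
(* The ideal is the whole ring only when there are no lines, and then the premises on antiholes
   cannot hold. *)
- have noE u v : E u v -> False by move=> /I1; apply: linideal1.
  by split; [|split]; move=> a b c *; exfalso; apply: (@noE a c).
- have [/existsP[u /existsP[v Euv]]|] := boolP [exists u, exists v, E u v]; last first.
    rewrite negb_exists => /forallP noE.
    have {}noE u v : E u v -> False.
      by move=> Euv; have := noE u; rewrite negb_exists => /forallP/(_ v); rewrite Euv.
    by split; [|split]; move=> a b c *; exfalso; apply: (@noE a c).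
  have d4 := (line_dim h_gen' h0 h_edge d Euv).1 dimd.
  have idI := line_ideal_ideal E h.
  have depth4 : exists fs : seq (Rpoly K), [/\ size fs = 4%N, forall f, f \in fs -> f@_0%MM = 0 &
      forall k, (k < 4)%N -> regular (adjoins (line_ideal E h) (take k fs)) (nth 0 fs k)].
    exists fs; split=> //; first by rewrite szfs.
    move=> k k4 w /(in_ideal_plusP _ _ idI) aw; apply/(in_ideal_plusP _ _ idI).
    by apply: reg aw; rewrite szfs d4.
  have [tau tauP] := general_slope h_ty h0.
  have nE := lines_nested vtype0 vtype1 xv01 xvP h_ty h0 h_ind tauP symE Ety depth4.
  have tE := lines_tight vtype0 vtype1 xv01 xvP h_ty h0 h_ind tauP symE Ety depth4.
  split; first exact: (tight_no_antihole4 symE Ety nE tE).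
  split; first exact: (tight_no_antihole5 symE Ety nE tE).
  exact: (tight_no_antihole6 symE Ety nE tE).
apply: lines_cohen_macaulay => // U U0.
have [v [vU sv]] := simplicial_exists symE Ety h4 h5 h6 U0.
by exists v.
Qed.
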